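(* Let $A$ be a valuation ring with maximal ideal $\mathfrak m$ and residue field $k=A/\mathfrak m$, and assume $2\in A^\times$. Let $K$ be the quotient field of $A$. For $n\geq 1$ consider the map $$H_i(O_n(A);\mathbb Z)\to H_i(O_{n+1}(A);\mathbb Z)$$ induced by the homomorphism $O_n(A)\to O_{n+1}(A)$, $f\mapsto f\oplus \mathrm{id}_A$ (block sum with the identity on the last coordinate). Then this map is (i) a surjection for $i\leq \frac{n-m_A-1}{3}$ and an isomorphism for $i\leq\frac{n-m_A-2}{3}$ if $m_A<\infty$; (ii) a surjection for $i\leq\frac{n-m_A}{2}$ and an isomorphism for $i\leq\frac{n-m_A-1}{2}$ if $m_A<\infty$ and $A$ is formally real; (iii) a surjection for $i\leq\frac{n-3-2P(k)}{2P(k)+1}$ and an isomorphism for $i\leq\frac{n-4-2P(k)}{2P(k)+1}$ if $A$ is henselian and $P(k)<\infty$; (iv) a surjection for $i\leq\frac{n-2-P(k)}{P(k)+1}$ and an isomorphism for $i\leq\frac{n-3-P(k)}{P(k)+1}$ if $A$ is henselian, $k$ is formally real, and $P(k)<\infty$; (v) a surjection for $i\leq\frac{n-m_K-1}{3}$ and an isomorphism for $i\leq\frac{n-m_K-2}{3}$ if $m_K<\infty$; (vi) a surjection for $i\leq\frac{n-m_K}{2}$ and an isomorphism for $i\leq\frac{n-m_K-1}{2}$ if $K$ is formally real and $m_K<\infty$; (vii) a surjection for $i\leq\frac{n-3-2P(K)}{2P(K)+1}$ and an isomorphism for $i\leq\frac{n-4-2P(K)}{2P(K)+1}$ if $P(K)<\infty$;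 (viii) a surjection for $i\leq\frac{n-2-P(K)}{P(K)+1}$ and an isomorphism for $i\leq\frac{n-3-P(K)}{P(K)+1}$ if $K$ is formally real and $P(K)<\infty$.
   Context: A quadratic module over a commutative ring $R$ is a pair $(V,q)$ with $V$ a finitely generated projective $R$-module and $q:V\to R$ a function with $q(ax)=a^2q(x)$ such that $B_q(x,y)=q(x+y)-q(x)-q(y)$ is bilinear; it is non-singular if $x\mapsto B_q(x,-)$ is an isomorphism $V\to\mathrm{Hom}_R(V,R)$. A quadratic submodule of $(V,q)$ is a direct summand $U\subseteq V$ with the restricted form. $\mathbb E^n_R=(R^n,x_1^2+\dots+x_n^2)$ and $O_n(R)$ is the group of $R$-linear automorphisms of $R^n$ preserving this form. A unit vector is $v$ with $q(v)=1$. For a local ring $A$ with maximal ideal $\mathfrak m$ and residue field $k$, $m_A\in\mathbb Z_{\geq1}\cup\{\infty\}$ is the smallest $m$ such that every non-singular quadratic submodule $V$ of $\mathbb E^n_A$ (any $n$) with $\dim_k V/\mathfrak mV\geq m$ contains a unit vector; for a field $K$, $m_K$ is this invariant with $A=K$. The Pythagoras number $P(R)$ is the smallest $p\geq1$ such that every sum of squares in $R$ is a sum of $p$ squares ($\infty$ if none exists). A ring (or field) is formally real if $-1$ is not a sum of squares in it. A local ring $A$ with residue field $k$ is henselian if for every $f\in A[X]$ and $\alpha\in k$ with $\bar f(\alpha)=0$, $\bar f'(\alpha)\neq0$, there is $a\in A$ with $f(a)=0$ and $\bar a=\alpha$. A valuation ring is an integral domain $A$ with fraction field $K$ such that for every $x\in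 K^\times$, $x\in A$ or $x^{-1}\in A$. *)

(* Defs.v *)
From HB Require Import structures.
From mathcomp Require Import all_boot all_order all_algebra.
From mathcomp Require Import fraction.
Set Implicit Arguments. Unset Strict Implicit. Unset Printing Implicit Defensive.
Import Order.TTheory GRing.Theory Num.Theory.
Local Open Scope ring_scope.

(* Integral group homology via the (normalized-free) bar complex.      *)
(* Chains of degree i of a group G (with elements in an eqType T and   *)
(* multiplication mul) are formal Z-linear combinations of i-tuples of *)
(* elements of G, represented as lists of (coefficient, tuple) pairs;  *)
(* two lists denote the same chain iff they have the same coefficient  *)
(* function [chain_coef].                                              *)
Section BarComplex.
Variables (T : eqType) (mul : T -> T -> T).

Definition chain := seq (int * seq T).

Definition chain_coef (c : chain) (t : seq T) : int :=
  \sum_(x <- c | x.2 == t) x.1.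

Definition bar_face (s : seq T) (j : nat) : seq T :=
  if j == 0%N then behead s
  else if j == size s then take (size s).-1 s
  else if s is g0 :: _ then
    take j.-1 s ++ mul (nth g0 s j.-1) (nth g0 s j) :: drop j.+1 s
  else [::].

Definition bar_bd_gen (s : seq T) : chain :=
  if s is [::] then [::]
  else [seq (((-1) ^+ j : int), bar_face s j) | j <- iota 0 (size s).+1].

Definition bar_bd (c : chain) : chain :=
  flatten [seq [seq (x.1 * e.1, e.2) | e <- bar_bd_gen x.2] | x <- c].

Definition chain_sub (c c' : chain) : chain :=
  c ++ [seq (- x.1, x.2) | x <- c'].

Definition is_chain (G : T -> Prop) (i : nat) (c : chain) : Prop :=
  forall x, x \in c -> size x.2 = i /\ (forall g, g \in x.2 -> G g).

Definition is_cycle (G : T -> Prop) (i : nat) (c : chain) : Prop :=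
  is_chain G i c /\ forall t, chain_coef (bar_bd c) t = 0.

Definition is_boundary (G : T -> Prop) (i : nat) (c : chain) : Prop :=
  exists w, is_chain G i.+1 w /\ forall t, chain_coef (bar_bd w) t = chain_coef c t.

End BarComplex.

Definition map_chain (T1 T2 : eqType) (f : T1 -> T2) (c : chain T1) : chain T2 :=
  [seq (x.1, map f x.2) | x <- c].

Definition hom_surj (T1 T2 : eqType) (mul1 : T1 -> T1 -> T1) (mul2 : T2 -> T2 -> T2)
    (G : T1 -> Prop) (H : T2 -> Prop) (f : T1 -> T2) (i : nat) : Prop :=
  forall z', is_cycle mul2 H i z' ->
    exists z, is_cycle mul1 G i z /\ is_boundary mul2 H i (chain_sub z' (map_chain f z)).

Definition hom_inj (T1 T2 : eqType) (mul1 : T1 -> T1 -> T1) (mul2 : T2 -> T2 -> T2)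
    (G : T1 -> Prop) (H : T2 -> Prop) (f : T1 -> T2) (i : nat) : Prop :=
  forall z, is_cycle mul1 G i z -> is_boundary mul2 H i (map_chain f z) ->
    is_boundary mul1 G i z.

Section Quad.
Variable R : comUnitRingType.

Definition qstd (n : nat) (x : 'rV[R]_n) : R := \sum_(j < n) x 0 j ^+ 2.
Definition Bstd (n : nat) (x y : 'rV[R]_n) : R := qstd (x + y) - qstd x - qstd y.

Definition orth (n : nat) (M : 'M[R]_n) : Prop :=
  M \in unitmx /\ forall x : 'rV[R]_n, qstd (x *m M) = qstd x.

Definition is_submodule (n : nat) (V : 'rV[R]_n -> Prop) : Prop :=
  V 0 /\ forall (a : R) x y, V x -> V y -> V (a *: x + y).

Definition direct_summand (n : nat) (V : 'rV[R]_n -> Prop) : Prop :=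
  is_submodule V /\ exists W : 'rV[R]_n -> Prop, is_submodule W /\
    (forall x, exists v w, V v /\ W w /\ x = v + w) /\
    (forall x, V x -> W x -> x = 0).

Definition nonsingular (n : nat) (V : 'rV[R]_n -> Prop) : Prop :=
  (forall x, V x -> (forall y, V y -> Bstd x y = 0) -> x = 0) /\
  (forall phi : 'rV[R]_n -> R,
     (forall (a : R) x y, V x -> V y -> phi (a *: x + y) = a * phi x + phi y) ->
     exists x, V x /\ forall y, V y -> phi y = Bstd x y).

(* the maximal ideal of a local ring = its non-units *)
Definition maxid (a : R) : Prop := ~~ (a \is a GRing.unit).

Definition in_mV (n : nat) (V : 'rV[R]_n -> Prop) (x : 'rV[R]_n) : Prop :=
  exists (r : nat) (c : 'I_r -> R) (w : 'I_r -> 'rV[R]_n),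
    (forall j, maxid (c j) /\ V (w j)) /\ x = \sum_(j < r) c j *: w j.

(* dim_k V/mV >= d *)
Definition resdim_ge (n : nat) (V : 'rV[R]_n -> Prop) (d : nat) : Prop :=
  exists v : 'I_d -> 'rV[R]_n, (forall j, V (v j)) /\
    forall a : 'I_d -> R, in_mV V (\sum_(j < d) a j *: v j) -> forall j, maxid (a j).

Definition unitvec_prop (d : nat) : Prop :=
  forall (n : nat) (V : 'rV[R]_n -> Prop), direct_summand V -> nonsingular V ->
    resdim_ge V d -> exists v, V v /\ qstd v = 1.

Definition is_m_inv (d : nat) : Prop :=
  (1 <= d)%N /\ unitvec_prop d /\ forall d', (1 <= d')%N -> unitvec_prop d' -> (d <= d')%N.

Definition pyth_le (p : nat) : Prop :=
  forall l : seq R, exists l' : seq R, size l' = p /\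
    \sum_(x <- l) x ^+ 2 = \sum_(x <- l') x ^+ 2.
Definition is_pyth (p : nat) : Prop :=
  (1 <= p)%N /\ pyth_le p /\ forall p', (1 <= p')%N -> pyth_le p' -> (p <= p')%N.

Definition formally_real : Prop := forall l : seq R, \sum_(x <- l) x ^+ 2 <> -1.

(* Same notions for the residue field k = R/m, unfolded *)
Definition pyth_le_res (p : nat) : Prop :=
  forall l : seq R, exists l' : seq R, size l' = p /\
    maxid (\sum_(x <- l) x ^+ 2 - \sum_(x <- l') x ^+ 2).
Definition is_pyth_res (p : nat) : Prop :=
  (1 <= p)%N /\ pyth_le_res p /\ forall p', (1 <= p')%N -> pyth_le_res p' -> (p <= p')%N.

Definition formally_real_res : Prop :=
  forall l : seq R, ~ maxid (1 + \sum_(x <- l) x ^+ 2).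

Definition henselian : Prop :=
  forall (f : {poly R}) (al : R), maxid f.[al] -> ~ maxid (f^`()).[al] ->
    exists a, f.[a] = 0 /\ maxid (a - al).

End Quad.

Definition valuation_ring (A : idomainType) : Prop :=
  forall x : {fraction A}, x != 0 ->
    (exists a : A, x = FracField.tofrac a) \/ (exists a : A, x^-1 = FracField.tofrac a).

Definition stab (A : comUnitRingType) (n : nat) (M : 'M[A]_n) : 'M[A]_(n + 1) :=
  block_mx M 0 0 1%:M.

Definition stab_surj (A : comUnitRingType) (n i : nat) : Prop :=
  hom_surj (@mulmx A n n n) (@mulmx A (n + 1) (n + 1) (n + 1))
           (@orth A n) (@orth A (n + 1)) (@stab A n) i.

Definition stab_iso (A : comUnitRingType) (n i : nat) : Prop :=
  stab_surj A n i /\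
  hom_inj (@mulmx A n n n) (@mulmx A (n + 1) (n + 1) (n + 1))
          (@orth A n) (@orth A (n + 1)) (@stab A n) i.

Definition qle (i a b c d : nat) : Prop :=
  (i%:R : rat) <= (a%:R - b%:R - c%:R) / d%:R.

(* Main.v *)
(** Let O_n act on chains whose generators are pairs of an orthogonal frame in A^n and a simplex of
    the group. If the complex of frames is acyclic in a range, then, since O_n is transitive on
    frames of unit vectors of given length and each face of such a frame is carried to the next by
    a reflection centralizing its stabilizer, comparing the two filtrations of the total complex
    gives surjectivity and injectivity of stabilization by induction on the degree.

    Acyclicity: a cycle of frames is pushed, one position at a time, into the orthogonal complement
    of a given vector x. Over a valuation ring x is a multiple of a primitive h; if h has invertible
    length one splits it off, and otherwise h spans a nonsingular plane together with some letter.
    If k has more than three elements, unit vectors are enough as letters. If k has three elements,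
    vectors of length 2 (whose orthogonal pairs produce unit vectors) are admitted as letters too,
    and are removed afterwards by filtering frames according to their number of non-unit letters.

    Only the supply of unit vectors is special to the eight cases. A unit vector over K is brought
    down to A by intersecting the quadric with a secant line, as in the Cassels-Kneser argument;
    Hensel's lemma lifts representations as sums of squares from k. *)

(* The ranges come from counting room: [Ms B m] says that the constraints [B] leave room for [m]
   letters, where a letter takes one place and an arbitrary vector of invertible length takes [kap].
   Each degree spends one letter and one such vector, so the slope is [kap + 1]. When unit vectors
   are supplied by rank, [kap = 1]; when they come from sums of squares, a vector is exchanged for a
   combination of p orthonormal vectors of the same length, so [kap = p]. The obstacle is a pair of
   unit vectors e and v = b e + c h with h isotropic modulo the maximal ideal: their plane is
   degenerate there, and they can be compared only through a third letter f such that (h, f) and the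
   Gram determinants of f with e and with v are all invertible. If k has three elements, c is a unit
   and f is a unit vector, then (e, f) and (v, f) are not both 0 in k, and a nonzero value s gives 1
   - s^2 = 0. With f of length 2 = -1 the determinant is -1 - s^2, which never vanishes in that
   field. *)
Require Import Defs.
From HB Require Import structures.
From mathcomp Require Import all_boot all_order all_algebra.
From mathcomp Require Import fraction.
From Stdlib Require Import ClassicalEpsilon FunctionalExtensionality PropExtensionality Classical.
From mathcomp Require Import freeg ring zify.
Import Order.TTheory GRing.Theory Num.Theory.
Local Open Scope ring_scope.
Set Implicit Arguments. Unset Strict Implicit. Unset Printing Implicit Defensive.

(* Reflexive decision procedure for equations between formal combinations in an abelian group. *)
Inductive zexp := ZV of nat | Z0 | ZA of zexp & zexp | ZN of zexp.

Fixpoint zcoef (i : nat) (e : zexp) : int :=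
  match e with
  | ZV j => (i == j)%:Z | Z0 => 0 | ZA a b => zcoef i a + zcoef i b | ZN a => - zcoef i a
  end.

Fixpoint zval (U : zmodType) (s : seq U) (e : zexp) : U :=
  match e with
  | ZV j => nth 0 s j | Z0 => 0 | ZA a b => zval s a + zval s b | ZN a => - zval s a
  end.

Lemma zvalE (U : zmodType) (s : seq U) e :
  zval s e = \sum_(i < size s) nth 0 s i *~ zcoef i e.
Proof.
elim: e => [j||a Ha b Hb|a Ha] /=.
- have [ltj|gej] := ltnP j (size s).
    rewrite (bigD1 (Ordinal ltj)) //= eqxx mulr1z big1 ?addr0 // => i.
    by rewrite -val_eqE /= => /negbTE->; rewrite mulr0z.
  rewrite nth_default // big1 // => i _.
  by rewrite (ltn_eqF (leq_trans (ltn_ord i) gej)) mulr0z.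
- by rewrite big1 // => i _; rewrite mulr0z.
- by rewrite Ha Hb -big_split; apply: eq_bigr => i _; rewrite mulrzDr.
- by rewrite Ha -sumrN; apply: eq_bigr => i _; rewrite mulrNz.
Qed.

Lemma zmodP (U : zmodType) (s : seq U) e1 e2 :
  all (fun i => zcoef i e1 == zcoef i e2) (iota 0 (size s)) -> zval s e1 = zval s e2.
Proof.
move=> /allP H; rewrite !zvalE; apply: eq_bigr => i _.
by rewrite (eqP (H i _)) // mem_iota ltn_ord.
Qed.

Ltac zindex x s :=
  match s with
  | ?y :: ?s' =>
    match goal with
    | _ => let _ := match goal with _ => unify x y end in constr:(0%N)
    | _ => let n := zindex x s' in constr:(S n)
    end
  end.
Ltac zmem x s :=
  match s with
  | nil => constr:(false)
  | ?y :: ?s' =>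
    match goal with
    | _ => let _ := match goal with _ => unify x y end in constr:(true)
    | _ => zmem x s'
    end
  end.
Ltac zatoms e s :=
  match e with
  | 0%R => s
  | (?a + ?b)%R => let s' := zatoms a s in zatoms b s'
  | (- ?a)%R => zatoms a s
  | _ => match zmem e s with true => s | false => constr:(e :: s) end
  end.
Ltac zreify e s :=
  match e with
  | 0%R => constr:(Z0)
  | (?a + ?b)%R => let a' := zreify a s in let b' := zreify b s in constr:(ZA a' b')
  | (- ?a)%R => let a' := zreify a s in constr:(ZN a')
  | _ => let n := zindex e s in constr:(ZV n)
  end.
Ltac zmod :=
  match goal with
  | |- @eq ?U ?x ?y =>
    let s := zatoms x (@nil U) in let s := zatoms y s in
    let e1 := zreify x s in let e2 := zreify y s in
    exact: (@zmodP _ s e1 e2 isT)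
  end.

(** * Integral chains *)

Notation fr T := {freeg T / int}.

Section FreeGroup.
Variables T T' : choiceType.
Implicit Types (c a b : fr T) (f g : T -> fr T').

Definition lin f c : fr T' := fglift f c.

Lemma lin_additive f : zmod_morphism (lin f).
Proof. exact: lift_is_additive. Qed.
HB.instance Definition _ f := GRing.isZmodMorphism.Build _ _ (lin f) (lin_additive f).

Lemma linU f x : lin f << x >> = f x.
Proof. by rewrite /lin liftU scale1r. Qed.

(** [sup] abbreviates support. Degrees, admissible frames and group membership are all imposed as
    conditions on supports, so that a linear map has to be examined on generators only. *)
Variant sup (P : T -> Prop) c : Prop := Sup of (forall x, x \in dom c -> P x).

Lemma supE P c x : sup P c -> x \in dom c -> P x. Proof. by case=> H /H. Qed.

Lemma supU P x : P x -> sup P << x >>.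
Proof. by move=> Px; split=> y; rewrite domU1 inE => /eqP->. Qed.

Lemma sup0 P : sup P 0.
Proof. by split=> x; rewrite dom0. Qed.

Lemma supB P a b : sup P a -> sup P b -> sup P (a - b).
Proof. by move=> [Pa] [Pb]; split=> x /domB; rewrite mem_cat => /orP[/Pa|/Pb]. Qed.

Lemma supN P a : sup P a -> sup P (- a).
Proof. by rewrite -sub0r; apply: supB; apply: sup0. Qed.

Lemma supD P a b : sup P a -> sup P b -> sup P (a + b).
Proof. by move=> Pa Pb; rewrite -(opprK b); apply: supB => //; apply: supN. Qed.

Lemma sub_sup (P Q : T -> Prop) c : sup P c -> (forall x, P x -> Q x) -> sup Q c.
Proof. by move=> [Pc] PQ; split=> x /Pc/PQ. Qed.

Lemma supI (P Q : T -> Prop) c : sup P c -> sup Q c -> sup (fun x => P x /\ Q x) c.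
Proof. by move=> [Pc] [Qc]; split=> x xc; split; [exact: Pc|exact: Qc]. Qed.

Lemma freegUZ k (x : T) : (<< k *g x >> : fr T) = << x >> *~ k.
Proof. by rewrite freeg_mulz intz. Qed.

Lemma sup_ind (P : T -> Prop) (K : fr T -> Prop) :
  K 0 -> (forall x, P x -> K << x >>) -> (forall a b, K a -> K b -> K (a - b)) ->
  forall c, sup P c -> K c.
Proof.
move=> K0 KU KB c [Pc]; rewrite -[c]freeg_sumE.
have KN a : K a -> K (- a) by move=> Ka; rewrite -sub0r; apply: KB.
have KD a b : K a -> K b -> K (a + b).
  by move=> Ka Kb; rewrite -[b]opprK; apply: KB => //; apply: KN.
elim: (dom c) Pc => [|x r IH] Pc; first by rewrite big_nil.
rewrite big_cons; apply: (KD); last first.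
  by apply: IH => y yr; apply: Pc; rewrite inE yr orbT.
have Kx : K << x >> by apply: KU; apply: Pc; rewrite mem_head.
have Kn n : K (<< x >> *+ n).
  by elim: n => [|n Kn]; rewrite ?mulr0n // mulrS; apply: (KD).
rewrite freegUZ; case: (coeff x c) => n; first exact: (Kn n).
by rewrite NegzE mulrNz; apply: KN; exact: (Kn n.+1).
Qed.

Lemma sup_T c : sup (fun=> True) c. Proof. by split. Qed.

Lemma fr_ind (K : fr T -> Prop) :
  K 0 -> (forall x, K << x >>) -> (forall a b, K a -> K b -> K (a - b)) ->
  forall c, K c.
Proof. by move=> K0 KU KB c; apply: (sup_ind (P := fun=> True)) => // x _. Qed.

End FreeGroup.

Section Linear.
Variables T1 T2 T3 : choiceType.

Lemma sup_lin (P : T1 -> Prop) (Q : T2 -> Prop) f c :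
  sup P c -> (forall x, P x -> sup Q (f x)) -> sup Q (lin f c).
Proof.
move=> Pc PQ; move: c Pc; apply: sup_ind => [|x Px|a b Ha Hb].
- by rewrite raddf0; apply: sup0.
- by rewrite linU; apply: PQ.
- by rewrite raddfB; apply: supB.
Qed.

Lemma eq_add (P : T1 -> Prop) (F G : {additive fr T1 -> fr T2}) c :
  sup P c -> (forall x, P x -> F << x >> = G << x >>) -> F c = G c.
Proof.
move=> Pc FG; move: c Pc; apply: sup_ind => [|x /FG//|a b Ha Hb].
  by rewrite !raddf0.
by rewrite !raddfB /= Ha Hb.
Qed.

Lemma eq_lin (P : T1 -> Prop) (f g : T1 -> fr T2) c :
  sup P c -> (forall x, P x -> f x = g x) -> lin f c = lin g c.
Proof. by move=> Pc fg; apply: (eq_add Pc) => x Px; rewrite /= !linU fg. Qed.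

Lemma lin_id (P : T1 -> Prop) (f : T1 -> fr T1) c :
  sup P c -> (forall x, P x -> f x = << x >>) -> lin f c = c.
Proof.
move=> Pc f1; move: c Pc; apply: sup_ind => [|x Px|a b Ha Hb].
- by rewrite raddf0.
- by rewrite linU f1.
- by rewrite raddfB /= Ha Hb.
Qed.

Lemma lin_lin (f : T2 -> fr T3) (g : T1 -> fr T2) c :
  lin f (lin g c) = lin (fun x => lin f (g x)) c.
Proof.
elim/fr_ind: c => [|x|a b Ha Hb]; first by rewrite !raddf0.
  by rewrite !linU.
by rewrite !raddfB /= Ha Hb.
Qed.

End Linear.

Definition part (T : choiceType) (p : pred T) : fr T -> fr T :=
  lin (fun x => if p x then << x >> else 0).
HB.instance Definition _ (T : choiceType) (p : pred T) := GRing.Additive.on (part p).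

(** * The deletion boundary on sequences and its prism homotopy *)

Section Deletion.
Variable T : choiceType.
Implicit Types (x : T) (s : seq T).

Definition cns x : fr (seq T) -> fr (seq T) := lin (fun s => << x :: s >>).
HB.instance Definition _ x := GRing.Additive.on (cns x).

(** The alternating sum of deletions, in the cone form d(x c) = c - x dc. The empty sequence is a
    generator, so the complex is augmented: exactness in degree 0 amounts to the existence of a
    vertex. *)
Fixpoint del s : fr (seq T) :=
  if s is x :: s' then << s' >> - cns x (del s') else 0.

Definition D : fr (seq T) -> fr (seq T) := lin del.
HB.instance Definition _ := GRing.Additive.on D.

Lemma cnsU x s : cns x << s >> = << x :: s >>. Proof. exact: linU. Qed.

Lemma DU s : D << s >> = del s. Proof. exact: linU. Qed.

Lemma D_cns x c : D (cns x c) = c - cns x (D c).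
Proof.
elim/fr_ind: c => [|s|a b Ha Hb]; first by rewrite !raddf0 ?subr0 ?addr0 ?oppr0.
  by rewrite /cns /D !linU.
by rewrite !raddfB /= Ha Hb addrACA -opprD.
Qed.

Lemma DD c : D (D c) = 0.
Proof.
elim/fr_ind: c => [|s|a b Ha Hb]; rewrite ?raddf0 ?raddfB /= ?Ha ?Hb ?subr0 //.
rewrite DU; elim: s => [|x s IH] /=; first by rewrite raddf0.
by rewrite raddfB /= D_cns IH raddf0 subr0 DU subrr.
Qed.

Lemma del_size s : sup (fun t => (size t).+1 = size s) (del s).
Proof.
elim: s => [|x s IH] /=; first exact: sup0.
apply: supB; first exact: supU.
by apply: (sup_lin IH) => t /= <-; apply: supU.
Qed.

Lemma del_sub s : sup (fun t => subseq t s) (del s).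
Proof.
elim: s => [|x s IH] /=; first exact: sup0.
apply: supB; first by apply: supU; apply: subseq_cons.
by apply: (sup_lin IH) => t /= ts; apply: supU; rewrite /= eqxx.
Qed.

(* theta is applied from position i on; the alternating sum over i is a homotopy. *)
Fixpoint prism (th : T -> T) s : fr (seq T) :=
  if s is x :: s' then << x :: th x :: map th s' >> - cns x (prism th s') else 0.

Lemma lin_map_cns (th : T -> T) x c :
  lin (fun s => << map th s >>) (cns x c) = cns (th x) (lin (fun s => << map th s >>) c).
Proof. by rewrite /cns !lin_lin; apply: (eq_lin (sup_T c)) => s _; rewrite !linU. Qed.

Lemma lin_map_del (th : T -> T) s : lin (fun s => << map th s >>) (del s) = del (map th s).
Proof.
elim: s => [|x s IH] /=; first by rewrite raddf0.
by rewrite raddfB /= lin_map_cns IH linU.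
Qed.

Lemma prism_cns th x c :
  lin (prism th) (cns x c) =
  cns x (cns (th x) (lin (fun s => << map th s >>) c)) - cns x (lin (prism th) c).
Proof.
elim/fr_ind: c => [|s|a b Ha Hb]; first by rewrite !raddf0 /= ?subr0 ?addr0.
  by rewrite !cnsU !linU !cnsU.
by rewrite !raddfB /= Ha Hb !raddfB /= addrACA.
Qed.

Lemma prismP th s :
  D (prism th s) + lin (prism th) (del s) = << map th s >> - << s >>.
Proof.
elim: s => [|x s IH] /=; first by rewrite !raddf0 /= ?subrr ?addr0.
rewrite !raddfB /= DU /= D_cns raddfB /= cnsU prism_cns lin_map_del linU.
have -> : D (prism th s) = << map th s >> - << s >> - lin (prism th) (del s).
  by rewrite -IH addrK.
rewrite !raddfB /= !cnsU.
zmod.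
Qed.

End Deletion.

Lemma lin_add (T1 T2 T3 : choiceType) (F : {additive fr T2 -> fr T3}) (g : T1 -> fr T2) c :
  F (lin g c) = lin (fun x => F (g x)) c.
Proof.
elim/fr_ind: c => [|x|a b Ha Hb]; first by rewrite !raddf0.
  by rewrite !linU.
by rewrite !raddfB /= Ha Hb.
Qed.

Lemma lin_0 (T T' : choiceType) (c : fr T) : lin (fun=> 0 : fr T') c = 0.
Proof. by apply: (eq_add (F := lin _) (G := \0) (sup_T c)) => x _; rewrite /= linU. Qed.

Lemma lin_B (T T' : choiceType) (f g : T -> fr T') c :
  lin (fun x => f x - g x) c = lin f c - lin g c.
Proof.
elim/fr_ind: c => [|x|a b Ha Hb]; first by rewrite !raddf0 addr0.
  by rewrite !linU.
by rewrite !raddfB /= Ha Hb; zmod.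
Qed.

Lemma eq_lin_fun (T T' : choiceType) (f g : T -> fr T') c :
  f =1 g -> lin f c = lin g c.
Proof. by move=> fg; apply: (eq_lin (sup_T c)) => x _. Qed.

Lemma part_sup (T : choiceType) (p : pred T) (P : T -> Prop) c :
  sup P c -> sup (fun x => P x /\ p x) (part p c).
Proof.
move=> Pc; apply: (sup_lin Pc) => x Px; case: ifP => // px; last exact: sup0.
exact: supU.
Qed.

Lemma part_id (T : choiceType) (p : pred T) c : sup p c -> part p c = c.
Proof. by move=> Pc; apply: (lin_id Pc) => x ->. Qed.

Lemma part_0 (T : choiceType) (p : pred T) c : sup (fun x => ~~ p x) c -> part p c = 0.
Proof.
move=> Pc; rewrite /part (eq_lin (g := fun=> 0) Pc) ?lin_0 // => x.
by move/negbTE->.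
Qed.

Lemma part_split (T : choiceType) (p : pred T) c : c = part p c + part (predC p) c.
Proof.
elim/fr_ind: c => [|x|a b Ha Hb]; first by rewrite !raddf0 addr0.
  by rewrite /part !linU /=; case: (p x); rewrite ?addr0 ?add0r.
by rewrite {1}Ha {1}Hb !raddfB /=; zmod.
Qed.

Lemma sup_false (T : choiceType) (P : T -> Prop) (c : fr T) : sup P c -> (forall x, ~ P x) -> c = 0.
Proof.
move=> Pc NP; rewrite -[c](part_id (p := pred0)); last by apply: sub_sup Pc _ => x /NP.
by rewrite part_0 //.
Qed.

Lemma prism_map (T T' : choiceType) (k : T -> T') (th : T -> T) (th' : T' -> T') s :
  (forall y, th' (k y) = k (th y)) ->
  prism th' (map k s) = lin (fun t => << map k t >>) (prism th s).
Proof.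
move=> Hk; elim: s => [|x s IH] /=; first by rewrite raddf0.
rewrite raddfB /= linU /= Hk IH -!map_comp; congr (_ - _).
  by congr (<< _ :: _ :: _ >>); apply: eq_map => y /=; rewrite Hk.
by rewrite /cns !lin_lin; apply: eq_lin_fun => t; rewrite !linU.
Qed.

Lemma del_map (T T' : choiceType) (k : T -> T') s :
  del (map k s) = lin (fun t => << map k t >>) (del s).
Proof.
elim: s => [|x s IH] /=; first by rewrite raddf0.
rewrite raddfB /= linU IH; congr (_ - _).
by rewrite /cns !lin_lin; apply: eq_lin_fun => t; rewrite !linU.
Qed.

Lemma eq_prism (T : choiceType) (th th' : T -> T) s :
  {in s, th =1 th'} -> prism th s = prism th' s.
Proof.
elim: s => [//|x s IH] H /=; rewrite (H x (mem_head _ _)) IH; last first.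
  by move=> y ys; apply: H; rewrite inE ys orbT.
congr (<< _ :: _ :: _ >> - _); apply/eq_in_map => y ys.
by apply: H; rewrite inE ys orbT.
Qed.

Lemma prism_sup (T : choiceType) (P : T -> Prop) (th : T -> T) s :
  (forall x, x \in s -> P x) -> (forall x, x \in s -> P (th x)) ->
  sup (fun t : seq T => forall x, x \in t -> P x) (prism th s).
Proof.
elim: s => [|x s IH] H1 H2 /=; first exact: sup0.
apply: supB.
  apply: supU => y; rewrite !inE => /orP[/eqP->|/orP[/eqP->|/mapP[z zs ->]]].
  - exact/H1/mem_head.
  - exact/H2/mem_head.
  - by apply: H2; rewrite inE zs orbT.
have : sup (fun t : seq T => forall x, x \in t -> P x) (prism th s).
  by apply: IH => y ys; [apply: H1|apply: H2]; rewrite inE ys orbT.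
move=> /sup_lin; apply=> t Ht; apply: supU => y; rewrite inE => /orP[/eqP->|/Ht//].
exact/H1/mem_head.
Qed.

(** * Operators on products of bases, and signs *)

Definition sgn (U : zmodType) (b : bool) (c : U) := if b then - c else c.

(** Operators on one factor carry no Koszul sign; signs are supplied separately by [tw]. In [opr]
    the operator may depend on the left coordinate, because the change of group vertices in [gth]
    depends on the object. *)
Definition opl (X X' Y : choiceType) (f : X -> fr X') : fr (X * Y) -> fr (X' * Y) :=
  lin (fun p => lin (fun x => << (x, p.2) >>) (f p.1)).
HB.instance Definition _ (X X' Y : choiceType) (f : X -> fr X') :=
  GRing.Additive.on (@opl X X' Y f).
Definition opr (X Y Y' : choiceType) (f : X -> Y -> fr Y') : fr (X * Y) -> fr (X * Y') :=
  lin (fun p => lin (fun y => << (p.1, y) >>) (f p.1 p.2)).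
HB.instance Definition _ (X Y Y' : choiceType) (f : X -> Y -> fr Y') :=
  GRing.Additive.on (@opr X Y Y' f).

Lemma oplU (X X' Y : choiceType) (f : X -> fr X') (x : X) (y : Y) :
  opl f << (x, y) >> = lin (fun x => << (x, y) >>) (f x).
Proof. exact: linU. Qed.
Lemma oprU (X Y Y' : choiceType) (f : X -> Y -> fr Y') (x : X) (y : Y) :
  opr f << (x, y) >> = lin (fun y => << (x, y) >>) (f x y).
Proof. exact: linU. Qed.

Lemma opl_opr (X X' Y Y' : choiceType) (f : X -> fr X') (g : X -> Y -> fr Y')
    (g' : X' -> Y -> fr Y') c :
  (forall x y, sup (fun x' => g' x' y = g x y) (f x)) ->
  opl f (opr g c) = opr g' (opl f c).
Proof.
move=> H; apply: (eq_add (F := opl f \o opr g) (G := opr g' \o opl f) (sup_T c)).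
move=> [x y] _ /=; rewrite oprU oplU !lin_add.
transitivity (lin (fun x' => lin (fun y' => << (x', y') >>) (g x y)) (f x)); last first.
  by apply: (eq_lin (H x y)) => x' Hx'; rewrite /= oprU Hx'.
transitivity (lin (fun y' => lin (fun x' => << (x', y') >>) (f x)) (g x y)).
  by apply: (eq_lin (sup_T _)) => y' _; rewrite /= oplU.
elim/fr_ind: (f x) => [|x'|a b Ha Hb].
- by rewrite raddf0; under eq_lin_fun do rewrite raddf0; rewrite lin_0.
- by rewrite linU; under eq_lin_fun do rewrite linU.
- by rewrite raddfB /= -Ha -Hb; under eq_lin_fun do rewrite raddfB /=; rewrite lin_B.
Qed.

Lemma opl_sup (X X' Y : choiceType) (P : X * Y -> Prop) (Q : X' * Y -> Prop) (f : X -> fr X') c :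
  sup P c -> (forall x y, P (x, y) -> sup (fun x' => Q (x', y)) (f x)) -> sup Q (opl f c).
Proof.
move=> Pc H; apply: (sup_lin Pc) => -[x y] Pxy /=.
by apply: (sup_lin (H _ _ Pxy)) => x' Hx'; apply: supU.
Qed.

Lemma opr_sup (X Y Y' : choiceType) (P : X * Y -> Prop) (Q : X * Y' -> Prop) (f : X -> Y -> fr Y') c :
  sup P c -> (forall x y, P (x, y) -> sup (fun y' => Q (x, y')) (f x y)) -> sup Q (opr f c).
Proof.
move=> Pc H; apply: (sup_lin Pc) => -[x y] Pxy /=.
by apply: (sup_lin (H _ _ Pxy)) => x' Hx'; apply: supU.
Qed.

(** Multiplication by (-1)^dg, which turns two commuting differentials into anticommuting ones. *)
Definition tw (X : choiceType) (dg : X -> nat) : fr X -> fr X :=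
  lin (fun x => sgn (odd (dg x)) << x >>).
HB.instance Definition _ (X : choiceType) (dg : X -> nat) := GRing.Additive.on (tw dg).

Lemma twU (X : choiceType) (dg : X -> nat) x : tw dg << x >> = sgn (odd (dg x)) << x >>.
Proof. exact: linU. Qed.

Lemma sgn_add (U U' : zmodType) (F : {additive U -> U'}) b c : F (sgn b c) = sgn b (F c).
Proof. by case: b => //=; rewrite raddfN. Qed.

Lemma twE (X : choiceType) (dg : X -> nat) b c :
  sup (fun x => odd (dg x) = b) c -> tw dg c = sgn b c.
Proof.
move: c; apply: sup_ind => [|x <-|a a' Ha Ha'].
- by rewrite raddf0; case: b; rewrite /= ?oppr0.
- exact: linU.
- by rewrite raddfB /= Ha Ha'; case: b {Ha Ha'} => //=; zmod.
Qed.

Lemma twK (X : choiceType) (dg : X -> nat) c : tw dg (tw dg c) = c.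
Proof.
elim/fr_ind: c => [|x|a b Ha Hb]; rewrite ?raddf0 //; last by rewrite !raddfB /= Ha Hb.
by rewrite twU sgn_add /= twU; case: odd => //=; rewrite opprK.
Qed.

Lemma tw_sup (X : choiceType) (dg : X -> nat) P c : sup P c -> sup P (tw dg c).
Proof.
move=> Pc; apply: (sup_lin Pc) => x Px; case: odd => /=; last exact: supU.
by apply: supN; apply: supU.
Qed.

Lemma tw_even (X X' : choiceType) (dg : X -> nat) (dg' : X' -> nat) (F : {additive fr X -> fr X'}) c :
  (forall x, sup (fun y => odd (dg' y) = odd (dg x)) (F << x >>)) ->
  tw dg' (F c) = F (tw dg c).
Proof.
move=> H; elim/fr_ind: c => [|x|a b Ha Hb]; rewrite ?raddf0 //; last by rewrite !raddfB /= Ha Hb.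
by rewrite (twE (H x)) twU sgn_add.
Qed.

Lemma tw_odd (X X' : choiceType) (dg : X -> nat) (dg' : X' -> nat) (F : {additive fr X -> fr X'}) c :
  (forall x, sup (fun y => odd (dg' y) = ~~ odd (dg x)) (F << x >>)) ->
  tw dg' (F c) = - F (tw dg c).
Proof.
move=> H; elim/fr_ind: c => [|x|a b Ha Hb]; rewrite ?raddf0 ?oppr0 //.
  by rewrite (twE (H x)) twU sgn_add; case: odd => //=; rewrite opprK.
by rewrite !raddfB /= Ha Hb; zmod.
Qed.

Section Fibers.
Variables (X Y Y' : choiceType) (d : Y -> fr Y').

Definition inj (x : X) : fr Y -> fr (X * Y) := lin (fun y => << (x, y) >>).
HB.instance Definition _ x := GRing.Additive.on (inj x).
Definition slice (x : X) : fr (X * Y) -> fr Y :=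
  lin (fun p => if p.1 == x then << p.2 >> else 0).
HB.instance Definition _ x := GRing.Additive.on (slice x).

Lemma slice_sum (s : seq X) (y : fr (X * Y)) :
  uniq s -> sup (fun p => p.1 \in s) y -> y = \sum_(x <- s) inj x (slice x y).
Proof.
move=> us; move: y; apply: sup_ind => [|[x v] /= xs|a b Ha Hb].
- by rewrite big1 // => x _; rewrite !raddf0.
- rewrite (bigD1_seq x) //= big1 => [|x' /negbTE Nx]; rewrite /slice linU /=.
    by rewrite eqxx addr0 /inj linU.
  by rewrite eq_sym Nx raddf0.
- rewrite {1}Ha {1}Hb -sumrB; apply: eq_bigr => x _.
  by rewrite !raddfB.
Qed.

(* A cycle for d acting on the second factor is a sum of cycles, one for each first coordinate. *)
Lemma fiber_ind (P : X -> Prop) (Q : X -> Y -> Prop) (K : fr (X * Y) -> Prop) y :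
  sup (fun p => P p.1 /\ Q p.1 p.2) y -> opr (fun _ : X => d) y = 0 ->
  K 0 -> (forall a b, K a -> K b -> K (a + b)) ->
  (forall x c, P x -> sup (Q x) c -> lin d c = 0 -> K (inj x c)) -> K y.
Proof.
move=> Sy dy K0 KD KI.
pose s := undup [seq p.1 | p <- dom y].
have ys : sup (fun p => p.1 \in s) y by split=> p py; rewrite mem_undup map_f.
rewrite (slice_sum (undup_uniq _) ys) -/s.
have Ps : forall x, x \in s -> P x.
  by move=> x; rewrite mem_undup => /mapP[p py ->]; case: (supE Sy py).
have H x : x \in s -> K (inj x (slice x y)).
  move=> xs; apply: KI; first exact: Ps.
    apply: (sup_lin Sy) => -[x' v] [_ /=]; case: eqP => [-> q|_ _]; last exact: sup0.
    exact: supU.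
  transitivity (lin (fun p => if p.1 == x then << p.2 >> else 0) (opr (fun _ : X => d) y)); last first.
    by rewrite dy raddf0.
  rewrite /slice /opr !lin_lin; apply: eq_lin_fun => -[x' v] /=.
  rewrite lin_lin (eq_lin_fun (g := fun w => if x' == x then << w >> else 0)); last first.
    by move=> w; rewrite linU.
  case: eqP => _; rewrite ?raddf0 ?lin_0 // linU.
  by rewrite (lin_id (sup_T _)).
elim: s H {ys Ps} => [|x s IH] H; first by rewrite big_nil.
rewrite big_cons; apply: KD; first exact/H/mem_head.
by apply: IH => x' xs; apply: H; rewrite inE xs orbT.
Qed.

End Fibers.

Lemma opr_inj (X Y Y' : choiceType) (f : X -> Y -> fr Y') (x : X) c :
  opr f (inj x c) = inj x (lin (f x) c).
Proof. by rewrite /inj lin_add lin_lin; apply: eq_lin_fun => y /=; rewrite oprU. Qed.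

Lemma fiber_exact (X Y Y' Y'' : choiceType) (d : Y -> fr Y') (d' : Y'' -> fr Y)
    (P : X -> Prop) (Q : X -> Y -> Prop) (Q' : X -> Y'' -> Prop) y :
  (forall x c, P x -> sup (Q x) c -> lin d c = 0 -> exists2 w, sup (Q' x) w & lin d' w = c) ->
  sup (fun p => P p.1 /\ Q p.1 p.2) y -> opr (fun _ : X => d) y = 0 ->
  exists2 w, sup (fun p => P p.1 /\ Q' p.1 p.2) w & opr (fun _ : X => d') w = y.
Proof.
move=> H Sy dy.
pose K y := exists2 w, sup (fun p => P p.1 /\ Q' p.1 p.2) w & opr (fun _ : X => d') w = y.
apply: (fiber_ind (K := K) Sy dy) => [|a b [u Su <-] [v Sv <-]|x c Px Sc dc].
- by exists 0; rewrite ?raddf0 //; apply: sup0.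
- by exists (u + v); rewrite ?raddfD //; apply: supD.
- have [w Sw <-] := H x c Px Sc dc; exists (inj x w); last by rewrite opr_inj.
  by apply: (sup_lin Sw) => z Qz; apply: supU.
Qed.

Definition swap (X Y : choiceType) : fr (X * Y) -> fr (Y * X) := lin (fun p => << (p.2, p.1) >>).
HB.instance Definition _ (X Y : choiceType) := GRing.Additive.on (@swap X Y).

Lemma swapK (X Y : choiceType) c : @swap Y X (@swap X Y c) = c.
Proof. by rewrite /swap lin_lin; apply: (lin_id (sup_T _)) => -[x y] _; rewrite linU. Qed.

Lemma swap_sup (X Y : choiceType) (P : X * Y -> Prop) (Q : Y * X -> Prop) c :
  sup P c -> (forall x y, P (x, y) -> Q (y, x)) -> sup Q (swap c).
Proof. by move=> Sc PQ; apply: (sup_lin Sc) => -[x y] Pxy; apply/supU/PQ. Qed.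

Lemma swap_opl (X X' Y : choiceType) (f : X -> fr X') c :
  swap (opl f c) = opr (fun _ : Y => f) (swap c).
Proof.
rewrite /opl /opr /swap !lin_lin; apply: eq_lin_fun => -[x y] /=.
by rewrite linU lin_lin; apply: eq_lin_fun => z; rewrite linU.
Qed.

Lemma fiber_exact_l (X X' X'' Y : choiceType) (d : X -> fr X') (d' : X'' -> fr X)
    (P : Y -> Prop) (Q : Y -> X -> Prop) (Q' : Y -> X'' -> Prop) (c : fr (X * Y)) :
  (forall y z, P y -> sup (Q y) z -> lin d z = 0 -> exists2 w, sup (Q' y) w & lin d' w = z) ->
  sup (fun p => P p.2 /\ Q p.2 p.1) c -> opl d c = 0 ->
  exists2 w, sup (fun p => P p.2 /\ Q' p.2 p.1) w & opl d' w = c.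
Proof.
move=> H Sc dc; have [||w Sw Ew] := fiber_exact H (y := swap c).
- by apply: (swap_sup Sc).
- by rewrite -swap_opl dc raddf0.
exists (swap w); first exact: (swap_sup Sw).
by rewrite -[LHS]swapK swap_opl swapK Ew swapK.
Qed.

(** * Chains on pairs of an object and a group simplex *)

Section Total.
Variables (A : comUnitRingType) (N : nat).
Local Notation M := 'M[A]_N.
Variables (X : choiceType) (act : X -> M -> X).
Hypothesis act1 : forall x, act x 1%:M = x.
Hypothesis actM : forall x g h, act x (g *m h) = act (act x g) h.
Variables (dX : X -> fr X) (dg : X -> nat).
Hypothesis dX_act : forall x g, dX (act x g) = lin (fun y => << act y g >>) (dX x).
Hypothesis dX_dg : forall x, sup (fun y => (dg y).+1 = dg x) (dX x).
Hypothesis dXX : forall x, lin dX (dX x) = 0.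
Hypothesis dg_act : forall x g, dg (act x g) = dg x.

Definition actu (p : X * seq M) (g : M) : X * seq M := (act p.1 g, [seq u *m g | u <- p.2]).

(* Normal form of a simplex under the diagonal right action: its first group element becomes 1. *)
Definition nfg (p : X * seq M) : fr (X * seq M) :=
  if p.2 is u :: _ then << actu p u^T >> else 0.
Definition nf : fr (X * seq M) -> fr (X * seq M) := lin nfg.
HB.instance Definition _ := GRing.Additive.on nf.
Definition delr : fr (X * seq M) -> fr (X * seq M) := opr (fun _ u => del u).
HB.instance Definition _ := GRing.Additive.on delr.
Lemma delrU x u : delr << (x, u) >> = lin (fun v => << (x, v) >>) (del u).
Proof. exact: oprU. Qed.
(** The simplicial boundary on coinvariants. Deleting the first vertex destroys the normal form;
    [nf] restores it, and this is where the group acts on the object. *)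
Definition dbar c := nf (delr c).
HB.instance Definition _ := GRing.isZmodMorphism.Build _ _ dbar
  (fun a b => etrans (congr1 nf (raddfB _ a b)) (raddfB _ _ _)).
Definition dleft : fr (X * seq M) -> fr (X * seq M) := opl dX.
HB.instance Definition _ := GRing.Additive.on dleft.
Lemma dleftU x u : dleft << (x, u) >> = lin (fun y => << (y, u) >>) (dX x).
Proof. exact: oplU. Qed.
Local Notation twp := (tw (fun p : X * seq M => dg p.1)).
(** The total differential; it computes the homology of the group with coefficients in the complex
    of objects. *)
Definition delta c := dleft c + twp (dbar c).
Lemma delta_additive : zmod_morphism delta.
Proof. by move=> a b; rewrite /delta !raddfB /=; zmod. Qed.
HB.instance Definition _ := GRing.isZmodMorphism.Build _ _ delta delta_additive.

Variables (Xs : X -> Prop) (G : M -> Prop).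
Hypothesis G1 : G 1%:M.
Hypothesis GM : forall g h, G g -> G h -> G (g *m h).
Hypothesis GT : forall g, G g -> G g^T.
Hypothesis GK : forall g, G g -> g *m g^T = 1%:M.
Hypothesis Xs_act : forall x g, Xs x -> G g -> Xs (act x g).
Hypothesis Xs_dX : forall x, Xs x -> sup Xs (dX x).

Definition raw (p : X * seq M) := Xs p.1 /\ forall g, g \in p.2 -> G g.
Definition nrm (p : X * seq M) := raw p /\ exists s, p.2 = 1%:M :: s.

Lemma raw_nf c : sup raw c -> sup nrm (nf c).
Proof.
move=> Rc; apply: (sup_lin Rc) => -[x [|u s]] [/= Hx Hs]; first exact: sup0.
have Gu : G u by apply: Hs; exact: mem_head.
apply: supU; split; last by exists [seq v *m u^T | v <- s]; rewrite /= GK.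
split=> /=; first exact/Xs_act/GT.
move=> g; rewrite inE => /orP[/eqP->|/mapP[v vs ->]]; apply: (GM); try exact: (GT).
  exact: Gu.
by apply: Hs; rewrite inE vs orbT.
Qed.

Lemma nrm_raw c : sup nrm c -> sup raw c.
Proof. by move=> H; apply: (sub_sup H) => p []. Qed.

Lemma actuM p g h : actu p (g *m h) = actu (actu p g) h.
Proof.
by case: p => x u; rewrite /actu /= actM -map_comp; congr pair; apply: eq_map => v /=; rewrite mulmxA.
Qed.

Lemma actu1 p : actu p 1%:M = p.
Proof.
by case: p => x u; rewrite /actu /= act1; congr pair; rewrite -[RHS]map_id; apply: eq_map => v; rewrite mulmx1.
Qed.

Lemma nf_nrm c : sup nrm c -> nf c = c.
Proof. by move=> Nc; apply: (lin_id Nc) => -[x [|u s]] [_ [t [//->]]] _; rewrite /nfg /= trmx1 actu1. Qed.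

Lemma nfg_actu p g : g *m g^T = 1%:M -> nfg (actu p g) = nfg p.
Proof.
case: p => x [|u s] // gg; rewrite /nfg /= -actuM trmx_mul.
by rewrite mulmxA gg mul1mx.
Qed.

Lemma delr_actu p g : delr << actu p g >> = lin (fun q => << actu q g >>) (delr << p >>).
Proof.
case: p => x u; rewrite /actu /= !delrU del_map !lin_lin.
by apply: eq_lin_fun => v; rewrite !linU.
Qed.

Lemma lin_nf_actu c g : g *m g^T = 1%:M -> nf (lin (fun q => << actu q g >>) c) = nf c.
Proof. by move=> gg; rewrite /nf lin_lin; apply: eq_lin_fun => q; rewrite linU nfg_actu. Qed.

Lemma GKT g : G g -> g^T *m g^T^T = 1%:M.
Proof. by move=> /GT/GK. Qed.

Lemma nf_delr_nf c : sup raw c -> nf (delr (nf c)) = nf (delr c).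
Proof.
move=> Rc; apply: (eq_add (F := nf \o delr \o nf) (G := nf \o delr) Rc).
move=> -[x [|u s]] [/= _ Hs]; rewrite [nf << _ >>]linU /nfg /=.
  by rewrite delrU /= !raddf0.
by rewrite delr_actu lin_nf_actu // GKT //; apply/Hs/mem_head.
Qed.

Lemma delr_raw c : sup raw c -> sup raw (delr c).
Proof.
move=> Rc; apply: (opr_sup Rc) => x u [/= Hx Hu]; apply: (sub_sup (del_sub u)) => v vu.
by split=> //= g gv; apply: Hu; apply: (mem_subseq vu).
Qed.

Lemma dbar_nrm c : sup raw c -> sup nrm (dbar c).
Proof. by move=> Rc; apply/raw_nf/delr_raw. Qed.

Lemma dleft_nrm c : sup nrm c -> sup nrm (dleft c).
Proof.
move=> Nc; apply: (opl_sup Nc) => x u [[/= Hx Hu] Hs].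
by apply: (sub_sup (Xs_dX Hx)) => y Hy.
Qed.

Lemma delta_nrm c : sup nrm c -> sup nrm (delta c).
Proof. by move=> Nc; apply: supD; [exact: dleft_nrm|apply/tw_sup/dbar_nrm/nrm_raw]. Qed.

Lemma delr_delr c : delr (delr c) = 0.
Proof.
elim/fr_ind: c => [|[x u]|a b Ha Hb]; rewrite ?raddf0 //; last by rewrite !raddfB /= Ha Hb subr0.
rewrite delrU lin_add.
transitivity (lin (fun y => lin (fun v => << (x, v) >>) (del y)) (del u)).
  by apply: eq_lin_fun => v; rewrite /= delrU.
by rewrite -lin_lin -DU -/(D _) DD raddf0.
Qed.

Lemma dbar_dbar c : sup raw c -> dbar (dbar c) = 0.
Proof. by move=> Rc; rewrite /dbar nf_delr_nf ?delr_delr ?raddf0 //; exact: delr_raw. Qed.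

Lemma dleft_delr c : dleft (delr c) = delr (dleft c).
Proof. by apply: opl_opr => x y. Qed.

Lemma dleft_nf c : dleft (nf c) = nf (dleft c).
Proof.
apply: (eq_add (F := dleft \o nf) (G := nf \o dleft) (sup_T c)) => -[x [|u s]] _ /=.
  rewrite [nf << _ >>]linU /nfg /= raddf0 dleftU lin_add.
  by rewrite (eq_lin_fun (g := fun=> 0)) ?lin_0 // => y; rewrite /= [nf _]linU.
rewrite [nf << _ >>]linU /nfg /= dleftU dleftU /actu /= dX_act lin_lin lin_add.
by apply: eq_lin_fun => y; rewrite linU /= [nf _]linU.
Qed.

Lemma dleft_dleft c : dleft (dleft c) = 0.
Proof.
elim/fr_ind: c => [|[x u]|a b Ha Hb]; rewrite ?raddf0 //; last by rewrite !raddfB /= Ha Hb subr0.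
rewrite dleftU lin_add.
transitivity (lin (fun y => lin (fun v => << (v, u) >>) (dX y)) (dX x)).
  by apply: eq_lin_fun => v; rewrite /= dleftU.
by rewrite -lin_lin dXX raddf0.
Qed.

Lemma tw_dleft c : twp (dleft c) = - dleft (twp c).
Proof.
apply: tw_odd => -[x u]; rewrite /= dleftU; apply: (sup_lin (dX_dg x)) => y <-.
by apply: supU => /=; rewrite negbK.
Qed.

Lemma tw_nf c : twp (nf c) = nf (twp c).
Proof.
apply: tw_even => -[x [|u s]]; rewrite /= [nf _]linU /nfg /=; first exact: sup0.
by apply: supU; rewrite /= dg_act.
Qed.

Lemma tw_delr c : twp (delr c) = delr (twp c).
Proof.
apply: tw_even => -[x u]; rewrite /= delrU; apply: (sup_lin (sup_T _)) => v _.
exact: supU.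
Qed.

Lemma tw_dbar c : twp (dbar c) = dbar (twp c).
Proof. by rewrite /dbar tw_nf tw_delr. Qed.

Lemma dleft_dbar c : dleft (dbar c) = dbar (dleft c).
Proof. by rewrite /dbar dleft_nf dleft_delr. Qed.

Lemma delta_delta c : sup nrm c -> delta (delta c) = 0.
Proof.
move=> Nc; have Rc := nrm_raw Nc.
rewrite /delta !raddfD /= dleft_dleft add0r -[dbar (tw _ _)]tw_dbar dbar_dbar //.
by rewrite !raddf0 addr0 -dleft_dbar tw_dleft subrr.
Qed.

Section Gauge.
Variable eta : X -> M.
Hypothesis eta_dX : forall x, sup (fun y => forall g, eta (act y g) = eta (act x g)) (dX x).
Hypothesis G_eta : forall x, Xs x -> G (eta x).

(** The object x g^-1 is invariant under the diagonal action, so multiplying the vertex g on the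
    left by the value of [eta] there is equivariant and descends to coinvariants. In normal form the
    object x becomes x (eta x)^-1. With [eta] constant this is conjugation; with [eta] leading each
    object to a representative of its orbit it is Shapiro's lemma. *)
Definition gth (x : X) (g : M) : M := eta (act x g^T) *m g.
Definition gprism : fr (X * seq M) -> fr (X * seq M) := opr (fun x u => prism (gth x) u).
HB.instance Definition _ := GRing.Additive.on gprism.
Definition gmap : fr (X * seq M) -> fr (X * seq M) := opr (fun x u => << map (gth x) u >>).
HB.instance Definition _ := GRing.Additive.on gmap.

Lemma gprismP c : delr (gprism c) + gprism (delr c) = gmap c - c.
Proof.
elim/fr_ind: c => [|[x u]|a b Ha Hb]; first by rewrite !raddf0 addr0.
  rewrite [gprism _]oprU delrU [gmap _]oprU linU !lin_add /=.
  rewrite (eq_lin_fun (g := fun v => lin (fun w => << (x, w) >>) (del v))); last by move=> v; rewrite delrU.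
  rewrite (eq_lin_fun (f := fun v => gprism _) (g := fun v => lin (fun w => << (x, w) >>) (prism (gth x) v))); last by move=> v; rewrite [gprism _]oprU.
  by rewrite -!lin_lin -raddfD /= prismP raddfB /= !linU.
by rewrite !raddfB /= addrACA -opprD Ha Hb; zmod.
Qed.

Lemma raw_gprism c : sup raw c -> sup raw (gprism c).
Proof.
move=> Rc; apply: (opr_sup Rc) => x u [/= Hx Hu].
apply: sub_sup (prism_sup (P := G) Hu _) _ => [g gu|v Hv]; last by split.
by apply: GM; [apply/G_eta/Xs_act/GT/Hu|apply: Hu].
Qed.

Lemma nf_gprism_nf c : sup raw c -> nf (gprism (nf c)) = nf (gprism c).
Proof.
move=> Rc; apply: (eq_add (F := nf \o gprism \o nf) (G := nf \o gprism) Rc).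
move=> -[x [|u s]] [/= _ Hs]; rewrite [nf << _ >>]linU /nfg /=.
  by rewrite [gprism << _ >>]oprU /= !raddf0.
have uu := GKT (Hs _ (mem_head _ _)).
rewrite -[RHS](lin_nf_actu _ uu); congr (nf _).
have K : prism (gth (act x u^T)) [seq v *m u^T | v <- u :: s] =
    lin (fun t => << map (mulmx^~ u^T) t >>) (prism (gth x) (u :: s)).
  apply: prism_map => y; rewrite /gth trmx_mul trmxK -actM !mulmxA.
  have -> : u^T *m u = 1%:M by rewrite -[X in _ *m X]trmxK.
  by rewrite mul1mx.
rewrite -[actu _ _]/(act x u^T, [seq v *m u^T | v <- u :: s]).
rewrite ![gprism _]oprU K !lin_lin.
by apply: eq_lin_fun => v; rewrite !linU.
Qed.

Lemma dleft_gprism c : dleft (gprism c) = gprism (dleft c).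
Proof.
apply: opl_opr => x u; apply: sub_sup (eta_dX x) _ => y Hy.
by apply: eq_prism => g _; rewrite /gth Hy.
Qed.

Lemma tw_gprism c : twp (gprism c) = gprism (twp c).
Proof.
apply: tw_even => -[x u]; rewrite /= [gprism _]oprU; apply: (sup_lin (sup_T _)) => v _.
exact: supU.
Qed.

Definition ghom c := twp (nf (gprism c)).
Definition gauge c := nf (gmap c).

Lemma ghom_nrm c : sup nrm c -> sup nrm (ghom c).
Proof. by move=> Nc; apply/tw_sup/raw_nf/raw_gprism/nrm_raw. Qed.

Lemma gaugeP c : sup nrm c -> delta (ghom c) + ghom (delta c) = gauge c - c.
Proof.
move=> Nc; have Rc := nrm_raw Nc.
have E1 y : dleft (twp y) = - twp (dleft y) by rewrite tw_dleft opprK.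
rewrite /delta /ghom /gauge !raddfD /= E1 dleft_nf dleft_gprism.
rewrite -[dbar (tw _ _)]tw_dbar twK -tw_gprism -tw_nf twK.
rewrite /dbar nf_gprism_nf ?nf_delr_nf; [|exact: raw_gprism|exact: delr_raw].
have := congr1 nf (gprismP c); rewrite raddfD raddfB /= (nf_nrm Nc) => <-.
by zmod.
Qed.

Lemma ghom0 : ghom 0 = 0.
Proof. by rewrite /ghom !raddf0. Qed.

Lemma gauge_cycle c : sup nrm c -> delta c = 0 ->
  sup nrm (ghom c) /\ gauge c = c + delta (ghom c).
Proof.
move=> Nc dc; split; first exact: ghom_nrm.
by have := gaugeP Nc; rewrite dc ghom0 addr0 => ->; rewrite addrC subrK.
Qed.

(** Any map of the form id + delta h + h delta commutes with delta. *)
Lemma gauge_delta c : sup nrm c -> gauge (delta c) = delta (gauge c).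
Proof.
move=> Nc; have E2 := gaugeP (delta_nrm Nc); rewrite delta_delta // ghom0 addr0 in E2.
have -> : gauge c = delta (ghom c) + ghom (delta c) + c by rewrite gaugeP ?subrK.
have dd : delta (delta (ghom c)) = 0 by apply/delta_delta/ghom_nrm.
by rewrite [RHS](raddfD delta) (raddfD delta) /= dd add0r E2 subrK.
Qed.

End Gauge.

Lemma nf_J (J : X -> nat -> Prop) c : (forall x g m, J x m -> J (act x g) m) ->
  sup (fun p => J p.1 (size p.2)) c -> sup (fun p => J p.1 (size p.2)) (nf c).
Proof.
move=> J_act Sc; apply: (sup_lin Sc) => -[x [|u s]] /= Jx; first exact: sup0.
by apply: supU; rewrite /= size_map; apply: J_act.
Qed.

Lemma prism_size (T : choiceType) (th : T -> T) s :
  sup (fun t => size t = (size s).+1) (prism th s).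
Proof.
elim: s => [|x s IH] /=; first exact: sup0.
apply: supB; first by apply: supU; rewrite /= size_map.
by apply: (sup_lin IH) => t Ht; apply: supU; rewrite /= Ht.
Qed.

Lemma ghom_J (eta : X -> M) (J : X -> nat -> Prop) c :
  (forall x g m, J x m -> J (act x g) m) ->
  sup (fun p => J p.1 (size p.2).+1) c -> sup (fun p => J p.1 (size p.2)) (ghom eta c).
Proof.
move=> J_act Sc; apply: tw_sup; apply: nf_J => //.
apply: (opr_sup Sc) => x u Jx; apply: sub_sup (prism_size _ u) _ => t Ht.
by rewrite /= Ht.
Qed.

Lemma gaugeE (eta : X -> M) c : sup nrm c ->
  gauge eta c = lin (fun p => << (act p.1 (eta p.1)^T,
    [seq eta (act p.1 g^T) *m g *m (eta p.1)^T | g <- p.2]) >>) c.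
Proof.
move=> Nc; rewrite /gauge /gmap /opr [nf _]lin_lin.
apply: (eq_lin Nc) => -[x u] [_ [s /= ->]].
rewrite linU linU /nfg /actu /= /gth trmx1 act1 !mulmx1 -map_comp; congr (<< (_, _ :: _) >>).
Qed.

Definition inner (h : M) : fr (X * seq M) -> fr (X * seq M) :=
  lin (fun p => << (act p.1 h^T, [seq h *m u *m h^T | u <- p.2]) >>).
HB.instance Definition _ h := GRing.Additive.on (inner h).

(* Inner automorphisms act trivially on homology. *)
Lemma innerP h c : G h -> sup nrm c -> delta c = 0 ->
  sup nrm (ghom (fun=> h) c) /\ inner h c = c + delta (ghom (fun=> h) c).
Proof.
move=> Gh Nc dc; rewrite /inner -(gaugeE (fun=> h) Nc).
by apply: gauge_cycle => // x; apply: sub_sup (sup_T _) _.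
Qed.

(* u_0, ..., u_m span a simplex of dimension m, so total degree n means dg x + (m + 1) = n + 1. *)
Definition Nc n c := sup (fun p => nrm p /\ dg p.1 + size p.2 = n.+1)%N c.

Lemma dleft_dg P c : sup (fun p => P (dg p.1) (size p.2)) c ->
  sup (fun p => P (dg p.1).+1 (size p.2)) (dleft c).
Proof.
move=> Sc; apply: (opl_sup Sc) => x u /= Px.
by apply: sub_sup (dX_dg x) _ => y /= ->.
Qed.

Lemma dbar_dg P c : sup (fun p => P (dg p.1) (size p.2)) c ->
  sup (fun p => P (dg p.1) (size p.2).+1) (dbar c).
Proof.
move=> Sc; apply: (nf_J (J := fun x m => P (dg x) m.+1)) => [x g m|]; first by rewrite dg_act.
apply: (opr_sup Sc) => x u /= Px; apply: sub_sup (del_size u) _ => t /= Ht.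
by rewrite Ht.
Qed.

Lemma delta_Nc n c : Nc n.+1 c -> Nc n (delta c).
Proof.
move=> H; have Hn : sup nrm c by apply: sub_sup H _ => p [].
apply: supI; first exact: delta_nrm.
have Hd : sup (fun p => dg p.1 + size p.2 = n.+2)%N c by apply: sub_sup H _ => p [].
apply: supD; last apply: tw_sup.
  by apply: sub_sup (@dleft_dg (fun a b => (a + b = n.+2)%N) c Hd) _ => p /= [].
by apply: sub_sup (@dbar_dg (fun a b => (a + b = n.+2)%N) c Hd) _ => p /=; rewrite addnS => -[].
Qed.

Lemma ghom_Nc eta n c : (forall x, Xs x -> G (eta x)) -> Nc n c -> Nc n.+1 (ghom eta c).
Proof.
move=> Ge H; have Hn : sup nrm c by apply: sub_sup H _ => p [].
apply: supI; first exact: ghom_nrm.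
apply: (@ghom_J eta (fun x m => (dg x + m = n.+2)%N) c) => [x g m|]; first by rewrite dg_act.
by apply: sub_sup H _ => p [_]; rewrite addnS => ->.
Qed.

(* The filtration by dg: the part of lowest dg of a cycle is a cycle for dX. *)
Lemma tot_exact n c :
  (forall a z, (a <= n)%N -> sup (fun x => Xs x /\ dg x = a) z -> lin dX z = 0 ->
     exists2 w, sup (fun x => Xs x /\ dg x = a.+1) w & lin dX w = z) ->
  Nc n c -> delta c = 0 -> exists2 w, Nc n.+1 w & delta w = c.
Proof.
move=> Ex.
(* Induction that raises a lower bound for dg. A simplex has at least one group vertex, so dg is at
   most n, and for j = 0 the chain is zero. *)
suff H j : (j <= n.+1)%N -> forall c, Nc n c -> sup (fun p => n.+1 - j <= dg p.1)%N c -> delta c = 0 ->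
    exists2 w, Nc n.+1 w & delta w = c.
  by move=> N0 dc; apply: (H n.+1) => //; apply: sub_sup N0 _ => p _; rewrite subnn.
elim: j {c} => [_|j IH jn] c N0 Lc dc.
  exists 0; first exact: sup0.
  rewrite raddf0; symmetry; apply: (sup_false (supI N0 Lc)) => -[x u] [[[_ [s /= ->]] /=]].
  by rewrite subn0 addnS => -[<-]; rewrite ltnNge leq_addr.
set a := (n.+1 - j.+1)%N in Lc.
have Ea : (n.+1 - j = a.+1)%N by rewrite /a; lia.
pose c1 := part (fun p => dg p.1 == a) c; pose c2 := part (predC (fun p => dg p.1 == a)) c.
have Ec : c = c1 + c2 by apply: part_split.
have S1 := part_sup (fun p : X * seq M => dg p.1 == a) N0; rewrite -/c1 in S1.
have S2 := part_sup (predC (fun p : X * seq M => dg p.1 == a)) (supI N0 Lc); rewrite -/c2 in S2.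
have dc1 : dleft c1 = 0.
  have <- : part (fun p => dg p.1 < a)%N (delta c) = dleft c1; last by rewrite dc raddf0.
  have -> : delta c = dleft c1 + (dleft c2 + twp (dbar c)) by rewrite /delta {1}Ec raddfD addrA.
  rewrite raddfD /= part_id; last first.
    have H : sup (fun p => dg p.1 = a) c1 by apply: sub_sup S1 _ => p [_ /eqP].
    by apply: sub_sup (@dleft_dg (fun x _ => (x = a)%N) _ H) _ => p /= <-.
  rewrite part_0 ?addr0 //; apply: supD; last apply: tw_sup.
    have H : sup (fun p => a < dg p.1)%N c2.
      by apply: sub_sup S2 _ => p [[_ ap] /= pa]; rewrite ltn_neqAle eq_sym pa.
    by apply: sub_sup (@dleft_dg (fun x _ => (a < x)%N) _ H) _ => p /=; rewrite ltnS leqNgt.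
  by apply: sub_sup (@dbar_dg (fun x _ => (a <= x)%N) _ Lc) _ => p /=; rewrite -leqNgt.
have [w [Sw Dw Ew]] : exists w, [/\ Nc n.+1 w, sup (fun p => dg p.1 = a.+1) w & dleft w = c1].
  pose Q (u : seq M) := [/\ forall g, g \in u -> G g, exists s, u = 1%:M :: s & (a + size u = n.+1)%N].
  have [|||w Sw Ew] := @fiber_exact_l X X X (seq M) dX dX Q
    (fun _ x => Xs x /\ dg x = a) (fun _ x => Xs x /\ dg x = a.+1) c1.
  - by move=> u z _; apply: Ex; rewrite /a; lia.
  - apply: sub_sup S1 _ => -[x u] [[[[/= Hx Hu] Hs] Hd]] /= /eqP Ha.
    by split; split=> //; rewrite -Ha.
  - exact: dc1.
  exists w; split=> //; apply: sub_sup Sw _ => -[x u] [[/= Hu Hs Hd] [Hx Ha]] //.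
  by split; [split|rewrite Ha addSn Hd].
(* [dleft w] cancels the part of lowest dg, and the other half of [delta w] lives in dg equal to a +
   1. *)
have [||||w' Nw' Ew'] := IH _ (c - delta w).
- exact: ltnW.
- by apply: supB => //; apply: delta_Nc.
- have -> : c - delta w = c2 - tw (fun p : X * seq M => dg p.1) (dbar w).
    by rewrite /delta Ew Ec; zmod.
  rewrite Ea; apply: supB.
    by apply: sub_sup S2 _ => p [[_ ap] /= pa]; rewrite ltn_neqAle eq_sym pa.
  apply: tw_sup.
  by apply: sub_sup (@dbar_dg (fun x _ => (x = a.+1)%N) _ Dw) _ => p /= ->.
- by rewrite raddfB /= dc delta_delta ?subrr //; apply: sub_sup Sw _ => p [].
by exists (w' + w); [apply: supD|rewrite raddfD /= Ew' subrK].
Qed.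

End Total.

(** * Orthogonal vectors over a valuation ring *)

Notation unit a := (a \is a GRing.unit).

Section Dot.
Variables (A : idomainType) (N : nat).
Local Notation V := 'rV[A]_N.
Implicit Types (x y z h u v w : V) (B C : seq V) (g : 'M[A]_N).

Definition dot x y : A := (x *m y^T) 0 0.

Lemma dotE x y : dot x y = \sum_j x 0 j * y 0 j.
Proof. by rewrite /dot mxE; apply: eq_bigr => j _; rewrite mxE. Qed.

Lemma dotC x y : dot x y = dot y x.
Proof. by rewrite !dotE; apply: eq_bigr => j _; rewrite mulrC. Qed.
Lemma dotDl x y z : dot (x + y) z = dot x z + dot y z.
Proof. by rewrite /dot mulmxDl mxE. Qed.
Lemma dotDr x y z : dot z (x + y) = dot z x + dot z y.
Proof. by rewrite dotC dotDl !(dotC z). Qed.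
Lemma dotZl a x y : dot (a *: x) y = a * dot x y.
Proof. by rewrite /dot -scalemxAl mxE. Qed.
Lemma dotZr a x y : dot y (a *: x) = a * dot y x.
Proof. by rewrite dotC dotZl dotC. Qed.
Lemma dotNl x y : dot (- x) y = - dot x y.
Proof. by rewrite /dot mulNmx mxE. Qed.
Lemma dotNr x y : dot y (- x) = - dot y x.
Proof. by rewrite dotC dotNl dotC. Qed.
Lemma dot0l x : dot 0 x = 0. Proof. by rewrite /dot mul0mx mxE. Qed.
Lemma dot0r x : dot x 0 = 0. Proof. by rewrite dotC dot0l. Qed.

Definition dotS := (dotDl, dotDr, dotZl, dotZr, dotNl, dotNr, dot0l, dot0r).

Lemma dot_orth g x y : g *m g^T = 1%:M -> dot (x *m g) (y *m g) = dot x y.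
Proof. by move=> gg; rewrite /dot trmx_mul mulmxA -(mulmxA x) gg mulmx1. Qed.

Definition perp C x := all (fun c => dot x c == 0) C.

Lemma perpP C x : reflect (forall c, c \in C -> dot x c = 0) (perp C x).
Proof. by apply: (iffP allP) => H c /H /eqP. Qed.

Lemma perp_cons c C x : perp (c :: C) x = (dot x c == 0) && perp C x. Proof. by []. Qed.
Lemma perp_cat C C' x : perp (C ++ C') x = perp C x && perp C' x.
Proof. exact: all_cat. Qed.

Lemma perpD C x y : perp C x -> perp C y -> perp C (x + y).
Proof. by move=> /perpP Hx /perpP Hy; apply/perpP => c cC; rewrite dotDl Hx // Hy // addr0. Qed.
Lemma perpZ C a x : perp C x -> perp C (a *: x).
Proof. by move=> /perpP Hx; apply/perpP => c cC; rewrite dotZl Hx // mulr0. Qed.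
Lemma perpN C x : perp C x -> perp C (- x).
Proof. by rewrite -scaleN1r; apply: perpZ. Qed.
Lemma perpB C x y : perp C x -> perp C y -> perp C (x - y).
Proof. by move=> Hx Hy; apply: perpD => //; apply: perpN. Qed.

Definition grp B g : Prop := g *m g^T = 1%:M /\ forall b, b \in B -> b *m g = b.

Lemma grp1 B : grp B 1%:M.
Proof. by split=> [|b _]; rewrite ?trmx1 ?mulmx1. Qed.
Lemma grpK B g : grp B g -> g *m g^T = 1%:M. Proof. by case. Qed.
Lemma grpKT B g : grp B g -> g^T *m g = 1%:M. Proof. by case=> /mulmx1C. Qed.
Lemma grpT B g : grp B g -> grp B g^T.
Proof.
move=> Hg; split; first by rewrite trmxK (grpKT Hg).
by case: Hg => gg Hg b bB; rewrite -{1}(Hg b bB) -mulmxA gg mulmx1.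
Qed.
Lemma grpM B g (h : 'M[A]_N) : grp B g -> grp B h -> grp B (g *m h).
Proof.
move=> [g1 g2] [h1 h2]; split=> [|b bB]; last by rewrite mulmxA g2 // h2.
by rewrite trmx_mul mulmxA -(mulmxA g) h1 mulmx1.
Qed.
Lemma grp_sub B B' g : {subset B <= B'} -> grp B' g -> grp B g.
Proof. by move=> s [g1 g2]; split=> // b /s /g2. Qed.

Lemma perp_act C x g : grp C g -> perp C (x *m g) = perp C x.
Proof.
move=> [gg Hg]; apply: eq_in_all => c cC.
by rewrite -{1}(Hg c cC) dot_orth.
Qed.

Definition refl u : 'M[A]_N := 1%:M - (2 / dot u u) *: (u^T *m u).

Lemma reflE x u : x *m refl u = x - (2 * dot x u / dot u u) *: u.
Proof.
rewrite /refl mulmxBr mulmx1 -scalemxAr mulmxA; congr (_ - _).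
have -> : x *m u^T = (dot x u)%:M.
  by apply/rowP => i; rewrite !ord1 !mxE /= mulr1n /dot mxE.
by rewrite mul_scalar_mx scalerA; congr (_ *: _); rewrite -!mulrA [_^-1 * _]mulrC.
Qed.

Lemma refl_sym u : (refl u)^T = refl u.
Proof. by rewrite /refl linearB /= linearZ /= trmx1 trmx_mul trmxK. Qed.

Lemma refl_refl u : unit (dot u u) -> refl u *m refl u = 1%:M.
Proof.
move=> Uu; apply/row_matrixP => i; rewrite !rowE mulmx1 mulmxA; set x := delta_mx _ _.
rewrite !reflE -addrA -opprD -scalerDl -[RHS]subr0 -[in RHS](scale0r u); congr (_ - _ *: _).
by rewrite !dotS divrK //; ring.
Qed.

Lemma refl_grp B u : unit (dot u u) -> perp B u -> grp B (refl u).
Proof.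
move=> Uu /perpP Bu; split; first by rewrite refl_sym refl_refl.
by move=> b bB; rewrite reflE dotC Bu // mulr0 mul0r scale0r subr0.
Qed.

Fixpoint ol B : bool := if B is b :: B' then [&& unit (dot b b), perp B' b & ol B'] else true.

Fixpoint proj B x : V :=
  if B is b :: B' then let y := proj B' x in y - (dot y b / dot b b) *: b else x.

Lemma proj_perp B x : ol B -> perp B (proj B x).
Proof.
elim: B => [//|b B IH] /= /and3P[Ub Bb oB].
rewrite !dotS divrK // subrr eqxx /=.
by apply: perpB; [exact: IH|apply: perpZ].
Qed.

Lemma dot_proj B x y : ol B -> perp B y -> dot (proj B x) y = dot x y.
Proof.
elim: B => [//|b B IH] /= /and3P[Ub Bb oB] /andP[/eqP yb By].
by rewrite !dotS [dot b y]dotC yb mulr0 subr0 IH.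
Qed.

End Dot.

Section Local.
Variables (A : idomainType) (N : nat).
Hypothesis Adiv : forall a b : A, (exists c, a = c * b) \/ (exists c, b = c * a).
Hypothesis U2 : unit (2 : A).
Local Notation V := 'rV[A]_N.
Implicit Types (x y z h u v w : V) (B C : seq V) (g : 'M[A]_N).

(** Of two elements one divides the other and hence their sum, so the nonunits form an ideal: the
    ring is local. *)
Lemma unitD (a b : A) : unit (a + b) -> unit a || unit b.
Proof.
case: (Adiv a b) => -[c ->].
  by rewrite -{2}[b]mul1r -mulrDl unitrM => /andP[_ ->]; rewrite orbT.
by rewrite -{1}[a]mul1r -mulrDl unitrM => /andP[_ ->].
Qed.

Lemma unitDl (a b : A) : ~~ unit b -> unit (a + b) = unit a.
Proof.
move=> nb; apply/idP/idP => [/unitD|Ua]; first by rewrite (negbTE nb) orbF.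
have : unit ((a + b) + - b) by rewrite addrK.
by move=> /unitD; rewrite unitrN (negbTE nb) orbF.
Qed.

Lemma nunitD (a b : A) : ~~ unit a -> ~~ unit b -> ~~ unit (a + b).
Proof. by move=> na nb; rewrite unitDl. Qed.

Lemma nunitMr (a b : A) : ~~ unit b -> ~~ unit (a * b).
Proof. by rewrite unitrM negb_and => ->; rewrite orbT. Qed.
Lemma nunitMl (a b : A) : ~~ unit a -> ~~ unit (a * b).
Proof. by rewrite unitrM negb_and => ->. Qed.

Lemma refl_move x y : dot x x = dot y y -> unit (dot (x - y) (x - y)) -> x *m refl (x - y) = y.
Proof.
move=> E U; rewrite reflE.
have -> : 2 * dot x (x - y) = dot (x - y) (x - y).
  by rewrite !dotS (dotC y x) -E; ring.
by rewrite divrr // scale1r subKr.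
Qed.

Lemma unit_dot_or x y : dot x x = dot y y -> unit (dot x x) ->
  unit (dot (x - y) (x - y)) || unit (dot (x + y) (x + y)).
Proof.
move=> E Ux; apply: unitD.
have -> : dot (x - y) (x - y) + dot (x + y) (x + y) = 2 * 2 * dot x x.
  by rewrite !dotS (dotC y x) -E; ring.
by rewrite !unitrM U2.
Qed.

(** One of x - y and x + y has invertible length, because their lengths add up to 4 (x, x). In the
    first case one reflection suffices; in the second x is reflected to -y, and then the reflection
    in y gives y. *)
Lemma transit1 B x y : dot x x = dot y y -> unit (dot x x) -> perp B x -> perp B y ->
  exists g, grp B g /\ x *m g = y.
Proof.
move=> E Ux Bx By; have /orP[U|U] := unit_dot_or E Ux.
  by exists (refl (x - y)); split; [apply: refl_grp => //; apply: perpB|apply: refl_move].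
rewrite -[y]opprK in U.
exists (refl (x - - y) *m refl y); split.
  apply: grpM; apply: refl_grp => //; last by rewrite -E.
  by rewrite opprK; apply: perpD.
rewrite mulmxA refl_move //; last by rewrite !dotS opprK.
rewrite reflE !dotS mulrN mulNr mulrK; last by rewrite -E.
by rewrite scaleNr opprK scaler_nat mulr2n addKr.
Qed.

Lemma divides_all (s : seq A) : s != [::] -> exists2 c, c \in s & forall a, a \in s -> exists d, a = d * c.
Proof.
elim: s => [//|a s IH] _; case: (altP (s =P [::])) => [->|/IH[c cs Hc]].
  by exists a; rewrite ?mem_head // => b; rewrite inE => /eqP->; exists 1; rewrite mul1r.
case: (Adiv a c) => -[e Ee].
  exists c; first by rewrite inE cs orbT.
  by move=> b; rewrite inE => /orP[/eqP->|/Hc//]; exists e.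
exists a; first exact: mem_head.
move=> b; rewrite inE => /orP[/eqP->|/Hc[d ->]]; first by exists 1; rewrite mul1r.
by exists (d * e); rewrite Ee mulrA.
Qed.

Definition prim h := [exists j, unit (h 0 j)].

Lemma prim_decomp x : x != 0 -> exists c h, [/\ x = c *: h, prim h & c != 0].
Proof.
move=> x0; have [j0 xj0] : exists j, x 0 j != 0.
  apply/existsP; apply: contraR x0; rewrite negb_exists => /forallP H.
  by apply/eqP/rowP => j; rewrite mxE; apply/eqP; move: (H j); rewrite negbK.
have [|c /mapP[j1 _ Ec] Hc] := @divides_all [seq x 0 j | j <- enum 'I_N].
  by apply/eqP => E; have := map_f (fun j => x 0 j) (mem_enum 'I_N j0); rewrite E.
have /fin_all_exists[d Hd] : forall j, exists d, x 0 j = d * c.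
  by move=> j; apply: Hc; apply: map_f; rewrite mem_enum.
have c0 : c != 0 by apply: contraNneq xj0 => E; rewrite (Hd j0) E mulr0.
exists c, (\row_j d j); split=> //; first by apply/rowP => j; rewrite !mxE mulrC -Hd.
apply/existsP; exists j1; rewrite mxE.
have -> : d j1 = 1; last exact: unitr1.
by apply: (mulIf c0); rewrite -Hd mul1r Ec.
Qed.

Lemma prim_dual B h : ol B -> perp B h -> prim h -> exists x, perp B x /\ dot h x = 1.
Proof.
move=> oB Bh /existsP[j Uj]; exists (proj B ((h 0 j)^-1 *: delta_mx 0 j)).
split; first exact: proj_perp.
rewrite dotC dot_proj // dotZl dotE (bigD1 j) //= mxE !eqxx mul1r big1 ?addr0 ?mulVr //.
by move=> i /negbTE ij; rewrite mxE eqxx /= ij mul0r.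
Qed.

(** A vector h of noninvertible length cannot be split off alone, but its plane with x can. If x
    also has noninvertible length, x + h replaces it: its length is 2 (h, x) up to nonunits. *)
Lemma plane B h x : perp B h -> perp B x -> unit (dot h x) -> ~~ unit (dot h h) ->
  exists u w, [/\ [/\ unit (dot u u), unit (dot w w) & dot u w = 0], perp B u, perp B w &
    forall C y, perp [:: h, x & C] y = perp [:: u, w & C] y].
Proof.
move=> Bh Bx Uhx nh.
wlog Ux : x Bx Uhx / unit (dot x x).
  move=> W; case: (boolP (unit (dot x x))) => [|nx]; first exact: W.
  have [|||u [w [ol1 Bu Bw H]]] := W (x + h); first exact: perpD.
  - by rewrite dotDr unitDl.
  - have -> : dot (x + h) (x + h) = 2 * dot h x + dot x x + dot h h.
      by rewrite !dotS (dotC x h); ring.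
    by rewrite !unitDl // unitrM U2.
  exists u, w; split=> // C y; rewrite -H !perp_cons dotDr.
  by case: (dot y h =P 0) => [->|]; rewrite // addr0.
exists x, (h - (dot h x / dot x x) *: x); split=> //; last 1 first.
- move=> C y; rewrite !perp_cons !dotS.
  by case: (dot y x =P 0) => [->|] /=; rewrite ?andbF // mulr0 subr0.
- split=> //; last by rewrite !dotS (dotC x h) divrK // subrr.
  have -> : dot (h - (dot h x / dot x x) *: x) (h - (dot h x / dot x x) *: x) =
      - ((dot h x / dot x x) * dot h x) + dot h h.
    rewrite !dotS (dotC x h); have := divrK Ux (dot h x); move: (dot h x / dot x x) => l <-.
    by ring.
  by rewrite unitDl // unitrN !unitrM Uhx unitrV Ux.
- by apply: perpB => //; apply: perpZ.
Qed.

End Local.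

(** * Acyclicity of the complex of orthogonal frames *)

Section Complex.
Variables (A : idomainType) (N : nat).
Local Notation V := 'rV[A]_N.
Implicit Types (x h v e f : V) (B C : seq V) (t s r : seq V).
Variable letter : V -> Prop.

Fixpoint frame C t : Prop :=
  if t is v :: t' then [/\ letter v, perp C v & frame (v :: C) t'] else True.

Lemma perp_catrev t C y : perp (catrev t C) y = perp t y && perp C y.
Proof. by rewrite catrevE perp_cat /perp all_rev. Qed.

Lemma frame_sub C C' t : (forall y : V, perp C y -> perp C' y) -> frame C t -> frame C' t.
Proof.
elim: t C C' => [//|v t IH] C C' H /= [Lv Cv Rt]; split=> //; first exact: H.
by apply: IH Rt => y /= /andP[-> /H].
Qed.

Lemma frame_cat C t s : frame C t -> frame (catrev t C) s -> frame C (t ++ s).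
Proof. by elim: t C => [//|v t IH] C /= [Lv Cv Rt] Rs; split=> //; apply: IH. Qed.

Lemma frame_catE C t s : frame C (t ++ s) -> frame C t /\ frame (catrev t C) s.
Proof. by elim: t C => [//|v t IH] C /= [Lv Cv /IH[]]. Qed.

Lemma frame_subseq C s t : subseq s t -> frame C t -> frame C s.
Proof.
elim: t C s => [|v t IH] C [|w s] //= H [Lv Cv Rt]; move: H; case: eqP => [->|_] H.
  by split=> //; apply: IH.
by apply: (IH C (w :: s)) => //; apply: frame_sub Rt => y /= /andP[].
Qed.

Lemma frame_del C t : frame C t -> sup (frame C) (del t).
Proof. by move=> Rt; apply: sub_sup (del_sub t) _ => s st; apply: frame_subseq Rt. Qed.

Lemma frame_perp C t : frame C t -> forall c, c \in C -> perp t c.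
Proof.
elim: t C => [//|v t IH] C /= [Lv /perpP Cv Rt] c cC.
by rewrite dotC Cv // eqxx /=; apply: (IH (v :: C)) => //; rewrite inE cC orbT.
Qed.

Definition nframe C n t := frame C t /\ size t = n.

Definition Exact C n := forall z, sup (nframe C n) z -> D z = 0 ->
  exists2 w, sup (nframe C n.+1) w & D w = z.

Lemma nframe_sub C C' n c : (forall y : V, perp C y -> perp C' y) -> sup (nframe C n) c -> sup (nframe C' n) c.
Proof. by move=> H Sc; apply: sub_sup Sc _ => t [Rt <-]; split=> //; apply: frame_sub Rt. Qed.

Lemma Exact_eq C C' n : (forall y : V, perp C y = perp C' y) -> Exact C n -> Exact C' n.
Proof.
move=> H E z Sz Dz; have [||w Sw Dw] := E z; rewrite //; first by apply: nframe_sub Sz => y; rewrite H.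
by exists w => //; apply: nframe_sub Sw => y; rewrite H.
Qed.

Lemma nframe_cns C n v c : letter v -> perp C v -> sup (nframe (v :: C) n) c -> sup (nframe C n.+1) (cns v c).
Proof. by move=> Lv Cv Sc; apply: (sup_lin Sc) => t [Rt <-]; apply: supU; split. Qed.

Definition join : fr (seq V * seq V) -> fr (seq V) := lin (fun p => << p.1 ++ p.2 >>).
HB.instance Definition _ := GRing.Additive.on join.
Definition D1 : fr (seq V * seq V) -> fr (seq V * seq V) := opl (@del V).
HB.instance Definition _ := GRing.Additive.on D1.
Definition D2 : fr (seq V * seq V) -> fr (seq V * seq V) := opr (fun _ => @del V).
HB.instance Definition _ := GRing.Additive.on D2.

Lemma del_cat t s : del (t ++ s) =
  lin (fun t' => << t' ++ s >>) (del t) + sgn (odd (size t)) (lin (fun s' => << t ++ s' >>) (del s)).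
Proof.
elim: t => [|v t IH] /=.
  by rewrite raddf0 add0r (lin_id (sup_T _)).
rewrite IH raddfB raddfD /= linU /cns sgn_add /= !lin_lin.
rewrite (eq_lin_fun (g := fun t' => << v :: t' ++ s >>)); last by move=> t'; exact: linU.
rewrite [X in sgn _ X](eq_lin_fun (g := fun s' => << v :: t ++ s' >>)); last by move=> s'; exact: linU.
rewrite [X in _ = _ - X + _](eq_lin_fun (g := fun t' => << v :: t' ++ s >>)); last by move=> t'; exact: linU.
by case: odd => /=; zmod.
Qed.

Lemma D_join a c : sup (fun p => size p.1 = a) c ->
  D (join c) = join (D1 c) + sgn (odd a) (join (D2 c)).
Proof.
move: c; apply: sup_ind => [|[t s] /= <-|c c' Hc Hc'].
- by rewrite !raddf0; case: odd => /=; rewrite ?oppr0 addr0.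
- rewrite /join linU DU del_cat /= [D1 _]oplU [D2 _]oprU !lin_lin; congr (_ + _).
    by apply: eq_lin_fun => t'; rewrite linU.
  by congr sgn; apply: eq_lin_fun => t'; rewrite linU.
- by rewrite !raddfB /= Hc Hc'; case: odd {Hc Hc'} => /=; zmod.
Qed.

Lemma D1D1 c : D1 (D1 c) = 0.
Proof.
elim/fr_ind: c => [|[t s]|a b Ha Hb]; rewrite ?raddf0 //; last by rewrite !raddfB /= Ha Hb subr0.
rewrite [D1 << _ >>]oplU lin_add (eq_lin_fun (g := fun t' => lin (fun r => << (r, s) >>) (del t'))).
  by rewrite -lin_lin -DU -/(D _) DD raddf0.
by move=> t'; rewrite /= [D1 _]oplU.
Qed.

Lemma D1D2 c : D1 (D2 c) = D2 (D1 c). Proof. by apply: opl_opr => x y. Qed.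

Definition bicell C x a b (p : seq V * seq V) :=
  (frame C p.1 /\ size p.1 = a) /\ nframe (x :: catrev p.1 C) b p.2.

Lemma bicell_D1 C x a b c : sup (bicell C x a.+1 b) c -> sup (bicell C x a b) (D1 c).
Proof.
move=> Sc; apply: (opl_sup Sc) => t s [/= [Rt St] [Rs Ss]].
apply: sub_sup (supI (del_sub t) (del_size t)) _ => t' [t't St']; split; split=> //=.
- exact: frame_subseq Rt.
- by apply: succn_inj; rewrite St'.
- apply: frame_sub Rs => y /=; rewrite !perp_catrev => /and3P[-> ty ->]; rewrite andbT /=.
  by apply/perpP => v /(mem_subseq t't); apply/perpP.
Qed.

Lemma bicell_join C x a b c : sup (bicell C x a b) c -> sup (nframe C (a + b)) (join c).
Proof.
move=> Sc; apply: (sup_lin Sc) => -[t s] [/= [Rt <-] [Rs <-]]; apply: supU; split; rewrite ?size_cat //.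
by apply: frame_cat => //; apply: frame_sub Rs => y /= /andP[].
Qed.

(* The double complex of pairs (t, s) with s orthogonal to x and to t: a cycle is moved,
   one position at a time, from the first coordinate to the second. *)
Lemma stair C x n a0 z :
  (a0 <= n)%N ->
  (forall a t, (a0 < a <= n)%N -> frame C t -> size t = a -> Exact (x :: catrev t C) (n - a)) ->
  sup (nframe C n) z -> D z = 0 ->
  exists y w, [/\ sup (bicell C x a0 (n - a0)) y, D1 y = 0, D2 y = 0, sup (nframe C n.+1) w & z = join y + D w].
Proof.
move=> a0n rows Sz Dz.
suff H k : (k <= n - a0)%N -> exists y w, [/\ sup (bicell C x (n - k) k) y, D1 y = 0, D2 y = 0,
    sup (nframe C n.+1) w & z = join y + D w].
  by have [//|y [w]] := H (n - a0)%N; rewrite subKn //; exists y, w.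
elim: k => [_|k IH kn].
  exists (lin (fun t => << (t, [::]) >>) z), 0; rewrite subn0 raddf0 addr0; split=> //.
  - by apply: (sup_lin Sz) => t [Rt St]; apply: supU.
  - rewrite /D1 lin_add (eq_lin_fun (g := fun t => lin (fun t' => << (t', [::]) >>) (del t))).
      by rewrite -lin_lin -/(D _) Dz raddf0.
    by move=> t; rewrite /= oplU.
  - rewrite /D2 lin_add (eq_lin_fun (g := fun=> 0)) ?lin_0 // => t.
    by rewrite /= oprU raddf0.
  - exact: sup0.
  - rewrite /join lin_lin (lin_id (sup_T _)) // => t _.
    by rewrite linU cats0.
have [|y [w [Sy D1y D2y Sw Ez]]] := IH; first exact: ltnW.
have [a Ea] : exists a, (n - k)%N = a.+1 by exists (n - k).-1; lia.
rewrite Ea in Sy.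
have [v Sv Dv] : exists2 v, sup (bicell C x a.+1 k.+1) v & D2 v = y.
  apply: (fiber_exact (d' := @del V) (P := fun t => frame C t /\ size t = a.+1)
    (Q := fun t => nframe (x :: catrev t C) k) (Q' := fun t => nframe (x :: catrev t C) k.+1) _ Sy D2y).
  move=> t c [Rt St] Sc dc.
  have := rows a.+1 t _ Rt St; have -> : (n - a.+1)%N = k by lia.
  by apply=> //; lia.
have -> : (n - k.+1)%N = a by lia.
pose b := odd a.+1.
(* The boundary of [join v] consists of [join (D1 v)] and, up to sign, [join y]; so y may be traded
   for a chain with one letter fewer on the left and one more on the right. *)
have Jv := D_join (sub_sup Sv (fun p (Hp : bicell C x a.+1 k.+1 p) => proj2 (proj1 Hp))).
exists (- sgn b (D1 v)), (w + sgn b (join v)); split.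
- apply: supN; rewrite /b; case: odd => /=; last exact: bicell_D1 Sv.
  by apply: supN; apply: bicell_D1 Sv.
- by rewrite raddfN sgn_add /= D1D1; case: (b); rewrite /= ?oppr0.
- by rewrite raddfN sgn_add /= -D1D2 Dv D1y; case: (b); rewrite /= ?oppr0.
- apply: supD => //; have -> : n.+1 = (a.+1 + k.+1)%N by lia.
  rewrite /b; case: odd => /=; last exact: bicell_join Sv.
  by apply: supN; apply: bicell_join Sv.
- rewrite Ez raddfD raddfN !sgn_add /= Jv Dv -/b.
  by case: (b) => /=; zmod.
Qed.

End Complex.

Section Acyclic.
Variables (A : idomainType) (N : nat).
Hypothesis Adiv : forall a b : A, (exists c, a = c * b) \/ (exists c, b = c * a).
Hypothesis U2 : unit (2 : A).
Local Notation V := 'rV[A]_N.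
Implicit Types (x h v e f : V) (B C : seq V) (t : seq V).
(* Ms B m says that the constraints B leave room for m more letters; a constraint by an arbitrary
   vector of invertible length uses up kap of them. *)
Variables (letter : V -> Prop) (kap : nat) (Ms : seq V -> nat -> Prop).
Hypothesis letterU : forall v, letter v -> unit (dot v v).
Hypothesis M_ol : forall B m, Ms B m -> ol B.
Hypothesis M_le : forall B m m', Ms B m -> (m' <= m)%N -> Ms B m'.
Hypothesis M_letter : forall B m e, Ms B m.+1 -> letter e -> perp B e -> Ms (e :: B) m.
Hypothesis M_vec : forall B m v, Ms B (kap + m) -> unit (dot v v) -> perp B v -> Ms (v :: B) m.
Hypothesis M_ex : forall B, Ms B 1 -> exists2 e, letter e & perp B e.
(** The third letter for a plane of e and v that is degenerate modulo the maximal ideal; [aux_five]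
    and [aux_three] provide it. *)
Hypothesis M_aux : forall B e v h b c, Ms B kap.+2 -> letter e -> letter v -> perp B e -> perp B v ->
  perp (e :: B) h -> prim h -> ~~ unit (dot h h) -> v = b *: e + c *: h ->
  exists f, [/\ letter f, perp B f, unit (dot h f), unit (dot e e * dot f f - dot e f ^+ 2) &
                unit (dot v v * dot f f - dot v f ^+ 2)].

Local Notation frame := (frame letter).
Local Notation nframe := (nframe letter).
Local Notation Exact := (Exact letter).
Local Notation k := kap.+1.

Lemma perp_scale C a h (y : V) : a != 0 -> perp (a *: h :: C) y = perp (h :: C) y.
Proof. by move=> /negbTE a0; rewrite !perp_cons dotZr mulf_eq0 a0. Qed.

Lemma perp_proj B x (y : V) : ol B -> perp (x :: B) y = perp (proj B x :: B) y.
Proof.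
move=> oB; rewrite !perp_cons; case: (boolP (perp B y)) => [By|]; last by rewrite !andbF.
by rewrite (dotC y (proj _ _)) dot_proj // dotC.
Qed.

Lemma M_catrev B m t : Ms B (size t + m) -> frame B t -> Ms (catrev t B) m.
Proof.
elim: t B => [//|v t IH] B /= HM [Lv Bv Rt]; apply: IH => //.
exact: M_letter.
Qed.

Lemma M_plane B h x m : Ms B (kap + (kap + m)) -> perp B h -> perp B x -> unit (dot h x) ->
  ~~ unit (dot h h) ->
  exists u w, Ms (u :: w :: B) m /\ forall y : V, perp [:: h, x & B] y = perp [:: u, w & B] y.
Proof.
move=> HM Bh Bx Uhx nh; have [u [w [[Uu Uw uw] Bu Bw H]]] := plane Adiv U2 Bh Bx Uhx nh.
exists u, w; split; last by move=> y; rewrite H.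
by apply: M_vec => //; [exact: M_vec|rewrite /= uw eqxx].
Qed.

(** The vector f need not be orthogonal to the letters already placed, so it is projected to their
    complement. Its product with h is unchanged there, and h with the projection spans a nonsingular
    plane, to which the induction hypothesis applies. The plane takes 2 [kap] places: [kap] from the
    assumed slack, [kap] from the fall in degree by at least one. *)
Lemma push B h f n z :
  (forall m B', (m < n)%N -> Ms B' (m * k).+1 -> Exact B' m) ->
  Ms B (kap + (n * k).+1) -> perp B h -> ~~ unit (dot h h) -> unit (dot h f) ->
  sup (nframe (h :: B) n) z -> D z = 0 ->
  exists z' w, [/\ sup (nframe [:: f, h & B] n) z', D z' = 0, sup (nframe (h :: B) n.+1) w & z = z' + D w].
Proof.
move=> IH HM Bh nh Uhf Sz Dz.
have [//||//|//|y [w [Sy D1y D2y Sw Ez]]] := @stair _ _ letter (h :: B) f n 0 z; last first.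
  exists (join y), w; split=> //.
  - by apply: (sup_lin Sy) => -[[|v t] s] [[/= _ St] [Rs Ss]] //; rewrite subn0 in Ss; apply: supU.
  - have := D_join (a := 0) (sub_sup Sy (fun p Hp => proj2 (proj1 Hp))).
    by rewrite D1y D2y !raddf0 addr0.
move=> a t /andP[a0 an] Rt St.
have Bt : frame B t by apply: frame_sub Rt => y /= /andP[].
have HM' : Ms (catrev t B) (kap + (n * k).+1 - a).
  by apply: M_catrev Bt; rewrite St subnKC //; apply: (leq_trans an); nia.
have oB' := M_ol HM'.
have th : perp (catrev t B) h.
  by rewrite perp_catrev Bh andbT; apply: (frame_perp Rt); rewrite mem_head.
have Uhf' : unit (dot h (proj (catrev t B) f)) by rewrite dotC dot_proj // dotC.
have [|u [w [HM'' H]]] := @M_plane (catrev t B) h (proj (catrev t B) f) ((n - a) * k).+1 _ th (proj_perp _ oB') Uhf' nh.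
  by apply: M_le HM' _; nia.
have := IH (n - a)%N _ _ HM''; rewrite -subn_gt0 subKn // => /(_ a0).
apply: Exact_eq => y; rewrite -H perp_cons -(perp_proj f y oB') !perp_cons !perp_catrev perp_cons.
by rewrite andbCA; congr (_ && _); rewrite andbCA.
Qed.

(** Only the primitive part h of the projection of x matters. If h has noninvertible length, the
    cycle is pushed into the complement of a dual vector f, and is filled in the complement of the
    nonsingular plane of h and f, which is still orthogonal to h. *)
Lemma exact_one B x n :
  (forall m B', (m <= n)%N -> Ms B' (m * k).+1 -> Exact B' m) ->
  Ms B (kap + (kap + (n * k).+1)) -> Exact (x :: B) n.
Proof.
move=> IH HM; have oB := M_ol HM.
apply: (@Exact_eq _ _ _ (proj B x :: B)); first by move=> y; rewrite -perp_proj.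
have Bp := proj_perp x oB.
case: (altP (proj B x =P 0)) => [->|/(prim_decomp Adiv)[c [h [Ex ph c0]]]].
  apply: (@Exact_eq _ _ _ B); first by move=> y; rewrite perp_cons dot0r eqxx.
  by apply: IH => //; apply: M_le HM _; lia.
rewrite Ex in Bp *; apply: (@Exact_eq _ _ _ (h :: B)); first by move=> y; rewrite perp_scale.
have {}Bp : perp B h.
  by apply/perpP => b bB; move/perpP: Bp => /(_ b bB) /eqP; rewrite dotZl mulf_eq0 (negbTE c0) => /eqP.
case: (boolP (unit (dot h h))) => [Uh|nh].
  by apply: IH => //; apply: M_vec => //; apply: M_le HM _; lia.
have [f [Bf hf]] := prim_dual oB Bp ph.
have Uhf : unit (dot h f) by rewrite hf unitr1.
move=> z Sz Dz.
have [||z' [w [Sz' Dz' Sw ->]]] := push (f := f) _ _ Bp nh Uhf Sz Dz.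
- by move=> m B' mn; apply: IH; apply: ltnW.
- by apply: M_le HM _; lia.
have [u [w' [HM'' H]]] := M_plane HM Bp Bf Uhf nh.
have : Exact [:: f, h & B] n.
  by apply: (Exact_eq _ (IH n _ (leqnn n) HM'')) => y; rewrite -H !perp_cons andbCA.
move=> /(_ z' Sz' Dz')[w1 Sw1 <-]; exists (w1 + w); last by rewrite raddfD.
by apply: supD => //; apply: nframe_sub Sw1 => y /= /andP[].
Qed.

(** Suspension: the cones with apexes e and v over a common filling of c are glued along it. *)
Lemma cone_diff C e v n c b : letter e -> letter v -> perp C e -> perp C v ->
  sup (nframe [:: e, v & C] n.+1) b -> D b = c ->
  exists2 w, sup (nframe C n.+2) w & cns v c - cns e c = D w.
Proof.
move=> Le Lv Ce Cv Sb <-; exists (cns e b - cns v b).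
  by apply: supB; apply: nframe_cns => //; apply: nframe_sub Sb => y /= /and3P[ye yv yC]; apply/andP.
by rewrite raddfB /= !D_cns; zmod.
Qed.

Lemma good_pair C e v : ol C -> perp C e -> perp C v -> unit (dot e e) ->
  unit (dot e e * dot v v - dot e v ^+ 2) ->
  exists2 h, unit (dot h h) /\ perp (e :: C) h & forall C' (y : V), perp [:: e, v & C'] y = perp [:: h, e & C'] y.
Proof.
move=> oC Ce Cv Ue U; exists (v - (dot v e / dot e e) *: e).
  split; last first.
    rewrite perp_cons !dotS divrK // subrr eqxx /=.
    by apply: perpB => //; apply: perpZ.
  have -> : dot (v - (dot v e / dot e e) *: e) (v - (dot v e / dot e e) *: e) =
      (dot e e)^-1 * (dot e e * dot v v - dot e v ^+ 2).
    rewrite mulrBr mulKr // !dotS (dotC e v) -!mulrA [_^-1 * dot e e]mulrC divrr //; ring.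
  by rewrite unitrM unitrV Ue.
move=> C' y; rewrite !perp_cons !dotS.
by case: (dot y e =P 0) => [->|]; rewrite ?andbF // mulr0 subr0.
Qed.

(** For a fixed letter e, [stair] reduces a cycle to a sum of terms v c_v, where the cycle c_v is
    orthogonal to v and e. The c_v add up to zero, so the sum does not change if every v is replaced
    by v - e, and [key] fills each such term. *)
Theorem acyclic n B : Ms B (n * k).+1 -> Exact B n.
Proof.
elim/ltn_ind: n B => n IH B HM; have oB := M_ol HM.
case: n IH HM => [|n] IH HM.
  have [e Le Be] := M_ex HM; move=> z Sz Dz.
  exists (cns e z); last by rewrite D_cns Dz raddf0 subr0.
  by apply: (sup_lin Sz) => -[|v t] [_ St] //; apply: supU.
have [e Le Be] := M_ex (M_le HM (isT : (1 <= (n.+1 * k).+1)%N)).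
have Ue := letterU Le.
have HMe : Ms (e :: B) (kap + (n * k).+1) by apply: M_letter => //; apply: M_le HM _; lia.
(* (v - e) * c bounds for every letter v and every cycle c orthogonal to both *)
have key v c : letter v -> perp B v -> sup (nframe [:: e, v & B] n) c -> D c = 0 ->
    exists2 w, sup (nframe B n.+2) w & cns v c - cns e c = D w.
  move=> Lv Bv Sc Dc.
  have good e' v' c' : letter e' -> letter v' -> perp B e' -> perp B v' ->
      unit (dot e' e' * dot v' v' - dot e' v' ^+ 2) -> sup (nframe [:: e', v' & B] n) c' -> D c' = 0 ->
      exists2 w, sup (nframe B n.+2) w & cns v' c' - cns e' c' = D w.
    move=> Le' Lv' Be' Bv' U Sc' Dc'.
    have [h [Uh Bh] Hh] := good_pair oB Be' Bv' (letterU Le') U.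
    have : Exact [:: h, e' & B] n.
      apply: IH => //; apply: M_vec => //; apply: M_letter => //; apply: M_le HM _; lia.
    move=> /(Exact_eq (fun y => esym (Hh B y)))/(_ c' Sc' Dc')[b Sb Db].
    exact: (cone_diff _ _ _ _ Sb Db).
  have bounds C' : (forall y : V, perp C' y = perp [:: e, v & B] y) -> Exact C' n ->
      exists2 w, sup (nframe B n.+2) w & cns v c - cns e c = D w.
    by move=> H /(Exact_eq H)/(_ c Sc Dc)[b Sb Db]; apply: cone_diff Sb Db.
  set b := dot v e / dot e e; pose x := v - b *: e.
  have Ev : v = b *: e + x by rewrite addrC subrK.
  have ex : dot e x = 0 by rewrite dotC !dotS divrK // subrr.
  have Bx : perp (e :: B) x.
    by rewrite perp_cons dotC ex eqxx; apply: perpB => //; apply: perpZ.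
  have Hx C' (y : V) : perp [:: e, v & C'] y = perp [:: x, e & C'] y.
    rewrite !perp_cons /x !dotS.
    by case: (dot y e =P 0) => [->|]; rewrite ?andbF // mulr0 subr0.
  case: (altP (x =P 0)) => [x0|/(prim_decomp Adiv)[a [h [Exh ph a0]]]].
    apply: (@bounds (e :: B)); first by move=> y; rewrite Hx x0 [in RHS]perp_cons dot0r eqxx.
    by apply: IH => //; apply: M_le HMe _; lia.
  have {}Hx C' (y : V) : perp [:: e, v & C'] y = perp [:: h, e & C'] y.
    by rewrite Hx Exh perp_scale.
  have {}Bx : perp (e :: B) h.
    apply/perpP => d dB; move/perpP: Bx => /(_ d dB) /eqP.
    by rewrite Exh dotZl mulf_eq0 (negbTE a0) => /eqP.
  case: (boolP (unit (dot h h))) => [Uh|nh].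
    apply: (@bounds [:: h, e & B]); first by move=> y; rewrite Hx.
    by apply: IH => //; apply: M_vec.
  (* The plane of e and v is degenerate modulo the maximal ideal. Both are compared with f, after c
     has been moved into the complement of f. *)
  have [|f [Lf Bf Uhf Uef Uvf]] := M_aux (M_le HM _) Le Lv Be Bv Bx ph nh (etrans Ev (congr1 _ Exh)).
    by lia.
  have Sc' : sup (nframe [:: h, e & B] n) c by apply: nframe_sub Sc => y; rewrite Hx.
  have [|c1 [w [Sc1 Dc1 Sw Ec]]] := push (f := f) _ HMe Bx nh Uhf Sc' Dc.
    by move=> m B' mn; apply: IH; apply: ltnW.
  have Sef : sup (nframe [:: e, f & B] n) c1.
    by apply: nframe_sub Sc1 => y; rewrite !perp_cons => /and4P[-> _ -> ->].
  have Svf : sup (nframe [:: v, f & B] n) c1.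
    apply: nframe_sub Sc1 => y; rewrite !perp_cons => /and4P[-> yh ye ->]; rewrite andbT.
    by rewrite Ev Exh !dotS (eqP yh) (eqP ye) !mulr0 addr0 eqxx.
  have [w1 Sw1 E1] := good _ _ _ Le Lf Be Bf Uef Sef Dc1.
  have [w2 Sw2 E2] := good _ _ _ Lv Lf Bv Bf Uvf Svf Dc1.
  have Swe : sup (nframe [:: e, v & B] n.+1) w by apply: nframe_sub Sw => y; rewrite Hx.
  have [w3 Sw3 E3] := cone_diff Le Lv Be Bv Swe (erefl _).
  exists (w1 - w2 + w3); first by apply: supD => //; apply: supB.
  by rewrite raddfD raddfB /= -E1 -E2 -E3 Ec !raddfD /=; zmod.
move=> z Sz Dz.
(* The staircase stops at one letter on the left: the extra constraint e costs 2 [kap] in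
   [exact_one], and the fall in degree pays for this only when there are at least two letters. *)
have [//||//|//|y [w [Sy D1y D2y Sw Ez]]] := @stair _ _ letter B e n.+1 1 z.
  move=> a t /andP[a1 an] Rt St.
  apply: exact_one => [m B' mn|]; first by apply: IH; lia.
  by apply: M_catrev Rt; apply: M_le HM _; rewrite St; nia.
rewrite subSS subn0 in Sy.
pose snd : fr (seq V * seq V) -> fr (seq V) := lin (fun p => << p.2 >>).
pose K y := exists2 w, sup (nframe B n.+2) w & join y - cns e (lin (fun p => << p.2 >>) y) = D w.
have [w' Sw' Ew'] : K y.
  apply: (fiber_ind (K := K) (P := fun t => frame B t /\ size t = 1%N)
      (Q := fun t => nframe (e :: catrev t B) n) Sy D2y) => [|a b [u Su Eu] [u' Su' Eu']|t c [Rt St] Sc Dc].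
  - by exists 0; [exact: sup0|rewrite !raddf0 ?subr0 ?addr0].
  - exists (u + u'); first exact: supD.
    by rewrite !raddfD /= -Eu -Eu'; zmod.
  case: t Rt St Sc => [//|v [|//]] /= [Lv Bv _] _ Sc.
  have [u Su Eu] := key v c Lv Bv Sc Dc; exists u => //; rewrite -Eu; congr (_ - cns _ _).
    by rewrite /join /inj lin_lin; apply: eq_lin_fun => s; rewrite linU.
  by rewrite /inj lin_lin (lin_id (sup_T _)) // => s _; rewrite linU.
(* On a single letter [D1] just forgets it, so [D1 y = 0] says that the cycles attached to the
   letters add up to zero. *)
have snd0 : lin (fun p => << p.2 >>) y = 0.
  have <- : lin (fun p => << p.2 >>) (D1 y) = lin (fun p => << p.2 >>) y.
    rewrite /D1 lin_lin; apply: (eq_lin Sy) => -[t s] [[_ /=]]; case: t => [//|v [|//]] _ _ /=.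
    by rewrite raddf0 subr0 !linU.
  by rewrite D1y raddf0.
exists (w' + w); first exact: supD.
by rewrite raddfD /= -Ew' snd0 raddf0 subr0 -Ez.
Qed.

End Acyclic.

(** * Frames with group simplices, and Shapiro's lemma *)

Definition att (X X' Y : choiceType) (k : X -> X') : fr (X * Y) -> fr (X' * Y) :=
  opl (fun x => << k x >>).
HB.instance Definition _ (X X' Y : choiceType) (k : X -> X') := GRing.Additive.on (@att X X' Y k).

Lemma attU (X X' Y : choiceType) (k : X -> X') (x : X) (y : Y) : att k << (x, y) >> = << (k x, y) >>.
Proof. by rewrite [att _ _]oplU linU. Qed.

Lemma att_sup (X X' Y : choiceType) (k : X -> X') (P : X * Y -> Prop) (Q : X' * Y -> Prop) c :
  sup P c -> (forall x y, P (x, y) -> Q (k x, y)) -> sup Q (att k c).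
Proof. by move=> Sc PQ; apply: (opl_sup Sc) => x y Pxy; apply/supU/PQ. Qed.

Lemma att_att (X X' X'' Y : choiceType) (k : X -> X') (k' : X' -> X'') (c : fr (X * Y)) :
  att k' (att k c) = att (k' \o k) c.
Proof.
apply: (eq_add (F := att k' \o att k) (G := att (k' \o k)) (sup_T c)) => -[x y] _ /=.
by rewrite !attU.
Qed.

Section Att.
Variables (A : comUnitRingType) (N : nat) (X X' : choiceType).
Local Notation M := 'M[A]_N.
Variables (act : X -> M -> X) (act' : X' -> M -> X') (k : X -> X').
Variables (dX : X -> fr X) (dX' : X' -> fr X') (dg : X -> nat) (dg' : X' -> nat) (Gk : M -> Prop).

Lemma att_dbar c : (forall x g, Gk g -> act' (k x) g^T = k (act x g^T)) ->
  sup (fun p : X * seq M => forall g, g \in p.2 -> Gk g) c ->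
  dbar act' (att k c) = att k (dbar act c).
Proof.
move=> Hk Sc; apply: (eq_add (F := dbar act' \o att k) (G := att k \o dbar act) Sc) => -[x u] /= Hu.
rewrite attU /dbar !delrU /nf !lin_lin lin_add.
apply: (eq_lin (del_sub u)) => -[|g v] gu; first by rewrite !linU /= raddf0.
rewrite !linU /nfg /= /actu /= attU Hk //; apply: Hu; apply: (mem_subseq gu).
exact: mem_head.
Qed.

Lemma att_delta c : (forall x g, Gk g -> act' (k x) g^T = k (act x g^T)) ->
  (forall x, dX' (k x) = lin (fun y => << k y >>) (dX x)) -> (forall x, dg' (k x) = dg x) ->
  sup (fun p : X * seq M => forall g, g \in p.2 -> Gk g) c ->
  delta act' dX' dg' (att k c) = att k (delta act dX dg c).
Proof.
move=> Hk Hd Hg Sc; rewrite /delta raddfD /=; congr (_ + _).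
  apply: (eq_add (F := dleft dX' \o att k) (G := att k \o dleft dX) Sc) => -[x u] _ /=.
  rewrite attU !dleftU Hd lin_lin [RHS]lin_add.
  by apply: eq_lin_fun => y; rewrite linU /= attU.
rewrite (att_dbar Hk Sc); apply: tw_even => -[x u]; rewrite /= attU.
by apply: supU; rewrite /= Hg.
Qed.

End Att.

Section Pairs.
Variables (A : idomainType) (N : nat).
Local Notation V := 'rV[A]_N.
Local Notation M := 'M[A]_N.
Implicit Types (B C : seq V) (f s t : seq V) (g : M).

Definition acts s g : seq V := [seq v *m g | v <- s].
Lemma acts1 s : acts s 1%:M = s.
Proof. by rewrite /acts -[RHS]map_id; apply: eq_map => v; rewrite mulmx1. Qed.
Lemma actsM s g h : acts s (g *m h) = acts (acts s g) h.
Proof. by rewrite /acts -map_comp; apply: eq_map => v /=; rewrite mulmxA. Qed.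
Lemma acts_grp C g : grp C g -> acts C g = C.
Proof. by move=> [_ H]; rewrite /acts -[RHS]map_id; apply/eq_in_map. Qed.
Lemma grp_acts C g : g *m g^T = 1%:M -> acts C g = C -> grp C g.
Proof.
move=> gg E; split=> //; elim: C E => [//|c C IH] [Ec EC] b.
by rewrite inE => /orP[/eqP->|/IH->].
Qed.
Lemma acts_catrev s t g : acts (catrev s t) g = catrev (acts s g) (acts t g).
Proof. by elim: s t => [//|v s IH] t; exact: IH. Qed.
Lemma grp_catrev f C g : grp (catrev f C) g <-> grp C g /\ acts f g = f.
Proof.
split=> [H|[H E]].
  split; first by apply: grp_sub H => b bC; rewrite catrevE mem_cat bC orbT.
  by apply: acts_grp; apply: grp_sub H => b bC; rewrite catrevE mem_cat mem_rev bC.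
by apply: grp_acts; [case: H|rewrite acts_catrev E (acts_grp H)].
Qed.

Lemma dels_act s g : del (acts s g) = lin (fun t => << acts t g >>) (del s).
Proof. exact: del_map. Qed.
Lemma dels_dels s : lin (@del V) (del s) = 0.
Proof. by rewrite -DU -/(D _) DD. Qed.
Lemma size_acts s g : size (acts s g) = size s. Proof. exact: size_map. Qed.

Definition unitv (v : V) := dot v v = 1.

Lemma frame_act letter C s g : g *m g^T = 1%:M -> (forall v : V, letter v -> letter (v *m g)) ->
  frame letter C s -> frame letter (acts C g) (acts s g).
Proof.
move=> gg Lg; elim: s C => [//|v s IH] C /= [Lv Cv Rs]; split; [exact: Lg| |exact: (IH (v :: C))].
by rewrite /perp all_map /=; apply: sub_all Cv => c /=; rewrite dot_orth.
Qed.

Lemma unitv_act v g : g *m g^T = 1%:M -> unitv v -> unitv (v *m g).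
Proof. by move=> gg; rewrite /unitv dot_orth. Qed.

Lemma frame_grp letter C s g : (forall v : V, letter v -> letter (v *m g)) ->
  grp C g -> frame letter C s -> frame letter C (acts s g).
Proof. by move=> Lg Gg Rs; rewrite -(acts_grp Gg); apply: frame_act => //; case: Gg. Qed.

Lemma frame_unit_grp C s g : grp C g -> frame unitv C s -> frame unitv C (acts s g).
Proof. by move=> Gg; apply: frame_grp => // v; apply: unitv_act; case: Gg. Qed.

Definition XT B s := frame unitv B s.
Definition ds : fr (seq V * seq M) -> fr (seq V * seq M) := delta acts (@del V) size.
HB.instance Definition _ := GRing.Additive.on ds.
(* Chains of simplices (s, u): s an orthonormal frame orthogonal to B, u in the group of B. *)
Definition TT B n := Nc (@size V) (XT B) (grp B) n.

(** In a pair (f, s) the group moves both frames, but the boundary [del2] acts on s only; f is a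
    passive label whose stabilizer is to be extracted. *)
Definition act2 (x : seq V * seq V) g := (acts x.1 g, acts x.2 g).
Definition del2 (x : seq V * seq V) : fr (seq V * seq V) := lin (fun s => << (x.1, s) >>) (del x.2).
Definition size2 (x : seq V * seq V) := size x.2.
Definition ds2 : fr (seq V * seq V * seq M) -> fr (seq V * seq V * seq M) := delta act2 del2 size2.
HB.instance Definition _ := GRing.Additive.on ds2.
Definition XF (F : seq V -> Prop) C x := F x.1 /\ XT (catrev x.1 C) x.2.
Definition TF F C n := Nc size2 (XF F C) (grp C) n.

Lemma act2_1 x : act2 x 1%:M = x.
Proof. by case: x => f s; rewrite /act2 /= !acts1. Qed.
Lemma act2_M x g h : act2 x (g *m h) = act2 (act2 x g) h.
Proof. by case: x => f s; rewrite /act2 /= !actsM. Qed.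
Lemma del2_act x g : del2 (act2 x g) = lin (fun y => << act2 y g >>) (del2 x).
Proof.
case: x => f s; rewrite /del2 /act2 /= dels_act !lin_lin.
by apply: eq_lin_fun => t; rewrite !linU.
Qed.
Lemma del2_dg x : sup (fun y => (size2 y).+1 = size2 x) (del2 x).
Proof. by case: x => f s; apply: (sup_lin (del_size s)) => t Ht; apply: supU. Qed.
Lemma del2_del2 x : lin del2 (del2 x) = 0.
Proof.
case: x => f s; rewrite /del2 lin_lin /=.
transitivity (lin (fun s => << (f, s) >>) (lin (@del V) (del s))); last by rewrite dels_dels raddf0.
by rewrite lin_lin; apply: eq_lin_fun => t; rewrite linU.
Qed.
Lemma size2_act x g : size2 (act2 x g) = size2 x. Proof. exact: size_acts. Qed.

Lemma XT_act B s g : XT B s -> grp B g -> XT B (acts s g).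
Proof. by move=> Rs Gg; exact: frame_unit_grp. Qed.
Lemma XT_del B s : XT B s -> sup (XT B) (del s).
Proof. exact: frame_del. Qed.
Lemma XT_sub B B' s : (forall y : V, perp B' y -> perp B y) -> XT B' s -> XT B s.
Proof. exact: frame_sub. Qed.

Section F.
Variables (F : seq V -> Prop) (C : seq V).
Hypothesis F_act : forall f g, F f -> grp C g -> F (acts f g).

Lemma XF_act x g : XF F C x -> grp C g -> XF F C (act2 x g).
Proof.
case: x => f s [/= Ff Rs] Gg; split=> /=; first exact: F_act.
rewrite -[X in catrev _ X](acts_grp Gg) -acts_catrev.
by apply: frame_act => //; [case: Gg|move=> v; apply: unitv_act; case: Gg].
Qed.
End F.

Lemma ds_TT B n c : TT B n.+1 c -> TT B n (ds c).
Proof.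
exact: (delta_Nc (@del_size V) size_acts (@grpM _ _ B) (@grpT _ _ B) (@grpK _ _ B) (@XT_act B) (@XT_del B)).
Qed.

Lemma ds_ds B n c : TT B n c -> ds (ds c) = 0.
Proof.
move=> Tc; apply: (delta_delta actsM dels_act (@del_size V) dels_dels size_acts
  (@grpT _ _ B) (@grpK _ _ B) (Xs := XT B)).
by apply: sub_sup Tc _ => p [].
Qed.

Lemma TT_sub B B' n c : {subset B <= B'} -> TT B' n c -> TT B n c.
Proof.
move=> BB Tc; apply: sub_sup Tc _ => -[s u] [[[/= Xs Hu] Hs] Hn]; split=> //; split=> //; split=> //=.
  by apply: XT_sub Xs => y /perpP Hy; apply/perpP => b /BB; apply: Hy.
by move=> g /Hu; apply: grp_sub.
Qed.

Definition conjs (g : M) : fr (seq V * seq M) -> fr (seq V * seq M) := inner acts g.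

Lemma conjsP B n c g : grp B g -> TT B n c -> ds c = 0 ->
  exists2 h, TT B n.+1 h & conjs g c = c + ds h.
Proof.
move=> Gg Tc dc; exists (ghom acts (@size V) (fun=> g) c).
  exact: (ghom_Nc size_acts (@grpM _ _ B) (@grpT _ _ B) (@grpK _ _ B) (@XT_act B)).
have Nc0 : sup (nrm (XT B) (grp B)) c by apply: sub_sup Tc _ => p [].
by have [] := innerP acts1 actsM dels_act (@del_size V) size_acts (@grpM _ _ B) (@grpT _ _ B)
  (@grpK _ _ B) (@XT_act B) Gg Nc0 dc.
Qed.

Definition attf f : fr (seq V * seq M) -> fr (seq V * seq V * seq M) := att (fun s => (f, s)).
HB.instance Definition _ f := GRing.Additive.on (attf f).
Definition slf f : fr (seq V * seq V * seq M) -> fr (seq V * seq M) :=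
  lin (fun p => if p.1.1 == f then << (p.1.2, p.2) >> else 0).
HB.instance Definition _ f := GRing.Additive.on (slf f).

Lemma slf_attf f f' c : slf f (attf f' c) = if f' == f then c else 0.
Proof.
rewrite /slf /attf /att /opl !lin_lin.
rewrite (eq_lin_fun (g := fun p => if f' == f then << p >> else 0)).
  by case: eqP => _; [rewrite (lin_id (sup_T _))|rewrite lin_0].
by case=> x y /=; rewrite !linU.
Qed.

Lemma attf_ds2 f C n c : TT (catrev f C) n c -> ds2 (attf f c) = attf f (ds c).
Proof.
move=> Tc; apply: (@att_delta _ _ _ _ acts act2 _ _ _ _ _ (grp (catrev f C))) => //.
- move=> s g Gg; rewrite /act2 /=; congr (_, _).
  by have [] := proj1 (grp_catrev f C g^T) (grpT Gg).
- by apply: sub_sup Tc _ => p [[[]]].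
Qed.

Lemma attf_TF (F : seq V -> Prop) f C n c : F f -> TT (catrev f C) n c -> TF F C n (attf f c).
Proof.
move=> Ff Tc; apply: (att_sup Tc) => s u [[[/= Xs Hu] Hs] Hn].
by split=> //; split=> //; split=> //= g /Hu/grp_catrev[].
Qed.

(** All group vertices stabilize the label f, so passing to normal form does not move it and a cycle
    splits into cycles over the separate labels. *)
Definition PF (F : seq V -> Prop) C n (p : seq V * seq V * seq M) :=
  F p.1.1 /\ ((XT (catrev p.1.1 C) p.1.2 /\ forall g, g \in p.2 -> grp (catrev p.1.1 C) g) /\
    (exists s : seq M, p.2 = 1%:M :: s)) /\ (size p.1.2 + size p.2 = n.+1)%N.

Lemma PF_ind (F : seq V -> Prop) C n (K : fr (seq V * seq V * seq M) -> Prop) c :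
  sup (PF F C n) c -> ds2 c = 0 -> K 0 -> (forall a b, K a -> K b -> K (a + b)) ->
  (forall f a, F f -> TT (catrev f C) n a -> ds a = 0 -> K (attf f a)) -> K c.
Proof.
move=> Sc dc K0 KD KA.
have slice f : F f -> TT (catrev f C) n (slf f c) /\ ds (slf f c) = 0.
  move=> Ff; split.
    apply: (sup_lin Sc) => -[[f' s] u] [/= _ [H Hn]].
    by case: eqP H => [->|_] H; [apply: supU|apply: sup0].
  transitivity (slf f (ds2 c)); last by rewrite dc raddf0.
  apply: (eq_add (F := ds \o slf f) (G := slf f \o ds2) Sc) => -[[f' s] u] [/= _ [H Hn]].
  have E : << (f', s, u) >> = attf f' << (s, u) >> by rewrite [attf _ _]attU.
  rewrite E (@attf_ds2 _ C n) ?slf_attf; last exact: supU.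
  by case: eqP => // _; rewrite raddf0.
pose r := undup [seq p.1.1 | p <- dom c].
have cr : sup (fun p => p.1.1 \in r) c by split=> p pc; rewrite mem_undup (map_f (fun p => p.1.1)).
have Hr f : f \in r -> F f.
  by rewrite mem_undup => /mapP[p pc ->]; case: (supE Sc pc).
have -> : c = \sum_(f <- r) attf f (slf f c).
  have ur : uniq r by apply: undup_uniq.
  move: r ur cr {Hr} => r ur; move: c {Sc dc slice}; apply: sup_ind => [|[[f s] u] /= fin_r|a b Ha Hb].
  - by rewrite big1 // => f _; rewrite !raddf0.
  - have E : << (f, s, u) >> = attf f << (s, u) >> by rewrite [attf _ _]attU.
    rewrite (bigD1_seq f) //= big1 => [|f' /negbTE Nf]; rewrite [in slf _ _]E slf_attf.
      by rewrite eqxx addr0.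
    by rewrite eq_sym Nf raddf0.
  - by rewrite {1}Ha {1}Hb -sumrB; apply: eq_bigr => f _; rewrite !raddfB.
elim: r Hr {cr} => [|f r IH] Hr; first by rewrite big_nil.
rewrite big_cons; apply: KD; last by apply: IH => f' fin_r; apply: Hr; rewrite inE fin_r orbT.
have Ff := Hr f (mem_head _ _); have [Ta da] := slice f Ff.
exact: KA.
Qed.

(* Shapiro: if rep chooses one frame in each orbit, a cycle is homologous to a sum of cycles
   of the stabilizers of the chosen frames. *)
Lemma shapiro (F : seq V -> Prop) C n (rep : seq V -> seq V) c :
  (forall f g, F f -> grp C g -> F (acts f g)) ->
  (forall f g, F f -> grp C g -> rep (acts f g) = rep f) ->
  (forall f, F f -> exists2 g, grp C g & acts f g = rep f) ->
  TF F C n c -> ds2 c = 0 ->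
  exists2 h, TF F C n.+1 h & sup (PF (fun f => F f /\ exists f', F f' /\ f = rep f') C n) (c + ds2 h).
Proof.
move=> F_act rep_act rep_ex Tc dc.
pose eta f : M := epsilon (inhabits 1%:M) (fun g => F f -> grp C g /\ acts f g^T = rep f).
have etaP f : F f -> grp C (eta f) /\ acts f (eta f)^T = rep f.
  move=> Ff; apply: (epsilon_spec (inhabits 1%:M) (fun g => F f -> grp C g /\ acts f g^T = rep f)) => //.
  have [g Gg E] := rep_ex f Ff; exists g^T => _; rewrite trmxK; split=> //; exact: grpT.
pose e (x : seq V * seq V) := eta x.1.
have Ge x : XF F C x -> grp C (e x) by case: x => f s [/= /etaP[]].
have e_del x : sup (fun y => forall g, e (act2 y g) = e (act2 x g)) (del2 x).
  by case: x => f s; apply: (sup_lin (sup_T _)) => t _; apply: supU.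
have Nc0 : sup (nrm (XF F C) (grp C)) c by apply: sub_sup Tc _ => p [].
exists (ghom act2 size2 e c).
  exact: (ghom_Nc size2_act (@grpM _ _ C) (@grpT _ _ C) (@grpK _ _ C) (@XF_act F C F_act)).
have [_ <-] := gauge_cycle act2_1 act2_M del2_act del2_dg size2_act (@grpM _ _ C) (@grpT _ _ C)
  (@grpK _ _ C) (@XF_act F C F_act) e_del Ge Nc0 dc.
rewrite (gaugeE act2_1 _ Nc0); apply: (sup_lin Tc) => -[[f s] u] [[[/= Xs Hu] [u' /= Eu]] Hn].
have [/= Ff Rs] := Xs; have [Gf Ef] := etaP f Ff.
have [_ /= Rs'] := XF_act F_act Xs (grpT Gf); rewrite /e /= Ef in Rs' *.
have Ff' : F (rep f) by rewrite -Ef; apply: F_act => //; apply: grpT.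
apply: supU; rewrite /PF /= Ef; split; first by split; [exact: Ff'|exists f].
split; last by rewrite size_acts size_map.
split; last by rewrite Eu /= trmx1 acts1 mulmx1 (grpK Gf); eexists.
(* The new vertex fixes [rep f]: eta(f h^-1) takes [rep f] to f h^-1, then h gives f, and the
   inverse of eta(f) returns to [rep f]. *)
split=> // g /mapP[h /Hu Gh ->]; have GhT := grpT Gh.
have Fh : F (acts f h^T) by apply: F_act.
have [Gfh Efh] := etaP _ Fh; rewrite rep_act // in Efh.
apply/grp_catrev; split; first by apply: (grpM (grpM _ _) (grpT _)).
rewrite !actsM -{1}Efh -[acts (acts (acts f _) _) _]actsM (grpKT Gfh) acts1.
by rewrite -[acts (acts f _) _]actsM (grpKT Gh) acts1.
Qed.

End Pairs.

(** * Group homology over frames of a fixed length *)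

Section Levels.
Variables (A : idomainType) (N : nat).
Hypothesis Adiv : forall a b : A, (exists c, a = c * b) \/ (exists c, b = c * a).
Hypothesis U2 : unit (2 : A).
Local Notation V := 'rV[A]_N.
Local Notation M := 'M[A]_N.
Implicit Types (B C : seq V) (f s t : seq V) (g : M).
Implicit Types (c h w y : fr (seq V * seq M)).
Local Notation unitv := (@unitv A N).
Local Notation acts := (@acts A N).
Local Notation ds := (@ds A N).
Local Notation grp := (@grp A N).

Definition db : fr (seq V * seq M) -> fr (seq V * seq M) := dbar acts.
HB.instance Definition _ := GRing.Additive.on db.
Definition dl : fr (seq V * seq M) -> fr (seq V * seq M) := dleft (@del V).
HB.instance Definition _ := GRing.Additive.on dl.

Definition XL a B s := frame unitv B s /\ size s = a.
(** A zero boundary on objects and a constant degree: with them the results on the total complex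
    specialize to a single column, whose differential is [db]. *)
Definition z0 (s : seq V) : fr (seq V) := 0.
Definition n0 (s : seq V) := 0%N.
(* Chains of simplices (s, u) with a frame s of length a and m.+1 group elements. *)
Definition LL a B m := Nc n0 (XL a B) (grp B) m.

Lemma XL_act a B s g : XL a B s -> grp B g -> XL a B (acts s g).
Proof. by move=> [Rs Ss] Gg; split; [apply: frame_unit_grp|rewrite size_acts]. Qed.
Lemma z0_act s g : z0 (acts s g) = lin (fun t => << acts t g >>) (z0 s).
Proof. by rewrite raddf0. Qed.
Lemma z0_dg s : sup (fun t => (n0 t).+1 = n0 s) (z0 s). Proof. exact: sup0. Qed.
Lemma z0_z0 s : lin z0 (z0 s) = 0. Proof. exact: raddf0. Qed.
Lemma z0_X (P : seq V -> Prop) s : P s -> sup P (z0 s). Proof. by move=> _; exact: sup0. Qed.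
Lemma n0_act s g : n0 (acts s g) = n0 s. Proof. by []. Qed.

Lemma delta_db c : delta acts z0 n0 c = db c.
Proof.
rewrite /delta /dleft /opl (eq_lin_fun (g := fun=> 0)) ?lin_0 ?add0r; last by move=> p; exact: raddf0.
by rewrite /tw (lin_id (sup_T _)).
Qed.

Lemma LL_TT a B m c : LL a B m c -> TT B (a + m) c.
Proof.
move=> Lc; apply: sub_sup Lc _ => -[s u] [[[/= [Rs Ss] Hu] Hs] Hn]; split=> //.
by rewrite /= Ss -addnS; congr (_ + _)%N; exact: Hn.
Qed.

Lemma LL_of a B n m c : (a + m)%N = n -> TT B n c -> sup (fun p => size p.1 = a) c -> LL a B m c.
Proof.
move=> E Tc Sc; apply: sub_sup (supI Tc Sc) _ => -[s u] [[[[/= Rs Hu] Hs] Hn] Ss].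
by split=> //=; apply/eqP; rewrite add0n -(eqn_add2l a) addnS E -Hn Ss.
Qed.

Lemma LL_size a B m c : LL a B m c -> sup (fun p => size p.1 = a) c.
Proof. by move=> Lc; apply: sub_sup Lc _ => -[s u] [[[/= []]]]. Qed.

Lemma LL_sub a B B' m c : {subset B <= B'} -> LL a B' m c -> LL a B m c.
Proof.
move=> BB Lc; apply: (LL_of (erefl _)); last exact: LL_size Lc.
by apply: TT_sub BB _; apply: LL_TT.
Qed.

Lemma db_LL a B m c : LL a B m.+1 c -> LL a B m (db c).
Proof.
move=> Lc; rewrite -delta_db.
exact: (delta_Nc z0_dg n0_act (@grpM _ _ B) (@grpT _ _ B) (@grpK _ _ B) (@XL_act a B) (@z0_X _)).
Qed.

Lemma LL_nrm a B m c : LL a B m c -> sup (nrm (XL a B) (grp B)) c.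
Proof. by move=> Lc; apply: sub_sup Lc _ => p []. Qed.

Lemma dl_LL a B m c : LL a.+1 B m c -> LL a B m (dl c).
Proof.
move=> Lc; apply: (opl_sup Lc) => s u [[[/= [Rs Ss] Hu] Hs] Hn].
apply: sub_sup (supI (frame_del Rs) (del_size s)) _ => t [Rt St].
by split=> //; split=> //; split=> //; split=> //; apply: succn_inj; rewrite St.
Qed.

Lemma dl_db c : dl (db c) = db (dl c).
Proof. exact: (dleft_dbar (@dels_act A N)). Qed.

Lemma ds_LL a c : sup (fun p => size p.1 = a) c -> ds c = dl c + sgn (odd a) (db c).
Proof.
move=> Sc; rewrite /ds /delta; congr (_ + _); apply: twE.
by apply: sub_sup (@dbar_dg _ _ _ _ _ (@size_acts A N) (fun x _ => (x = a)%N) _ Sc) _ => p /= ->.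
Qed.

Definition Hm a B m y := exists2 h, LL a B m.+1 h & db h = y.
Lemma Hm0 a B m : Hm a B m 0. Proof. by exists 0; rewrite ?raddf0 //; exact: sup0. Qed.
Lemma HmD a B m y y' : Hm a B m y -> Hm a B m y' -> Hm a B m (y + y').
Proof. by move=> [h Lh <-] [h' Lh' <-]; exists (h + h'); [apply: supD|rewrite raddfD]. Qed.
Lemma HmN a B m y : Hm a B m y -> Hm a B m (- y).
Proof. by move=> [h Lh <-]; exists (- h); [apply: supN|rewrite raddfN]. Qed.
Lemma HmB a B m y y' : Hm a B m y -> Hm a B m y' -> Hm a B m (y - y').
Proof. by move=> Hy Hy'; apply: HmD => //; apply: HmN. Qed.

Lemma conjL a B m c g : grp B g -> LL a B m c -> db c = 0 -> Hm a B m (conjs g c - c).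
Proof.
move=> Gg Lc dc; exists (ghom acts n0 (fun=> g) c).
  exact: (ghom_Nc n0_act (@grpM _ _ B) (@grpT _ _ B) (@grpK _ _ B) (@XL_act a B)).
have dc' : delta acts z0 n0 c = 0 by rewrite delta_db.
have [_] := innerP (@acts1 A N) (@actsM A N) z0_act z0_dg n0_act (@grpM _ _ B) (@grpT _ _ B)
  (@grpK _ _ B) (@XL_act a B) Gg (LL_nrm Lc) dc'.
by rewrite delta_db => E; rewrite /conjs E addrAC subrr add0r.
Qed.

Definition atf f : fr (seq V * seq M) -> fr (seq V * seq M) := att (fun=> f).
HB.instance Definition _ f := GRing.Additive.on (atf f).

Lemma atf_LL f B m c : frame unitv B f -> LL 0 (catrev f B) m c -> LL (size f) B m (atf f c).
Proof.
move=> Rf Lc; apply: (att_sup Lc) => s u [[[/= _ Hu] Hs] Hn].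
by split=> //; split=> //; split=> // g /Hu /grp_catrev[].
Qed.

Lemma atf_db f C m c : LL 0 (catrev f C) m c -> db (atf f c) = atf f (db c).
Proof.
move=> Lc; apply: (@att_dbar _ _ _ _ acts acts (fun=> f) (fun g => acts f g^T = f)) => //.
apply: sub_sup Lc _ => -[s u] [[[/= _ Hu] _] _] g /Hu /grpT.
by move=> /grp_catrev[].
Qed.

Lemma atf_atf f f' c : atf f (atf f' c) = atf f c.
Proof. exact: att_att. Qed.

Lemma atf_nil B m c : LL 0 B m c -> atf [::] c = c.
Proof.
move=> Lc; rewrite /atf /att /opl; apply: (lin_id Lc) => -[s u] [[[/= [_ /size0nil ->]]]] _ _ _.
by rewrite linU.
Qed.

(* The condition eta f0 = 1 makes the gauge transformation a retraction onto the simplices over f0. *)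
Lemma frame_gauge a B f0 : frame unitv B f0 -> size f0 = a ->
  (forall f, XL a B f -> exists2 g, grp B g & acts f g = f0) ->
  exists eta : seq V -> M, [/\ forall f, XL a B f -> grp B (eta f),
    forall f, XL a B f -> acts f (eta f)^T = f0 & eta f0 = 1%:M].
Proof.
move=> Rf0 Sf0 tr.
pose P f (g : M) := [/\ XL a B f -> grp B g, XL a B f -> acts f g^T = f0 & f = f0 -> g = 1%:M].
have ex f : exists g, P f g.
  case: (eqVneq f f0) => [->|/eqP ne].
    by exists 1%:M; split=> // _; [exact: grp1|rewrite trmx1 acts1].
  case: (classic (XL a B f)) => [Xf|nX]; last by exists 1%:M; split.
  have [g Gg E] := tr f Xf; exists g^T; split=> //; first by move=> _; exact: grpT.
  by rewrite trmxK.
exists (fun f => epsilon (inhabits 1%:M) (P f)); split.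
- by move=> f; case: (epsilon_spec (inhabits 1%:M) (P f) (ex f)).
- by move=> f; case: (epsilon_spec (inhabits 1%:M) (P f) (ex f)).
- by case: (epsilon_spec (inhabits 1%:M) (P f0) (ex f0)) => _ _ ->.
Qed.

Section Shapiro.
Variables (a : nat) (B f0 : seq V).
Hypothesis Rf0 : frame unitv B f0.
Hypothesis Sf0 : size f0 = a.
Hypothesis tr : forall f, XL a B f -> exists2 g, grp B g & acts f g = f0.

(** Shapiro's lemma for one column: [atf f0] embeds the chains of the stabilizer of f0, and q is a
    chain map that retracts this embedding and inverts it up to homology. Since q is defined on all
    chains, not only on cycles, injectivity on homology can be read off from it. *)
Lemma shapiro_frame : exists q : fr (seq V * seq M) -> fr (seq V * seq M),
  [/\ forall m y, LL a B m y -> LL 0 (catrev f0 B) m (q y),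
      forall m y, LL a B m.+1 y -> db (q y) = q (db y),
      forall m c, LL 0 (catrev f0 B) m c -> q (atf f0 c) = c &
      forall m y, LL a B m y -> db y = 0 -> Hm a B m (atf f0 (q y) - y)].
Proof.
have [eta [Ge Ee e0]] := frame_gauge Rf0 Sf0 tr.
pose q := lin (fun p : seq V * seq M => << ([::] : seq V, [seq eta (acts p.1 g^T) *m g *m (eta p.1)^T | g <- p.2]) >>).
have qE m y : LL a B m y -> gauge acts eta y = atf f0 (q y).
  move=> Ly; rewrite (gaugeE (@acts1 A N) _ (LL_nrm Ly)) /q lin_add.
  by apply: (eq_lin Ly) => -[s u] [[[/= Xs _] _] _]; rewrite Ee //= [atf _ _]attU.
have qL m y : LL a B m y -> LL 0 (catrev f0 B) m (q y).
  move=> Ly; apply: (sup_lin Ly) => -[s u] [[[/= Xs Hu] [u' Eu]] Hn]; apply: supU.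
  have Gs := Ge s Xs; split; last by rewrite /= size_map.
  split; last by rewrite Eu /= trmx1 acts1 mulmx1 (grpK Gs); eexists.
  split=> // g /= /mapP[h /Hu Gh ->]; have GhT := grpT Gh.
  have Xh := XL_act Xs GhT; have Gh' := Ge _ Xh.
  apply/grp_catrev; split; first by apply: (grpM (grpM _ _) (grpT _)).
  rewrite !actsM -{1}(Ee _ Xh) -[acts (acts (acts s _) _) _]actsM (grpKT Gh') acts1.
  by rewrite -[acts (acts s _) _]actsM (grpKT Gh) acts1; apply: Ee.
have atfI m c c' : LL 0 (catrev f0 B) m c -> LL 0 (catrev f0 B) m c' -> atf f0 c = atf f0 c' -> c = c'.
  by move=> Lc Lc' /(congr1 (atf [::])); rewrite !atf_atf (atf_nil Lc) (atf_nil Lc').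
have e_del (x : seq V) : sup (fun t : seq V => forall g, eta (acts t g) = eta (acts x g)) (z0 x) by exact: sup0.
exists q; split=> //.
- move=> m y Ly; apply: (atfI m); [exact/db_LL/qL|exact/qL/db_LL|].
  rewrite -(atf_db (qL _ _ Ly)) -(qE _ _ Ly) -(qE _ _ (db_LL Ly)) -!delta_db.
  by rewrite (gauge_delta (@acts1 A N) (@actsM A N) z0_act z0_dg z0_z0 n0_act (@grpM _ _ B)
    (@grpT _ _ B) (@grpK _ _ B) (@XL_act a B) (@z0_X _) e_del Ge (LL_nrm Ly)).
- move=> m c Lc; rewrite /atf /att /opl /q lin_lin; apply: (lin_id Lc).
  move=> -[s u] [[[/= [_ /size0nil ->] Hu] _] _]; rewrite linU linU /=.
  congr (<< (_, _) >>); rewrite -[RHS]map_id; apply/eq_in_map => g /Hu Gg.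
  have [_ ->] := proj1 (grp_catrev f0 B g^T) (grpT Gg).
  by rewrite e0 trmx1 mulmx1 mul1mx.
- move=> m y Ly dy; have dy' : delta acts z0 n0 y = 0 by rewrite delta_db.
  have [_] := gauge_cycle (@acts1 A N) (@actsM A N) z0_act z0_dg n0_act (@grpM _ _ B)
    (@grpT _ _ B) (@grpK _ _ B) (@XL_act a B) e_del Ge (LL_nrm Ly) dy'.
  rewrite (qE _ _ Ly) delta_db => ->; exists (ghom acts n0 eta y); last by rewrite addrAC subrr add0r.
  exact: (ghom_Nc n0_act (@grpM _ _ B) (@grpT _ _ B) (@grpK _ _ B) (@XL_act a B) Ge Ly).
Qed.

End Shapiro.

Lemma frame_trans B f f' : frame unitv B f -> frame unitv B f' -> size f = size f' ->
  exists2 g, grp B g & acts f g = f'.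
Proof.
elim: f' f B => [|v' f' IH] [|v f] B //=; first by exists 1%:M; [exact: grp1|].
move=> [Lv Bv Rf] [Lv' Bv' Rf'] [S].
have [g [Gg E]] : exists g, grp B g /\ v *m g = v'.
  by apply: transit1 => //; rewrite /unitv in Lv Lv'; rewrite ?Lv ?Lv' ?unitr1.
have [|//||g' Gg' E'] := IH (acts f g) (v' :: B); last 1 first.
- exists (g *m g'); first by apply: grpM Gg _; apply: grp_sub Gg' => b bB; rewrite inE bB orbT.
  by rewrite actsM /= -/(acts f g) mulmxA E E'; case: Gg' => _ ->; rewrite ?mem_head.
- have := frame_act (grpK Gg) (fun w : V => @unitv_act _ _ w _ (grpK Gg)) Rf.
  by rewrite /= -/(acts B g) (acts_grp Gg) E.
- by rewrite size_acts.
Qed.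

Lemma frame_pair letter B f : frame letter B f ->
  pairwise (fun x y : V => dot x y == 0) f && all (perp B) f.
Proof.
elim: f B => [//|v f IH] B /= [_ Bv /IH/andP[-> H]]; rewrite Bv andbT /=.
apply/andP; split; last by apply: sub_all H => y /andP[].
by apply: sub_all H => y /andP[/eqP E _]; rewrite dotC E.
Qed.

Lemma refl_comm (x : V) g : x *m g = x -> g *m g^T = 1%:M -> refl x *m g = g *m refl x.
Proof.
move=> xg gg; have gx : x *m g^T = x by rewrite -{1}xg -mulmxA gg mulmx1.
have gx' : g *m x^T = x^T by rewrite -[g]trmxK -trmx_mul gx.
by rewrite /refl mulmxBl mulmxBr mul1mx mulmx1 -scalemxAl -scalemxAr -mulmxA xg mulmxA gx'.
Qed.

Lemma conjs_atf f B m c g : LL 0 (catrev f B) m c -> g *m g^T = 1%:M ->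
  (forall u, grp (catrev f B) u -> g *m u = u *m g) -> forall r, conjs g (atf r c) = atf (acts r g^T) c.
Proof.
move=> Lc gg Hg r; apply: (eq_add (F := inner acts g \o atf r) (G := atf (acts r g^T)) Lc).
move=> -[s u] [[[/= _ Hu] _] _]; rewrite ![atf _ _]attU [inner _ _ _]linU /=.
congr (<< (_, _) >>); rewrite -[RHS]map_id; apply/eq_in_map => h /Hu Gh.
by rewrite Hg // -mulmxA gg mulmx1.
Qed.

(** The vector v - v' has length 2, a unit. Its reflection exchanges v and v', fixes the other
    letters and commutes with every matrix fixing v and v'. Conjugation by it thus changes only the
    frame attached to c, and inner automorphisms are trivial on homology. *)
Lemma swap_frame B r v v' s m c : frame unitv B (r ++ [:: v, v' & s]) ->
  LL 0 (catrev (r ++ [:: v, v' & s]) B) m c -> db c = 0 ->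
  Hm (size (r ++ v :: s)) B m (atf (r ++ v' :: s) c - atf (r ++ v :: s) c).
Proof.
move=> Rf Lc dc; have := frame_pair Rf; rewrite pairwise_cat all_cat allrel_consr allrel_consr /=.
move=> /andP[/and5P[/and3P[rv rv' rs] pr /andP[/eqP vv' vs] v's ps] /and4P[Br Bv Bv' Bs]].
have Lv : unitv v by have [_ /= []] := frame_catE Rf.
have Lv' : unitv v' by have [_ /= [_ _ []]] := frame_catE Rf.
have Rf' : frame unitv B (r ++ v :: s).
  by apply: frame_subseq Rf; apply: cat_subseq => //=; rewrite eqxx; exact: subseq_cons.
have q2 : dot (v - v') (v - v') = 2.
  by rewrite !dotS (dotC v') vv' Lv Lv'; ring.
have Uw : unit (dot (v - v') (v - v')) by rewrite q2.
pose g := refl (v - v').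
have Gg : grp B g by apply: refl_grp => //; apply: perpB.
have Hr : acts (r ++ v :: s) g^T = r ++ v' :: s.
  have fix_g t : all (fun x => dot x v == 0) t -> all (fun x => dot x v' == 0) t -> acts t g = t.
    move=> tv tv'; rewrite /acts -[RHS]map_id; apply/eq_in_map => x xt.
    by rewrite reflE !dotS (eqP (allP tv x xt)) (eqP (allP tv' x xt)) subr0 mulr0 mul0r scale0r subr0.
  rewrite /acts map_cat /= -/(acts _ _) -/(acts s _) refl_sym refl_move ?fix_g //.
  - by apply: sub_all vs => x; rewrite dotC.
  - by apply: sub_all v's => x; rewrite dotC.
  - by rewrite Lv Lv'.
rewrite -Hr -(@conjs_atf (r ++ [:: v, v' & s]) B m c g Lc); last 2 first.
- exact: grpK Gg.
- move=> u Gu; apply: refl_comm; last by case: Gu.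
  case: Gu => _ Gu; rewrite mulmxBl !Gu // catrevE mem_cat mem_rev mem_cat !inE eqxx ?orbT //.
have Lc' : LL 0 (catrev (r ++ v :: s) B) m c.
  apply: LL_sub Lc => x; rewrite !catrevE !mem_cat !mem_rev !mem_cat !inE.
  by case/orP => [/orP[->|/orP[->|->]]|->]; rewrite ?orbT.
by apply: conjL => //; [apply: atf_LL|rewrite (atf_db Lc') dc raddf0].
Qed.

(* Each face of a frame is carried to the next one by a reflection that centralizes c,
   so the alternating sum of the faces collapses. *)
Lemma dl_frame B r s m c : frame unitv B (r ++ s) -> LL 0 (catrev (r ++ s) B) m c -> db c = 0 ->
  Hm (size (r ++ behead s)) B m
    (lin (fun t => atf (r ++ t) c) (del s) - (if odd (size s) then atf (r ++ behead s) c else 0)).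
Proof.
elim: s r => [|v s IH] r Rf Lc dc; first by rewrite raddf0 /= subrr; exact: Hm0.
rewrite raddfB /= linU /cns lin_lin.
rewrite (eq_lin_fun (g := fun t => atf (rcons r v ++ t) c)); last first.
  by move=> t; rewrite linU cat_rcons.
have := IH (rcons r v); rewrite cat_rcons => /(_ Rf Lc dc).
case: s {IH} Rf Lc => [|v' s] Rf Lc /=.
  by rewrite !raddf0 ?addr0 ?subr0 subrr => _; exact: Hm0.
have -> : size (rcons r v ++ s) = size (r ++ v' :: s) by rewrite !size_cat size_rcons addSnnS.
have S : size (r ++ v :: s) = size (r ++ v' :: s) by rewrite !size_cat.
have := swap_frame Rf Lc dc; rewrite S cat_rcons => Sw H.
have Eq a y y' : y = y' -> Hm a B m y -> Hm a B m y' by move=> ->.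
case: odd H => /= H; first by apply: Eq (HmN H); zmod.
by apply: Eq (HmB Sw H); zmod.
Qed.

End Levels.

(** * The stability induction *)

Section Beta.
Variables (A : idomainType) (N : nat).
Hypothesis Adiv : forall a b : A, (exists c, a = c * b) \/ (exists c, b = c * a).
Hypothesis U2 : unit (2 : A).
Local Notation V := 'rV[A]_N.
Local Notation M := 'M[A]_N.
Implicit Types (B C : seq V) (f s t : seq V) (g : M).
Implicit Types (c h w y : fr (seq V * seq M)).
Local Notation unitv := (@unitv A N).
Local Notation ds := (@ds A N).

Definition Acyc B n := forall c, TT B n c -> ds c = 0 -> exists2 w, TT B n.+1 w & ds w = c.

Lemma db_LL0 a B c : LL a B 0 c -> db c = 0.
Proof.
move=> Lc; apply: (eq_add (F := db (N:=N)) (G := \0) Lc) => -[s u] [[_ [u' /= ->]] /=].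
by rewrite add0n => -[/size0nil ->]; rewrite /db /dbar delrU /= raddf0 subr0 linU [nf _ _]linU.
Qed.

Lemma dl_LL0 B m c : LL 0 B m c -> dl c = 0.
Proof.
move=> Lc; apply: (eq_add (F := dl (N:=N)) (G := \0) Lc) => -[s u] [[[/= [_ /size0nil ->]]]] _ _ _.
by rewrite [dl _]dleftU raddf0.
Qed.

Lemma dl_atf f c : dl (atf f c) = lin (fun t => atf t c) (del f).
Proof.
elim/fr_ind: c => [|[s u]|a b Ha Hb].
- by rewrite !raddf0; under eq_lin_fun do rewrite raddf0; rewrite lin_0.
- by rewrite [atf _ _]attU [dl _]dleftU; apply: eq_lin_fun => t; rewrite [atf _ _]attU.
- by rewrite !raddfB /= Ha Hb; under [RHS]eq_lin_fun do rewrite raddfB /=; rewrite lin_B.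
Qed.

Lemma frame_cons letter B f (e : V) : frame letter B f -> perp f e -> frame letter (e :: B) f.
Proof.
elim: f B => [//|v f IH] B /= [Lv Bv Rf] /andP[ev ef]; split=> //; first by rewrite dotC ev.
by apply: frame_sub (IH _ Rf ef) => y /=; rewrite andbCA.
Qed.

Lemma TT_0 B n c : TT B n c -> sup (fun p => n < size p.1)%N c -> c = 0.
Proof.
move=> Tc Sc; apply: (sup_false (supI Tc Sc)) => -[s u] [[[_ [u' /= ->]]] /=].
by rewrite addnS => -[<-]; rewrite ltnNge leq_addr.
Qed.

Definition Stab_surj B i := forall e, unitv e -> perp B e -> forall c, LL 0 B i c -> db c = 0 ->
  exists2 c', LL 0 (e :: B) i c' /\ db c' = 0 & Hm 0 B i (c - c').
Definition Stab_inj B i := forall e, unitv e -> perp B e -> forall c, LL 0 (e :: B) i c -> db c = 0 ->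
  Hm 0 B i c -> Hm 0 (e :: B) i c.

Lemma Hm_sub a B B' m y : {subset B <= B'} -> Hm a B' m y -> Hm a B m y.
Proof. by move=> BB [h Lh <-]; exists h => //; apply: LL_sub Lh. Qed.

Lemma atf_Hm f B m y : frame unitv B f -> Hm 0 (catrev f B) m y -> Hm (size f) B m (atf f y).
Proof. by move=> Rf [h Lh <-]; exists (atf f h); [apply: atf_LL|rewrite (atf_db Lh)]. Qed.

Lemma dl_Hm a B m y : Hm a.+1 B m y -> Hm a B m (dl y).
Proof. by move=> [h Lh <-]; exists (dl h); [apply: dl_LL|rewrite dl_db]. Qed.

(* A level cycle comes from the stabilizer of any frame of that length. *)
Lemma level_cycle B f0 m w : frame unitv B f0 -> LL (size f0) B m w -> db w = 0 ->
  exists2 c, LL 0 (catrev f0 B) m c /\ db c = 0 & Hm (size f0) B m (atf f0 c - w).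
Proof.
move=> Rf0 Lw dw.
have tr f : XL (size f0) B f -> exists2 g, grp B g & acts f g = f0.
  by move=> [Rf Sf]; apply: frame_trans.
have [q [qL qd qa qh]] := shapiro_frame Rf0 (erefl _) tr.
exists (q w); last exact: qh.
split; first exact: qL.
case: m Lw => [|m] Lw; first exact: db_LL0 (qL _ _ Lw).
by rewrite (qd _ _ Lw) dw; have := qa m 0 (sup0 _); rewrite raddf0.
Qed.

Lemma level_inj B f0 m c : frame unitv B f0 -> LL 0 (catrev f0 B) m c ->
  Hm (size f0) B m (atf f0 c) -> Hm 0 (catrev f0 B) m c.
Proof.
move=> Rf0 Lc [h Lh E].
have tr f : XL (size f0) B f -> exists2 g, grp B g & acts f g = f0.
  by move=> [Rf Sf]; apply: frame_trans.
have [q [qL qd qa qh]] := shapiro_frame Rf0 (erefl _) tr.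
by exists (q h); [exact: qL|rewrite (qd _ _ Lh) E (qa _ _ Lc)].
Qed.

Lemma catrev_mem f C x : (x \in catrev f C) = (x \in f) || (x \in C).
Proof. by rewrite catrevE mem_cat mem_rev. Qed.

(** The faces of the frame are homologous over the group of B and alternate in sign, so they cancel
    in pairs and leave one or none: the horizontal differential is alternately stabilization and
    zero. *)
Lemma dl_atf_cons e f B m c : frame unitv B (e :: f) -> LL 0 (catrev (e :: f) B) m c -> db c = 0 ->
  Hm (size f) B m (dl (atf (e :: f) c) - (if odd (size f) then 0 else atf f c)).
Proof.
move=> Rf Lc dc; have := dl_frame U2 (r := [::]) Rf Lc dc.
rewrite dl_atf /=; by case: odd.
Qed.

(** From frames of the odd length a + 2 to those of the even length a + 1, the horizontal boundary
    is stabilization. Its surjectivity makes w a boundary up to a term with shorter frames. *)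
Lemma kill_even B a m w : ~~ odd a.+1 -> LL a.+1 B m w -> db w = 0 ->
  (forall f, frame unitv B f -> size f = a.+1 -> Stab_surj (catrev f B) m /\
     exists2 e, unitv e & perp (catrev f B) e) ->
  exists v r, [/\ TT B (a.+1 + m).+1 v, LL a B m.+1 r & ds v = w + r].
Proof.
move=> ea Lw dw HS.
case: (classic (w = 0)) => [->|w0].
  by exists 0, 0; rewrite raddf0 addr0; split=> //; exact: sup0.
have [f0 [Rf0 Sf0]] : exists f0, frame unitv B f0 /\ size f0 = a.+1.
  apply: NNPP => H; apply: w0; apply: (sup_false Lw) => -[s u] [[[/= [Rs Ss] _] _] _].
  by apply: H; exists s.
have [Sj [e Ue Be]] := HS f0 Rf0 Sf0.
rewrite -Sf0 in Lw; have [c [Lc dc] [h1 Lh1 E1]] := level_cycle Rf0 Lw dw.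
have [c' [Lc' dc'] [h2 Lh2 E2]] := Sj e Ue Be c Lc dc.
have /andP[ef eB] : perp f0 e && perp B e by rewrite -perp_catrev.
have Ref : frame unitv B (e :: f0) by split=> //; apply: frame_cons.
have Lc1 : LL 0 (catrev (e :: f0) B) m c'.
  by apply: LL_sub Lc' => x; rewrite inE !catrev_mem inE orbA.
have [h3 Lh3 E3] := dl_atf_cons Ref Lc1 dc'.
rewrite Sf0 (negbTE ea) in E3.
rewrite !Sf0 in Lh1 Lh3 Lw.
have Lh2' : LL a.+1 B m.+1 (atf f0 h2) by rewrite -Sf0; apply: atf_LL.
pose X := atf (e :: f0) c'; pose H := atf f0 h2 - h1 - h3.
have LX : LL a.+2 B m X by have := atf_LL Ref Lc1; rewrite /= Sf0.
have LH : LL a.+1 B m.+1 H by apply: supB => //; apply: supB.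
exists (X + H), (dl H); split.
- by apply: supD; [have := LL_TT LX|have := LL_TT LH]; rewrite ?addSn ?addnS.
- exact: dl_LL.
rewrite raddfD /= (ds_LL (LL_size LX)) (ds_LL (LL_size LH)).
have -> : db X = 0 by rewrite /X (atf_db Lc1) dc' raddf0.
rewrite (negbTE ea) [sgn (odd a.+2) 0](_ : _ = 0) ?addr0; last by case: odd; rewrite /= ?oppr0.
rewrite [sgn false _]/=.
have -> : db H = atf f0 c - atf f0 c' - (atf f0 c - w) - (dl X - atf f0 c').
  by rewrite /H !raddfB /= E1 E3 (atf_db Lh2) E2 raddfB /=; zmod.
by rewrite raddfB /=; zmod.
Qed.

(** From the odd length a + 1 to the even length a, the horizontal boundary is again stabilization.
    By its injectivity, w bounds as soon as [dl w] does. *)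
Lemma kill_odd B a m w : odd a.+1 -> LL a.+1 B m w -> db w = 0 -> Hm a B m (dl w) ->
  (forall f, frame unitv B f -> size f = a -> Stab_inj (catrev f B) m) ->
  Hm a.+1 B m w.
Proof.
move=> oa Lw dw Hw HI.
case: (classic (w = 0)) => [->|w0]; first exact: Hm0.
have [f0 [Rf0 Sf0]] : exists f0, frame unitv B f0 /\ size f0 = a.+1.
  apply: NNPP => H; apply: w0; apply: (sup_false Lw) => -[s u] [[[/= [Rs Ss] _] _] _].
  by apply: H; exists s.
case: f0 Rf0 Sf0 => [//|e f] Ref [Sf].
have [/= Ue Be Rf] := Ref.
have [ef Rf'] : perp f e /\ frame unitv B f.
  split; first by apply: (frame_perp Rf); exact: mem_head.
  by apply: frame_sub Rf => y /andP[].
have Sef : size (e :: f) = a.+1 by rewrite /= Sf.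
rewrite -Sef in Lw; have [c [Lc dc] Hc] := level_cycle Ref Lw dw.
have Hf := dl_atf_cons Ref Lc dc; rewrite Sf in Hf; rewrite /= in oa; rewrite (negbTE oa) in Hf.
have sub_f : {subset catrev f B <= catrev (e :: f) B}.
  by move=> x; rewrite !catrev_mem inE => /orP[->|->]; rewrite ?orbT.
have Lc1 : LL 0 (catrev f B) m c by apply: LL_sub Lc.
have Hfc : Hm 0 (catrev f B) m c.
  apply: level_inj => //; rewrite Sf.
  have : Hm a B m (dl (atf (e :: f) c - w)) by apply: dl_Hm; rewrite -Sf.
  rewrite raddfB /= => H1; have := HmB (HmD H1 Hw) Hf.
  by congr Hm; zmod.
have sub1 : {subset e :: catrev f B <= catrev (e :: f) B}.
  by move=> x; rewrite inE !catrev_mem inE orbA.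
have sub2 : {subset catrev (e :: f) B <= e :: catrev f B}.
  by move=> x; rewrite inE !catrev_mem inE orbA.
have Bfe : perp (catrev f B) e by rewrite perp_catrev ef Be.
have := HI f Rf' Sf e Ue Bfe c (LL_sub sub1 Lc) dc Hfc.
move=> /(Hm_sub sub2) /(atf_Hm Ref) H2; rewrite Sef in H2 Hc.
by have := HmB H2 Hc; congr Hm; zmod.
Qed.

Lemma ds_size x c : sup (fun p => size p.1 < x)%N c -> sup (fun p => size p.1 < x)%N (ds c).
Proof.
move=> Sc; apply: supD; last apply: tw_sup.
  have := @dleft_dg _ _ _ _ _ (@del_size V) (fun a _ => (a < x)%N) _ Sc.
  by move=> H; apply: sub_sup H _ => p /= /ltnW.
exact: (@dbar_dg _ _ _ _ _ (@size_acts A N) (fun a _ => (a < x)%N) _ Sc).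
Qed.

(** The longest frames are removed, one length at a time. Their part is a vertical cycle because
    nothing else contributes to that length. In odd length its horizontal boundary is, up to sign,
    the vertical boundary of the next part, as [kill_odd] requires. *)
Lemma reduce B n w : TT B n w -> sup (fun p => size p.1 <= 1)%N (ds w) ->
  (forall a m f, (a + m)%N = n -> (2 <= a)%N -> ~~ odd a -> frame unitv B f -> size f = a ->
     Stab_surj (catrev f B) m /\ exists2 e, unitv e & perp (catrev f B) e) ->
  (forall a m f, (a.+1 + m)%N = n -> (2 <= a)%N -> ~~ odd a -> frame unitv B f -> size f = a ->
     Stab_inj (catrev f B) m) ->
  exists2 v, TT B n.+1 v & sup (fun p => size p.1 <= 1)%N (w - ds v).
Proof.
move=> Tw Dw HS HI.
suff K a : forall w, TT B n w -> sup (fun p => size p.1 <= 1)%N (ds w) ->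
    sup (fun p => size p.1 <= a.+1)%N w ->
    exists2 v, TT B n.+1 v & sup (fun p => size p.1 <= 1)%N (w - ds v).
  apply: (K n w Tw Dw); apply: sub_sup Tw _ => -[s u] [_] /= E.
  by rewrite -E leq_addr.
elim: a {w Tw Dw} => [|a IH] w Tw Dw Sw.
  by exists 0; [exact: sup0|rewrite raddf0 subr0].
have next v r : TT B n.+1 v -> ds v = part (fun p => size p.1 == a.+2) w + r ->
    sup (fun p => size p.1 < a.+2)%N r ->
    exists2 v, TT B n.+1 v & sup (fun p => size p.1 <= 1)%N (w - ds v).
  move=> Tv Ev Sr; have [|||v' Tv' Sv'] := IH (w - ds v).
  - by apply: supB => //; apply: ds_TT.
  - by rewrite raddfB /= (ds_ds Tv) subr0.
  - rewrite Ev {1}(part_split (fun p : seq V * seq M => size p.1 == a.+2) w).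
    rewrite opprD addrACA subrr add0r; apply: supB => //.
    by apply: sub_sup (part_sup _ Sw) _ => p [p1 /= p2]; rewrite -ltnS ltn_neqAle p2.
  by exists (v + v'); [apply: supD|rewrite [ds _]raddfD opprD addrA].
have [an|na] := ltnP n a.+2.
  have E : part (fun p => size p.1 == a.+2) w = 0.
    apply: (TT_0 (B := B) (n := n)).
      by apply: sub_sup (part_sup _ Tw) _ => p [].
    by apply: sub_sup (part_sup _ Tw) _ => p [_ /eqP->].
  by apply: (next 0 0); rewrite ?raddf0 ?E ?addr0 //; exact: sup0.
have [m Em] : exists m, (a.+2 + m)%N = n by exists (n - a.+2)%N; rewrite subnKC.
have [p1 p2] : (forall p : seq V * seq M, size p.1 == a.+2 -> size p.1 = a.+2) /\
    (forall p : seq V * seq M, size p.1 == a.+1 -> size p.1 = a.+1) by split=> p /eqP.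
set wa := part _ w in next.
have La : LL a.+2 B m wa.
  apply: (LL_of Em).
    by apply: sub_sup (part_sup _ Tw) _ => p [].
  by apply: sub_sup (part_sup _ Tw) _ => p [_ /eqP].
pose wb := part (fun p => size p.1 == a.+1) w.
have Lb : LL a.+1 B m.+1 wb.
  apply: (@LL_of _ _ _ _ n); first by rewrite -Em addnS.
    by apply: sub_sup (part_sup _ Tw) _ => p [].
  by apply: sub_sup (part_sup _ Tw) _ => p [_ /eqP].
have Er : sup (fun p => size p.1 < a.+1)%N (w - wa - wb).
  have -> : w - wa - wb = part (predC (fun p => size p.1 == a.+1)) (part (predC (fun p => size p.1 == a.+2)) w).
    set w' := part _ w; have H := part_split (fun p : seq V * seq M => size p.1 == a.+2) w.
    rewrite -/wa -/w' in H; have H' := part_split (fun p : seq V * seq M => size p.1 == a.+1) w'.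
    suff Eb : part (fun p => size p.1 == a.+1) w' = wb.
      by rewrite Eb in H'; rewrite {1}H {1}H'; zmod.
    rewrite /w' /part lin_lin; apply: eq_lin_fun => p /=.
    by case: (eqVneq (size p.1) a.+2) => [->|_] /=; rewrite ?linU // raddf0 (gtn_eqF (ltnSn a.+1)).
  apply: sub_sup (part_sup _ (part_sup _ Sw)) _ => p [[q1 /= q2] /= q3].
  by rewrite ltn_neqAle q3 -ltnS ltn_neqAle q2.
have Ew : w = wa + wb + (w - wa - wb) by zmod.
have Eds : ds w = (dl wa + sgn (odd a.+2) (db wa)) + (dl wb + sgn (odd a.+1) (db wb)) + ds (w - wa - wb).
  by rewrite -(ds_LL (LL_size La)) -(ds_LL (LL_size Lb)) -!raddfD /= -Ew.
have Sds := ds_size Er.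
have Sdlb : sup (fun p => size p.1 = a) (dl wb) by apply: LL_size (dl_LL Lb).
have Sdla : sup (fun p => size p.1 = a.+1) (dl wa) by apply: LL_size (dl_LL La).
have dbS x c : sup (fun p => size p.1 = x) c -> sup (fun p => size p.1 = x) (sgn (odd x) (db c)).
  move=> Sc; have H := @dbar_dg _ _ _ _ _ (@size_acts A N) (fun i _ => (i = x)%N) _ Sc.
  by case: odd; rewrite /=; [apply: supN|].
have Sdba := dbS _ _ (LL_size La); have Sdbb := dbS _ _ (LL_size Lb).
have ne x (i : nat) c : x != i -> sup (fun p => size p.1 = x) c -> part (fun p => size p.1 == i) c = 0.
  by move=> xi Sc; apply: part_0; apply: sub_sup Sc _ => p ->.
have id_ x c : sup (fun p => size p.1 = x) c -> part (fun p => size p.1 == x) c = c.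
  by move=> Sc; apply: part_id; apply: sub_sup Sc _ => p ->.
have big x (i : nat) c : (x <= i)%N -> sup (fun p => size p.1 < x)%N c -> part (fun p => size p.1 == i) c = 0.
  move=> xi Sc; apply: part_0; apply: sub_sup Sc _ => p px.
  by rewrite neq_ltn (leq_trans px xi).
have D0 : sgn (odd a.+2) 0 = 0 :> fr (seq V * seq M) by case: odd => /=; rewrite ?oppr0.
have [Y2 EY2] : exists Y2, Y2 = sgn (odd a.+2) (db wa) by eexists.
have [Y1 EY1] : exists Y1, Y1 = sgn (odd a.+1) (db wb) by eexists.
have [Z EZ] : exists Z, Z = ds (w - wa - wb) by eexists.
rewrite -EZ -EY2 -EY1 in Eds; rewrite -EY2 in Sdba; rewrite -EY1 in Sdbb; rewrite -EZ in Sds.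
have dwa : db wa = 0.
  have := congr1 (part (fun p : seq V * seq M => size p.1 == a.+2)) Eds.
  have n1 : a.+1 != a.+2 by lia.
  have n2 : a != a.+2 by lia.
  rewrite (big 2%N) // !raddfD /= (ne _ _ _ n1 Sdla) (id_ _ _ Sdba) (ne _ _ _ n2 Sdlb).
  rewrite (ne _ _ _ n1 Sdbb) (big a.+1) // !addr0 add0r.
  by rewrite EY2; case: odd => /= /eqP; rewrite eq_sym ?oppr_eq0 => /eqP.
case: (boolP (odd a.+2)) => oa.
  have [v Lv Ev] : Hm a.+2 B m wa.
    apply: kill_odd => //; last by move=> f Rf Sf; apply: (HI a.+1) => //; lia.
    have := congr1 (part (fun p : seq V * seq M => size p.1 == a.+1)) Eds.
    rewrite (big 2%N) //; last by case: (a) oa.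
    have -> : Y2 = 0 by rewrite EY2 dwa.
    have n1 : a != a.+1 by lia.
    rewrite !raddfD /= raddf0 (id_ _ _ Sdla) (ne _ _ _ n1 Sdlb).
    rewrite (id_ _ _ Sdbb) (big a.+1) // !addr0 add0r.
    move=> E; have {E} -> : dl wa = - Y1.
      by apply/eqP; rewrite -addr_eq0 -E.
    have Hb : Hm a.+1 B m (db wb) by exists wb.
    by apply: HmN; rewrite EY1; case: odd => //=; apply: HmN.
  have Lv' := LL_size Lv.
  apply: (next (- v) (- dl v)).
  - by apply: supN; have := LL_TT Lv; rewrite addnS Em.
  - rewrite raddfN /= (ds_LL Lv') Ev oa /=; zmod.
  - by apply: supN; have := dl_LL Lv => /LL_size H; apply: sub_sup H _ => p ->.
have [|v [r [Tv Lr Ev]]] := kill_even oa La dwa; first by move=> f Rf Sf; apply: (HS a.+2).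
apply: (next v r) => //; first by rewrite -Em.
by apply: sub_sup (LL_size Lr) _ => p ->.
Qed.

Lemma low_parts B n w : TT B n.+1 w -> sup (fun p => size p.1 <= 1)%N w ->
  exists w0 w1, [/\ LL 0 B n.+1 w0, LL 1 B n w1, w = w0 + w1 &
    part (fun p => size p.1 == 1%N) (ds w) = - db w1 /\
    part (fun p => size p.1 == 0%N) (ds w) = db w0 + dl w1].
Proof.
move=> Tw Sw; pose p1 := fun p : seq V * seq M => size p.1 == 1%N.
have L1 : LL 1 B n (part p1 w).
  apply: (@LL_of _ _ _ _ n.+1) => //; first by apply: sub_sup (part_sup _ Tw) _ => p [].
  by apply: sub_sup (part_sup _ Tw) _ => p [_ /eqP].
have L0 : LL 0 B n.+1 (part (predC p1) w).
  apply: (@LL_of _ _ _ _ n.+1) => //; first by apply: sub_sup (part_sup _ Tw) _ => p [].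
  by apply: sub_sup (part_sup _ Sw) _ => p; rewrite /p1 => -[] /=; case: (size p.1) => [|[]].
exists (part (predC p1) w), (part p1 w); split=> //; first by rewrite addrC; apply: part_split.
set w0 := part (predC p1) w; set w1 := part p1 w.
have Ew : w = w0 + w1 by rewrite addrC; apply: part_split.
have -> : ds w = (db w0 + dl w1) - db w1.
  rewrite Ew raddfD /= (ds_LL (LL_size L0)) (ds_LL (LL_size L1)) (dl_LL0 L0) /=.
  by rewrite add0r addrA.
have S0 : sup (fun p => size p.1 = 0%N) (db w0 + dl w1).
  by apply: supD; [exact: LL_size (db_LL L0)|exact: LL_size (dl_LL L1)].
have S1 : sup (fun p => size p.1 = 1%N) (db w1).
  exact: (@dbar_dg _ _ _ _ _ (@size_acts A N) (fun i _ => (i = 1)%N) _ (LL_size L1)).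
split; rewrite raddfB.
  rewrite /= part_0; last by apply: sub_sup S0 _ => p ->.
  by rewrite part_id ?sub0r //; apply: sub_sup S1 _ => p ->.
rewrite /= part_id; last by apply: sub_sup S0 _ => p ->.
by rewrite part_0 ?subr0 //; apply: sub_sup S1 _ => p ->.
Qed.

Variables (Ms : seq V -> nat -> Prop) (k M0 : nat).
(** A frame of length a, at least 2, takes a places while the degree falls by a - 1 and frees (a -
    1) k places. For k at least 2 this pays for the frame, so the induction applies to its
    stabilizer. *)
Hypothesis k2 : (2 <= k)%N.
Hypothesis M0_gt0 : (1 <= M0)%N.
Hypothesis M_le : forall B m m', Ms B m -> (m' <= m)%N -> Ms B m'.
Hypothesis M_unit : forall B m e, Ms B m.+1 -> unitv e -> perp B e -> Ms (e :: B) m.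
Hypothesis M_ex : forall B, Ms B 1 -> exists2 e, unitv e & perp B e.
Hypothesis M_Acyc : forall B n, Ms B (M0 + n * k) -> Acyc B n.

Lemma M_frame B m f : Ms B (size f + m) -> frame unitv B f -> Ms (catrev f B) m.
Proof.
elim: f B => [//|v f IH] B /= HM [Lv Bv Rf]; apply: IH => //.
exact: M_unit.
Qed.

(** With the empty frame attached, c is a cycle of the total complex. A filling reduced to w0 + w1,
    with frames of lengths 0 and 1, gives c = db w0 + dl w1 with w1 a vertical cycle. Shapiro's
    lemma moves w1 into the stabilizer of e, and [dl] forgets e. *)
Lemma stab_surj_step B i : (forall j B, (j < i)%N -> Ms B (M0 + j * k) -> Stab_surj B j) ->
  (forall j B, (j < i)%N -> Ms B (M0 + j.+1 * k) -> Stab_inj B j) ->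
  Ms B (M0 + i * k) -> Stab_surj B i.
Proof.
move=> IS II HM e Ue Be c Lc dc.
have Tc := LL_TT Lc; rewrite add0n in Tc.
have dsc : ds c = 0 by rewrite (ds_LL (LL_size Lc)) (dl_LL0 Lc) dc addr0.
have [y Ty Ey] := M_Acyc HM Tc dsc.
have [|||v Tv Sv] := reduce Ty.
- by rewrite Ey; apply: sub_sup (LL_size Lc) _ => p ->.
- move=> a m f E a2 _ Rf Sf; split.
    by apply: IS; [lia|apply: (M_frame _ Rf); apply: M_le HM _; nia].
  by apply: M_ex; apply: (M_frame _ Rf); apply: M_le HM _; nia.
- by move=> a m f E a2 _ Rf Sf; apply: II; [lia|apply: (M_frame _ Rf); apply: M_le HM _; nia].
have Ty' : TT B i.+1 (y - ds v) by apply: supB => //; apply: ds_TT.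
have [w0 [w1 [L0 L1 Ew [E1 E0]]]] := low_parts Ty' Sv.
have Edy : ds (y - ds v) = c by rewrite raddfB /= (ds_ds Tv) subr0.
rewrite Edy in E0 E1.
rewrite part_id in E0; last by apply: sub_sup (LL_size Lc) _ => p ->.
rewrite part_0 in E1; last by apply: sub_sup (LL_size Lc) _ => p ->.
have dw1 : db w1 = 0 by apply/eqP; rewrite -oppr_eq0 -E1.
have Re : frame unitv B [:: e] by [].
have [c' [Lc' dc'] Hc'] := level_cycle Re L1 dw1.
exists c'; first by [].
have [/= h Lh Eh] := Hc'.
have Edl : dl (atf [:: e] c') = c'.
  by rewrite dl_atf /= raddf0 subr0 linU (atf_nil Lc').
exists (w0 - dl h); first by apply: supB => //; apply: dl_LL.
rewrite raddfB /= -dl_db Eh raddfB /= Edl E0; zmod.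
Qed.

(** Attaching e to c and subtracting the given filling over B yields a total cycle. In a reduced
    filling of it, the part with frames of length 1 bounds c with e attached, and Shapiro's lemma
    returns to the stabilizer of e. *)
Lemma stab_inj_step B i : (forall j B, (j <= i)%N -> Ms B (M0 + j * k) -> Stab_surj B j) ->
  (forall j B, (j < i)%N -> Ms B (M0 + j.+1 * k) -> Stab_inj B j) ->
  Ms B (M0 + i.+1 * k) -> Stab_inj B i.
Proof.
move=> IS II HM e Ue Be c Lc dc [h0 L0 E0].
have Re : frame unitv B [:: e] by [].
have La : LL 1 B i (atf [:: e] c) by apply: (atf_LL Re).
pose z := atf [:: e] c - h0.
have Tz : TT B i.+1 z by apply: supB; [exact: (LL_TT La)|exact: (LL_TT L0)].
have Sz : sup (fun p => size p.1 <= 1)%N z.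
  by apply: supB; [apply: sub_sup (LL_size La) _|apply: sub_sup (LL_size L0) _] => p ->.
have Edl : dl (atf [:: e] c) = c by rewrite dl_atf /= raddf0 subr0 linU (atf_nil Lc).
have Edb : db (atf [:: e] c) = 0 by rewrite (@atf_db _ _ [:: e] B i c Lc) dc raddf0.
have dsz : ds z = 0.
  rewrite raddfB /= (ds_LL (LL_size La)) (ds_LL (LL_size L0)) (dl_LL0 L0) E0.
  by rewrite Edl Edb /= ?oppr0 ?addr0 ?add0r ?addr0 subrr.
have [w Tw Ew] := M_Acyc HM Tz dsz.
have [|||v Tv Sv] := reduce Tw.
- by rewrite Ew.
- move=> a m f E a2 _ Rf Sf; split.
    by apply: IS; [lia|apply: (M_frame _ Rf); apply: M_le HM _; nia].
  by apply: M_ex; apply: (M_frame _ Rf); apply: M_le HM _; nia.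
- by move=> a m f E a2 _ Rf Sf; apply: II; [lia|apply: (M_frame _ Rf); apply: M_le HM _; nia].
have Tw' : TT B i.+2 (w - ds v) by apply: supB => //; apply: ds_TT.
have [w0 [w1 [Lw0 Lw1 _ [E1 _]]]] := low_parts Tw' Sv.
rewrite raddfB /= (ds_ds Tv) subr0 Ew raddfB /= part_id in E1; last first.
  by apply: sub_sup (LL_size La) _ => p ->.
rewrite part_0 ?subr0 in E1; last by apply: sub_sup (LL_size L0) _ => p ->.
have H : Hm 1 B i (atf [:: e] c) by exists (- w1); [apply: supN|rewrite raddfN].
exact: (level_inj Re Lc H).
Qed.

Theorem stability i :
  (forall B, Ms B (M0 + i * k) -> Stab_surj B i) /\ (forall B, Ms B (M0 + i.+1 * k) -> Stab_inj B i).
Proof.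
elim/ltn_ind: i => i IH.
have HS B : Ms B (M0 + i * k) -> Stab_surj B i.
  by apply: stab_surj_step => [j B' /IH[H _]|j B' /IH[_ H]]; exact: H.
split=> // B; apply: stab_inj_step => [j B' ji|j B' /IH[_ H]]; last exact: H.
by move: ji; rewrite leq_eqVlt => /orP[/eqP->|/IH[H _]]; [exact: HS|exact: H].
Qed.

End Beta.

(** * Filtration of frames by their non-unit letters *)

Section Sort.
Variables (A : idomainType) (N : nat).
Local Notation V := 'rV[A]_N.
Local Notation M := 'M[A]_N.
Implicit Types (B C : seq V) (f s t : seq V) (g : M) (v : V).
Implicit Types (p : seq V * seq V).
Local Notation unitv := (@unitv A N).
Local Notation join := (@join A N).

Definition del1 p : fr (seq V * seq V) := lin (fun f => << (f, p.2) >>) (del p.1).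
Definition delp p : fr (seq V * seq V) := del1 p + sgn (odd (size p.1)) (del2 p).
Definition sizep p := (size p.1 + size p.2)%N.
Definition Dp : fr (seq V * seq V) -> fr (seq V * seq V) := lin delp.
HB.instance Definition _ := GRing.Additive.on Dp.

Definition insL v : fr (seq V * seq V) -> fr (seq V * seq V) := lin (fun p => << (v :: p.1, p.2) >>).
HB.instance Definition _ v := GRing.Additive.on (insL v).
Definition insR v : fr (seq V * seq V) -> fr (seq V * seq V) :=
  lin (fun p => sgn (odd (size p.1)) << (p.1, v :: p.2) >>).
HB.instance Definition _ v := GRing.Additive.on (insR v).
Definition ins v := if dot v v == 1 then insR v else insL v.
Lemma ins_additive v : zmod_morphism (ins v).
Proof. by move=> a b; rewrite /ins; case: ifP => _; rewrite raddfB. Qed.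
HB.instance Definition _ v := GRing.isZmodMorphism.Build _ _ (ins v) (ins_additive v).

(* Moves the unit vectors of a list to the second coordinate, with the sign of the shuffle. *)
Fixpoint shuffle t : fr (seq V * seq V) :=
  if t is v :: t' then ins v (shuffle t') else << ([::], [::]) >>.

Lemma sgnB (U : zmodType) b (x y : U) : sgn b (x - y) = sgn b x - sgn b y.
Proof. by case: b => //=; zmod. Qed.
Lemma sgnD (U : zmodType) b (x y : U) : sgn b (x + y) = sgn b x + sgn b y.
Proof. by case: b => //=; zmod. Qed.
Lemma sgnK (U : zmodType) b (x : U) : sgn b (sgn b x) = x.
Proof. by case: b => //=; rewrite opprK. Qed.
Lemma sgnN (U : zmodType) b (x : U) : sgn (~~ b) x = - sgn b x.
Proof. by case: b => //=; rewrite opprK. Qed.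

Lemma sgn_lin (T T' : choiceType) b (f : T -> fr T') c : sgn b (lin f c) = lin (fun x => sgn b (f x)) c.
Proof.
elim/fr_ind: c => [|x|u w Hu Hw]; first by rewrite !raddf0; case: b => //=; rewrite oppr0.
  by rewrite !linU.
by rewrite !raddfB /= sgnB Hu Hw.
Qed.

Lemma Dp_ins v c : Dp (ins v c) = c - ins v (Dp c).
Proof.
elim/fr_ind: c => [|[f s]|a b Ha Hb]; first by rewrite !raddf0 ?oppr0 ?addr0.
  rewrite /ins [Dp << _ >>]linU; case: ifP => _.
    have H : sup (fun p => odd (size p.1) = ~~ odd (size f)) (del1 (f, s)).
      by apply: (sup_lin (del_size f)) => t /= <-; apply: supU; rewrite /= negbK.
    rewrite [insR v << _ >>]linU /= sgn_add /= [Dp _]linU /(delp _) /= !raddfD /= sgn_add /=.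
    rewrite sgnD sgnK {1}/del2 /= raddfB /= linU /cns lin_lin.
    have -> : insR v (del1 (f, s)) = - sgn (odd (size f)) (del1 (f, v :: s)).
      rewrite /insR (eq_lin (g := fun p => - sgn (odd (size f)) << (p.1, v :: p.2) >>) H); last first.
        by move=> q ->; rewrite sgnN.
      rewrite -[RHS]sgnN /del1 lin_lin sgn_lin.
      by apply: eq_lin_fun => t; rewrite linU /= sgnN.
    have -> : insR v (del2 (f, s)) = sgn (odd (size f)) (lin (fun t => << (f, v :: t) >>) (del s)).
      by rewrite /del2 /insR lin_lin sgn_lin; apply: eq_lin_fun => t; rewrite linU.
    rewrite sgnK (eq_lin_fun (f := fun x => lin _ << v :: x >>) (g := fun t => << (f, v :: t) >>)); last first.
      by move=> t; rewrite linU.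
    zmod.
  rewrite [insL v << _ >>]linU /= [Dp _]linU /(delp _) /= sgnN.
  rewrite {1}/del1 /= raddfB /= linU /cns lin_lin raddfD /=.
  have -> : insL v (del1 (f, s)) = lin (fun t => << (v :: t, s) >>) (del f).
    by rewrite /del1 /insL lin_lin; apply: eq_lin_fun => t; rewrite linU.
  have -> : insL v (sgn (odd (size f)) (del2 (f, s))) = sgn (odd (size f)) (del2 (v :: f, s)).
    rewrite sgn_add; congr sgn.
    by rewrite /= /del2 /insL lin_lin; apply: eq_lin_fun => t; rewrite linU.
  rewrite (eq_lin_fun (f := fun x => lin _ << v :: x >>) (g := fun t => << (v :: t, s) >>)); last first.
    by move=> t; rewrite linU.
  by case: odd => /=; zmod.
by rewrite !raddfB /= Ha Hb; zmod.
Qed.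

Lemma Dp_shuffle t : Dp (shuffle t) = lin shuffle (del t).
Proof.
elim: t => [|v t IH] /=; first by rewrite raddf0 [Dp _]linU /(delp _) /del1 /del2 /= !raddf0 addr0.
rewrite Dp_ins IH raddfB /= linU; congr (_ - _).
rewrite /cns lin_lin lin_add; apply: eq_lin_fun => s.
by rewrite linU.
Qed.

Lemma D_joinp c : D (join c) = join (Dp c).
Proof.
elim/fr_ind: c => [|[f s]|a b Ha Hb]; first by rewrite !raddf0.
  rewrite [join _]linU DU del_cat [Dp _]linU /(delp _) raddfD sgn_add /=; congr (_ + sgn _ _).
    by rewrite /join /del1 lin_lin; apply: eq_lin_fun => t; rewrite linU.
  by rewrite /join /del2 lin_lin; apply: eq_lin_fun => t; rewrite linU.
by rewrite !raddfB /= Ha Hb.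
Qed.

Variable Lt : V -> Prop.
Hypothesis unit_Lt : forall v, unitv v -> Lt v.
Definition Lt' v := Lt v /\ ~ unitv v.
Definition RP C p := frame Lt' C p.1 /\ frame unitv (catrev p.1 C) p.2.

Lemma frame_weak (L L' : V -> Prop) C t : (forall v, L v -> L' v) -> frame L C t -> frame L' C t.
Proof. by move=> LL; elim: t C => [//|v t IH] C /= [/LL Lv Cv /IH]. Qed.

Lemma RP_join C p : RP C p -> frame Lt C (p.1 ++ p.2).
Proof.
case: p => f s [/= Rf Rs]; apply: frame_cat; first by apply: frame_weak Rf => v [].
exact: frame_weak Rs.
Qed.

Lemma shuffle_sup C t : frame Lt C t -> sup (fun p => RP C p /\ sizep p = size t) (shuffle t).
Proof.
elim: t C => [|v t IH] C /= Rt; first by apply: supU.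
case: Rt => Lv Cv /IH Sh; rewrite /ins; case: eqP => Uv; apply: (sup_lin Sh) => -[f s] [[/= Rf Rs] Sz].
  suff : RP C (f, v :: s) /\ sizep (f, v :: s) = (size t).+1.
    by move=> H; case: odd; rewrite /=; [apply: supN|]; apply: supU.
  split; last by rewrite -Sz /sizep /= addnS.
  split=> /=; first by apply: frame_sub Rf => y /andP[].
  split=> //; first by rewrite perp_catrev Cv andbT; apply: (frame_perp Rf); exact: mem_head.
  by apply: frame_sub Rs => y /=; rewrite !perp_catrev perp_cons andbCA.
apply: supU; split; last by rewrite -Sz.
by split.
Qed.

Lemma shuffle_cat C p : RP C p -> shuffle (p.1 ++ p.2) = << p >>.
Proof.
case: p => f s [/=]; elim: f C => [|v f IH] C /=.
  move=> _; elim: s C => [//|v s IH] C /= [Uv _ Rs]; rewrite (IH _ Rs) /ins.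
  by rewrite ifT ?[insR _ _]linU //; apply/eqP.
move=> [[_ Uv] _ Rf] Rs; rewrite (IH _ Rf Rs) /ins ifF ?[insL _ _]linU //.
by apply/eqP.
Qed.

(** Sorted pairs are a retract of the complex of frames: [join] and [shuffle] are chain maps, and
    [shuffle] undoes [join] on sorted pairs. *)
Lemma pairs_exact C a z : Exact Lt C a -> sup (fun p => RP C p /\ sizep p = a) z -> Dp z = 0 ->
  exists2 w, sup (fun p => RP C p /\ sizep p = a.+1) w & Dp w = z.
Proof.
move=> Ex Sz Dz; have [||w Sw Ew] := Ex (join z).
- by apply: (sup_lin Sz) => p [Rp Sp]; apply: supU; split; [exact: RP_join|rewrite size_cat].
- by rewrite D_joinp Dz raddf0.
exists (lin shuffle w).
  by apply: (sup_lin Sw) => t [Rt <-]; apply: shuffle_sup.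
rewrite /Dp lin_add.
transitivity (lin shuffle (D w)).
  by rewrite /D lin_lin; apply: eq_lin_fun => t; rewrite -Dp_shuffle.
rewrite Ew /join lin_lin; apply: (lin_id Sz) => p [Rp _].
by rewrite linU (shuffle_cat Rp).
Qed.

End Sort.

Section Filter.
Variables (A : idomainType) (N : nat).
Local Notation V := 'rV[A]_N.
Local Notation M := 'M[A]_N.
Local Notation ch := (fr (seq V * seq M)).
Local Notation ch2 := (fr (seq V * seq V * seq M)).
Implicit Types (f s t : seq V) (g : M) (v : V).
Local Notation unitv := (@unitv A N).
Local Notation ds := (@ds A N).
Local Notation ds2 := (@ds2 A N).
Local Notation del1 := (@del1 A N).
Local Notation delp := (@delp A N).
Local Notation sizep := (@sizep A N).

Lemma del1_act p g : del1 (act2 p g) = lin (fun q => << act2 q g >>) (del1 p).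
Proof.
case: p => f s; rewrite /del1 /= dels_act !lin_lin.
by apply: eq_lin_fun => t; rewrite !linU.
Qed.
Lemma del1_del2 p : lin del1 (del2 p) = lin (@del2 A N) (del1 p).
Proof.
case: p => f s; rewrite /del2 /del1 !lin_lin /=.
transitivity (lin (fun s => lin (fun f => << (f, s) >> : fr (seq V * seq V)) (del f)) (del s)).
  by apply: eq_lin_fun => t; rewrite linU.
transitivity (lin (fun f => lin (fun s => << (f, s) >> : fr (seq V * seq V)) (del s)) (del f)); last first.
  by apply: eq_lin_fun => t; rewrite linU.
elim/fr_ind: (del f) => [|x|a b Ha Hb].
- by rewrite raddf0; under eq_lin_fun do rewrite raddf0; rewrite lin_0.
- by rewrite linU; under eq_lin_fun do rewrite linU.
- by rewrite raddfB /= -Ha -Hb; under eq_lin_fun do rewrite raddfB /=; rewrite lin_B.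
Qed.

Definition dF : ch2 -> ch2 := opl del1.
HB.instance Definition _ := GRing.Additive.on dF.

Definition dp : ch2 -> ch2 := delta (@act2 A N) delp sizep.
HB.instance Definition _ := GRing.Additive.on dp.

Lemma delp_act p g : delp (act2 p g) = lin (fun q => << act2 q g >>) (delp p).
Proof. by rewrite /(delp _) del1_act del2_act /= size_acts raddfD sgn_add. Qed.
Lemma delp_dg p : sup (fun q => (sizep q).+1 = sizep p) (delp p).
Proof.
case: p => f s; apply: supD.
  by apply: (sup_lin (del_size f)) => t /= Ht; apply: supU; rewrite /sizep /= -Ht.
have H : sup (fun q => (sizep q).+1 = sizep (f, s)) (del2 (f, s)).
  by apply: (sup_lin (del_size s)) => t /= Ht; apply: supU; rewrite /sizep /= -Ht addnS.
by case: odd => //=; apply: supN.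
Qed.
Lemma del1_del1 p : lin del1 (del1 p) = 0.
Proof.
case: p => f s; rewrite /del1 lin_lin /=.
transitivity (lin (fun f => << (f, s) >> : fr (seq V * seq V)) (lin (@del V) (del f))); last by rewrite dels_dels raddf0.
by rewrite lin_lin; apply: eq_lin_fun => t; rewrite linU.
Qed.
Lemma delp_delp p : lin delp (delp p) = 0.
Proof.
have H1 : lin delp (del1 p) = - sgn (odd (size p.1)) (lin (@del2 A N) (del1 p)).
  have S : sup (fun q => odd (size q.1) = ~~ odd (size p.1)) (del1 p).
    by apply: (sup_lin (del_size p.1)) => t /= <-; apply: supU; rewrite /= negbK.
  rewrite (eq_lin (g := fun q => del1 q - sgn (odd (size p.1)) (del2 q)) S); last first.
    by move=> q Hq; rewrite /(delp _) Hq sgnN.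
  by rewrite lin_B del1_del1 sub0r sgn_lin.
have H2 : lin delp (del2 p) = lin (@del2 A N) (del1 p).
  have S : sup (fun q => q.1 = p.1) (del2 p).
    by apply: (sup_lin (sup_T _)) => t _; apply: supU.
  rewrite (eq_lin (g := fun q => del1 q + sgn (odd (size p.1)) (del2 q)) S); last first.
    by move=> q Hq; rewrite /(delp _) Hq.
  have -> : lin (fun q => del1 q + sgn (odd (size p.1)) (del2 q)) (del2 p) =
      lin del1 (del2 p) + sgn (odd (size p.1)) (lin (@del2 A N) (del2 p)).
    rewrite sgn_lin; elim/fr_ind: (del2 p) => [|x|a b Ha Hb]; first by rewrite !raddf0 addr0.
      by rewrite !linU.
    by rewrite !raddfB /= Ha Hb; zmod.
  by rewrite del1_del2 del2_del2; case: odd => /=; rewrite ?oppr0 addr0.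
by rewrite [X in lin _ X]/(delp _) raddfD sgn_add /= H1 H2 addNr.
Qed.
Lemma sizep_act p g : sizep (act2 p g) = sizep p.
Proof. by rewrite /sizep /= !size_acts. Qed.

Lemma dbar_F (P : seq V -> Prop) c : (forall f g, P f -> P (acts f g)) ->
  sup (fun p => P p.1.1) c -> sup (fun p => P p.1.1) (dbar (@act2 A N) c).
Proof.
move=> PF Sc; apply: (nf_J (J := fun x _ => P x.1)) => [x g m|]; first exact: PF.
by apply: (opr_sup Sc) => x u /= Px; apply: sub_sup (sup_T _) _ => t _.
Qed.

Lemma dp_split b c : sup (fun p => size p.1.1 = b) c -> dp c = dF c + sgn (odd b) (ds2 c).
Proof.
move=> Sc; rewrite /dp /ds2 /delta sgnD addrA; congr (_ + _).
  move: c Sc; apply: sup_ind => [|[[f s] u] /= <-|x y Hx Hy].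
  - by rewrite !raddf0; case: odd => /=; rewrite ?oppr0 addr0.
  - by rewrite /dF dleftU oplU dleftU raddfD sgn_add.
  - by rewrite !raddfB /= Hx Hy; case: odd => /=; zmod.
have := dbar_F (P := fun f => size f = b) (fun f g H => etrans (size_acts f g) H) Sc.
move: (dbar _ c); apply: sup_ind => [|[[f s] u] /= <-|x y Hx Hy].
- by rewrite !raddf0; case: odd => /=; rewrite ?oppr0.
- by rewrite !twU /sizep /size2 /= oddD; do 2!case: odd => /=; rewrite ?opprK.
- by rewrite !raddfB /= Hx Hy sgnB.
Qed.

Lemma dF_attf f c : dF (attf f c) = lin (fun t => attf t c) (del f).
Proof.
elim/fr_ind: c => [|[s u]|a b Ha Hb].
- by rewrite !raddf0; under eq_lin_fun do rewrite raddf0; rewrite lin_0.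
- rewrite [attf _ _]attU [dF _]oplU /del1 lin_lin; apply: eq_lin_fun => t.
  by rewrite linU [attf _ _]attU.
- by rewrite !raddfB /= Ha Hb; under [RHS]eq_lin_fun do rewrite raddfB /=; rewrite lin_B.
Qed.

Variables (B C : seq V) (Lt : V -> Prop) (n : nat).
Hypothesis BC : {subset B <= C}.
Hypothesis unit_Lt : forall v, unitv v -> Lt v.
Hypothesis Lt_act : forall v g, grp C g -> Lt v -> Lt (v *m g).
Local Notation Lt' := (Lt' Lt).
Definition Fr b f := frame Lt' C f /\ size f = b.
Definition NP m c := Nc sizep (RP Lt C) (grp C) m c.

Lemma Lt'_act v g : grp C g -> Lt' v -> Lt' (v *m g).
Proof.
move=> Gg [Lv Uv]; split; first exact: Lt_act.
by move=> U; apply: Uv; rewrite /unitv -(dot_orth _ _ (grpK Gg)).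
Qed.

Lemma Fr_act b f g : Fr b f -> grp C g -> Fr b (acts f g).
Proof.
move=> [Rf Sf] Gg; split; last by rewrite size_acts.
by apply: (frame_grp (fun v => @Lt'_act v g Gg)).
Qed.

Lemma RP_act p g : RP Lt C p -> grp C g -> RP Lt C (act2 p g).
Proof.
move=> [Rf Rs] Gg; have X : XF (Fr (size p.1)) C p by [].
by have [[/= Rf' _] Rs'] := XF_act (@Fr_act _) X Gg.
Qed.

Lemma RP_del p : RP Lt C p -> sup (RP Lt C) (delp p).
Proof.
case: p => f s [/= Rf Rs]; apply: supD.
  apply: (sup_lin (supI (del_sub f) (frame_del Rf))) => t [tf Rt]; apply: supU; split=> //=.
  apply: frame_sub Rs => y; rewrite !perp_catrev => /andP[yf ->]; rewrite andbT.
  by apply/perpP => v /(mem_subseq tf); apply/perpP.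
have H : sup (RP Lt C) (del2 (f, s)) by apply: (sup_lin (frame_del Rs)) => t Rt; apply: supU.
by case: odd => //=; apply: supN.
Qed.

Lemma dp_dp m c : NP m c -> dp (dp c) = 0.
Proof.
move=> Nc_; apply: (delta_delta (@act2_M A N) delp_act delp_dg delp_delp sizep_act
  (@grpT _ _ C) (@grpK _ _ C) (Xs := RP Lt C)).
by apply: sub_sup Nc_ _ => p [].
Qed.

Lemma TF_NP b m c : TF (Fr b) C m c -> NP (b + m) c.
Proof.
move=> Tc; apply: sub_sup Tc _ => -[[f s] u] [[[[/= [Rf Sf] Rs] Hu] Hs] /= Hn]; split=> //.
by rewrite /sizep /= Sf -addnA -addnS; congr (_ + _)%N.
Qed.

Lemma TF_size b m c : TF (Fr b) C m c -> sup (fun p => size p.1.1 = b) c.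
Proof. by move=> Tc; apply: sub_sup Tc _ => -[[f s] u] [[[[/= [Rf Sf] Rs] Hu] Hs] /= Hn]. Qed.

Lemma NP_TF b m m' c : (b + m)%N = m' -> NP m' c -> sup (fun p => size p.1.1 = b) c -> TF (Fr b) C m c.
Proof.
move=> E Nc_ Sc; apply: sub_sup (supI Nc_ Sc) _ => -[[f s] u] [[[[[/= Rf Rs] Hu] Hs] /= Hn] Sf].
split=> //; apply/eqP; rewrite -(eqn_add2l b) addnS E -Hn /sizep /size2 /= Sf addnA.
by [].
Qed.

Lemma dF_TF b m c : TF (Fr b.+1) C m c -> TF (Fr b) C m (dF c).
Proof.
move=> Tc; apply: (opl_sup Tc) => -[f s] u [[[[/= [Rf Sf] Rs] Hu] Hs] /= Hn].
apply: (sup_lin (supI (del_size f) (supI (del_sub f) (frame_del Rf)))) => t [St [tf Rt]].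
apply: supU; split=> //; split=> //; split=> //=; split; first by split=> //; apply: succn_inj; rewrite St.
apply: frame_sub Rs => y; rewrite !perp_catrev => /andP[yf ->]; rewrite andbT.
by apply/perpP => v /(mem_subseq tf); apply/perpP.
Qed.

Lemma ds2_F (P : seq V -> Prop) (c : ch2) : (forall f g, P f -> P (acts f g)) ->
  sup (fun p => P p.1.1) c -> sup (fun p => P p.1.1) (ds2 c).
Proof.
move=> PF Sc; apply: supD; last exact: (tw_sup _ (dbar_F PF Sc)).
by apply: (opl_sup Sc) => -[f s] u /= Pf; apply: (sup_lin (sup_T _)) => t _; apply: supU.
Qed.

Lemma dp_F b (c : ch2) : sup (fun p => size p.1.1 < b)%N c -> sup (fun p => size p.1.1 < b)%N (dp c).
Proof.
move=> Sc; apply: supD; last first.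
  by apply: tw_sup; apply: (dbar_F (P := fun f => (size f < b)%N)) => // f g; rewrite size_acts.
apply: (opl_sup Sc) => -[f s] u /= Pf; apply: supD.
  by apply: (sup_lin (del_size f)) => t /= St; apply: supU; rewrite /= ltnW // St.
have H : sup (fun q : seq V * seq V => (size q.1 < b)%N) (del2 (f, s)).
  by apply: (sup_lin (sup_T _)) => t _; apply: supU.
by case: odd => //=; apply: supN.
Qed.

Lemma ds2_ds2 b m (c : ch2) : TF (Fr b) C m c -> ds2 (ds2 c) = 0.
Proof.
move=> Tc; apply: (delta_delta (@act2_M A N) (@del2_act A N) (@del2_dg A N) (@del2_del2 A N) (@size2_act A N)
  (@grpT _ _ C) (@grpK _ _ C) (Xs := XF (Fr b) C)).
by apply: sub_sup Tc _ => p [].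
Qed.

Lemma orbit_rep : exists rep : seq V -> seq V, (forall f g, grp C g -> rep (acts f g) = rep f) /\
  forall f, exists2 g, grp C g & acts f g = rep f.
Proof.
pose orb f f' := exists2 g, grp C g & acts f g = f'.
exists (fun f => epsilon (inhabits [::]) (orb f)); split=> [f g Gg|f]; last first.
  apply: (epsilon_spec (inhabits [::]) (orb f)).
  by exists f; exists 1%:M; [exact: grp1|exact: acts1].
(* The representative must be literally equal along an orbit, so the predicates given to [epsilon]
   have to be equal, not just equivalent. *)
congr epsilon.
apply: functional_extensionality => f'; apply: propositional_extensionality.
split=> -[h Gh <-].
  by exists (g *m h); [exact: grpM|rewrite actsM].
exists (g^T *m h); first by apply: grpM => //; apply: grpT.
by rewrite -actsM mulmxA (grpK Gg) mul1mx.
Qed.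

(** The part with the longest list of non-unit letters is a cycle for the differential that keeps
    this list. By Shapiro's lemma it splits into cycles of stabilizers, for which K is given; all
    corrections have shorter lists. *)
Lemma peel b m w (K : ch2 -> Prop) : NP m w -> sup (fun p => size p.1.1 <= b.+1)%N w ->
  sup (fun p => size p.1.1 <= b)%N (dp w) -> K 0 -> (forall x y, K x -> K y -> K (x + y)) ->
  (forall f a m', Fr b.+1 f -> (b.+1 + m')%N = m -> TT (catrev f C) m' a -> ds a = 0 -> K (attf f a)) ->
  exists y h r, [/\ K y, NP m.+1 h, NP m r, sup (fun p => size p.1.1 <= b)%N r & w = y + dp h + r].
Proof.
move=> Nw Sw Sd K0 KD KA.
have [mb|bm] := ltnP m b.+1.
  exists 0, 0, w; rewrite raddf0 !add0r; split=> //; first exact: sup0.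
  apply: sub_sup Nw _ => -[[f s] u] [[_ [u' /= ->]] /=]; rewrite addnS => -[E].
  by rewrite -ltnS; apply: leq_ltn_trans mb; rewrite -E /sizep /= -addnA leq_addr.
have [m' Em] : exists m', (b.+1 + m')%N = m by exists (m - b.+1)%N; rewrite subnKC.
pose pb := fun p : seq V * seq V * seq M => size p.1.1 == b.+1.
have Tt : TF (Fr b.+1) C m' (part pb w).
  apply: (NP_TF Em); first by apply: sub_sup (part_sup _ Nw) _ => p [].
  by apply: sub_sup (part_sup _ Nw) _ => p [_ /eqP].
have Nr : NP m (part (predC pb) w) by apply: sub_sup (part_sup _ Nw) _ => p [].
have Sr : sup (fun p => size p.1.1 < b.+1)%N (part (predC pb) w).
  by apply: sub_sup (part_sup _ Sw) _ => p [p1 /= p2]; rewrite ltn_neqAle -/(pb p) p2.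
have Ew : w = part pb w + part (predC pb) w by apply: part_split.
move: (part pb w) (part (predC pb) w) Tt Nr Sr Ew => wt wr Tt Nr Sr Ew.
have dwt : ds2 wt = 0.
  have E : part pb (dp w) = sgn (odd b.+1) (ds2 wt).
    rewrite Ew (raddfD dp) /= (dp_split (TF_size Tt)).
    have S1 := TF_size (dF_TF Tt); have S2 := dp_F Sr.
    have S3 : sup pb (sgn (odd b.+1) (ds2 wt)).
      have H := ds2_F (P := fun f => size f = b.+1) (fun f g H => etrans (size_acts f g) H) (TF_size Tt).
      have H' : sup pb (ds2 wt) by apply: sub_sup H _ => p /= E; rewrite /pb E.
      by case: odd => //=; apply: supN.
    move: (dF wt) (dp wr) (sgn _ _) S1 S2 S3 => X Y Z S1 S2 S3.
    rewrite !raddfD /= (part_id S3) part_0 ?add0r; last first.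
      by apply: sub_sup S1 _ => p E; rewrite /pb E ltn_eqF.
    by rewrite part_0 ?addr0 //; apply: sub_sup S2 _ => p H; rewrite /pb ltn_eqF.
  rewrite part_0 in E; last by apply: sub_sup Sd _ => p H; rewrite /pb ltn_eqF.
  by rewrite -[LHS](sgnK (odd b.+1)) -E; case: odd; rewrite /= ?oppr0.
have [rep [rep1 rep2]] := orbit_rep.
have [h0 Th0 Sh0] := shapiro (@Fr_act b.+1) (fun f g _ => @rep1 f g) (fun f _ => rep2 f) Tt dwt.
have Ky : K (wt + ds2 h0).
  apply: (PF_ind Sh0) => //; first by rewrite raddfD /= dwt (ds2_ds2 Th0) addr0.
  by move=> f a [Ff _]; apply: KA.
exists (wt + ds2 h0), (- sgn (odd b.+1) h0), (wr + sgn (odd b.+1) (dF h0)).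
have Th1 := dF_TF Th0.
have NS m1 x : NP m1 x -> NP m1 (sgn (odd b.+1) x) by case: odd => //=; apply: supN.
split=> //.
- by apply: supN; apply: (NS); have := TF_NP Th0; rewrite addnS Em.
- by apply: supD => //; apply: (NS); have := TF_NP Th1; rewrite addnS -addSn Em.
- apply: supD => //; have H : sup (fun p => size p.1.1 <= b)%N (dF h0).
    by apply: sub_sup (TF_size Th1) _ => p ->.
  by case: odd => //=; apply: supN.
- rewrite Ew raddfN sgn_add /= (dp_split (TF_size Th0)) sgnD sgnK; zmod.
Qed.

Definition Bd z := exists2 w, TT B n.+1 w & ds w = z.
Lemma BdD x y : Bd x -> Bd y -> Bd (x + y).
Proof. by move=> [u Tu <-] [w Tw <-]; exists (u + w); [apply: supD|rewrite raddfD]. Qed.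
Lemma BdN x : Bd x -> Bd (- x).
Proof. by move=> [u Tu <-]; exists (- u); [apply: supN|rewrite raddfN]. Qed.
Lemma Bd0 : Bd 0. Proof. by exists 0; rewrite ?raddf0 //; exact: sup0. Qed.

Lemma attf_NP b f m c : Fr b f -> TT (catrev f C) m c -> NP (b + m) (attf f c).
Proof. by move=> Ff Tc; apply: TF_NP; apply: attf_TF. Qed.

Lemma dp_attf f m c : TT (catrev f C) m c ->
  dp (attf f c) = lin (fun t => attf t c) (del f) + sgn (odd (size f)) (attf f (ds c)).
Proof.
move=> Tc; rewrite (@dp_split (size f)) ?dF_attf ?(attf_ds2 Tc) //.
by apply: (att_sup Tc) => s u _.
Qed.

Hypothesis Lt_exact : forall a, (a <= n)%N -> Exact Lt C a.
(** The demands on three or more, two, and one non-unit letters. For two and for one, boundaries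
    over the shorter list B are allowed, so that unit vectors from the span of C and the removed
    letters can serve as apexes. *)
Hypothesis Acyc3 : forall f m, frame Lt' C f -> (3 <= size f)%N -> (size f + m = n.+1)%N -> Acyc (catrev f C) m.
Hypothesis Bd2 : forall y1 y2 m c, frame Lt' C [:: y1; y2] -> n = m.+1 -> TT [:: y2, y1 & C] m c -> ds c = 0 ->
  exists N1 N2, [/\ TT (y1 :: C) n N1, TT (y2 :: C) n N2, ds N1 = c, ds N2 = c & Bd (N2 - N1)].
Hypothesis Bd1 : forall y c, Lt' y -> perp C y -> TT (y :: C) n c -> ds c = 0 -> Bd c.

(** A stabilizer cycle attached to three or more letters bounds in that stabilizer. Attaching the
    same letters to the filling trades the cycle for terms with fewer letters. *)
Lemma kill3 b w z : NP n.+1 w -> sup (fun p => size p.1.1 <= b.+2)%N w -> dp w = attf [::] z ->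
  exists2 w', NP n.+1 w' /\ sup (fun p => size p.1.1 <= 2)%N w' & dp w' = attf [::] z.
Proof.
have Sz k : sup (fun p : seq V * seq V * seq M => size p.1.1 <= k)%N (attf [::] z).
  by apply: (att_sup (sup_T _)).
elim: b w => [|b IH] w Nw Sw Ew; first by exists w.
pose K y := exists H r, [/\ NP n.+2 H, NP n.+1 r, sup (fun p => size p.1.1 <= b.+2)%N r & y = dp H + r].
have [||||y [h [r [[H [r' [NH Nr' Sr' ->]]] Nh Nr Sr E]]]] := @peel b.+2 n.+1 w K Nw Sw.
- by rewrite Ew.
- by exists 0, 0; rewrite raddf0 addr0; split=> //; exact: sup0.
- move=> x y [H [r [NH Nr Sr ->]]] [H' [r' [NH' Nr' Sr' ->]]]; exists (H + H'), (r + r').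
  by split; rewrite ?raddfD /=; [exact: supD|exact: supD|exact: supD|zmod].
- move=> f a m' [Rf Sf] Em Ta da; have S3 : (3 <= size f)%N by rewrite Sf.
  have Sm : (size f + m' = n.+1)%N by rewrite Sf.
  have [c Tc <-] := Acyc3 Rf S3 Sm Ta da.
  have Ff : Fr b.+3 f by [].
  have Tfc := attf_TF Ff Tc; have E := dp_split (TF_size Tfc); rewrite (attf_ds2 Tc) in E.
  exists (sgn (odd b.+3) (attf f c)), (- sgn (odd b.+3) (dF (attf f c))).
  have NS m1 x : NP m1 x -> NP m1 (sgn (odd b.+3) x) by case: odd => //=; apply: supN.
  have Td := dF_TF Tfc; split.
  + by apply: (NS); have := TF_NP Tfc; rewrite addnS Em.
  + by apply: supN; apply: (NS); have := TF_NP Td; rewrite addnS -addSn Em.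
  + have Sd : sup (fun p => size p.1.1 <= b.+2)%N (dF (attf f c)) by apply: sub_sup (TF_size Td) _ => p ->.
    by apply: supN; case: odd => //=; apply: supN.
  + by rewrite sgn_add /= E sgnD sgnK; zmod.
apply: (IH (r' + r)).
- exact: supD.
- exact: supD.
- have -> : r' + r = w - dp (H + h) by rewrite E (raddfD dp) /=; zmod.
  by rewrite (raddfB dp) /= (dp_dp (supD NH Nh)) subr0.
Qed.

(** Without non-unit letters z bounds in the complex of sorted pairs. The filling is stripped of its
    lists of non-unit letters, longest first; at lengths two and one this alters z by boundaries
    over B, and a chain of unit vectors remains. *)
Theorem filter z : TT C n z -> ds z = 0 -> Bd z.
Proof.
move=> Tz dz.
have Fnil : Fr 0 [::] by [].
have dp0 m c : TT C m c -> dp (attf [::] c) = attf [::] (ds c).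
  by move=> Tc; rewrite (@dp_attf [::] m c Tc) /= raddf0 add0r.
have [|||w0 Nw0 Ew0] := tot_exact (@act2_M A N) delp_act delp_dg delp_delp sizep_act (@grpM _ _ C)
  (@grpT _ _ C) (@grpK _ _ C) RP_act RP_del (n := n) (c := attf [::] z).
- by move=> a c an Sc dc; apply: pairs_exact => //; apply: Lt_exact.
- exact: (attf_NP Fnil Tz).
- by rewrite -/(dp _) (dp0 _ _ Tz) dz raddf0.
have Sw0 : sup (fun p => size p.1.1 <= n.+2)%N w0.
  apply: sub_sup Nw0 _ => -[[f s] u] [_] /= E.
  by rewrite -E /sizep /= -addnA leq_addr.
have [w1 [Nw1 Sw1] Ew1] := kill3 Nw0 Sw0 Ew0.
have Satt k c : sup (fun p : seq V * seq V * seq M => size p.1.1 <= k)%N (attf [::] c).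
  by apply: (att_sup (sup_T _)).
pose K2 (y : ch2) := exists (x : ch2) (r : ch),
  [/\ NP n.+1 x, sup (fun p => size p.1.1 <= 1)%N x, Bd r & dp (y + x) = attf [::] r].
have [||||y [h [rr [[v [r [Nv Sv Br Ev]]] Nh Nrr Srr E]]]] := @peel 1 n.+1 w1 K2 Nw1 Sw1.
- by rewrite Ew1.
- by exists 0, 0; rewrite addr0 !raddf0; split=> //; [exact: sup0|exact: sup0|exact: Bd0].
- move=> x y [v [r [Nv Sv Br Ev]]] [v' [r' [Nv' Sv' Br' Ev']]]; exists (v + v'), (r + r').
  split; [exact: supD|exact: supD|exact: BdD|].
  by rewrite addrACA (raddfD dp) /= Ev Ev' raddfD.
- move=> [|y1 [|y2 [|? ?]]] a m' [Rf Sf] // [Em] Ta da.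
  have [N1 [N2 [T1 T2 E1 E2 Bn]]] := Bd2 Rf (esym Em) Ta da.
  have [/= L1 C1 [L2 C2 _]] := Rf.
  have C2' : perp C y2 by case/andP: C2.
  have F1 : Fr 1 [:: y1] by []. have F2 : Fr 1 [:: y2] by [].
  (* The faces [y2] and [y1] of the pair are cancelled by attaching the fillings N2 and N1, so the
     boundary has no non-unit letter left. *)
  exists (attf [:: y2] N2 - attf [:: y1] N1), (N2 - N1); split=> //.
  + by apply: supB; [exact: (attf_NP F2)|exact: (attf_NP F1)].
  + by apply: supB; apply: (att_sup (sup_T _)).
  rewrite (raddfD dp) (raddfB dp) /= (@dp_attf [:: y1; y2] m') // (@dp_attf [:: y1] n) // (@dp_attf [:: y2] n) //=.
  rewrite da !raddf0 !addr0 E1 E2 raddfB /= [cns _ _]linU !linU raddfB /= [RHS]raddfB /=; zmod.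
have dw2 : dp (rr - v) = attf [::] (z - r).
  have -> : rr - v = w1 - dp h - (y + v) by rewrite E; zmod.
  by rewrite !(raddfB dp) /= (dp_dp Nh) subr0 Ev Ew1 raddfB.
pose K1 (y : ch2) := exists2 r : ch, Bd r & dp y = attf [::] r.
have [||||y' [h' [r0 [[r1 Br1 Er1] Nh' Nr0 Sr0 E']]]] := @peel 0 n.+1 (rr - v) K1 (supB Nrr Nv) (supB Srr Sv).
- by rewrite dw2.
- by exists 0; rewrite ?raddf0 //; exact: Bd0.
- by move=> x x' [r2 B2 E2] [r3 B3 E3]; exists (r2 + r3); [exact: BdD|rewrite (raddfD dp) /= E2 E3 raddfD].
- move=> [|y1 [|? ?]] a m' [Rf Sf] // [Em] Ta da; have {}Em : m' = n := Em; rewrite Em in Ta.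
  have [/= L1 C1 _] := Rf; exists a; first exact: (Bd1 L1 C1).
  by rewrite (@dp_attf [:: y1] n) //= da !raddf0 !addr0 linU.
have S0 : sup (fun p => size p.1.1 = 0%N) r0.
  by apply: sub_sup Sr0 _ => p; rewrite leqn0 => /eqP.
have T0 : TT C n.+1 (slf [::] r0).
  apply: (sup_lin Nr0) => -[[f s] u] [[[[/= Rf Rs] Hu] Hs] Hn].
  by case: eqP Rs Hn => [-> Rs Hn|_ _ _]; [apply: supU|exact: sup0].
have Er0 : r0 = attf [::] (slf [::] r0).
  rewrite /attf /att /opl /slf lin_lin; symmetry; apply: (lin_id S0) => -[[f s] u] /= /size0nil ->.
  by rewrite eqxx !linU.
have Edr0 : dp r0 = attf [::] (z - r - r1).
  have -> : r0 = (rr - v) - y' - dp h' by rewrite E'; zmod.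
  by rewrite !(raddfB dp) /= -(raddfB dp) /= dw2 Er1 (dp_dp Nh') subr0 [RHS]raddfB.
have Eds : ds (slf [::] r0) = z - r - r1.
  have := congr1 (slf [::]) Edr0; rewrite {1}Er0 (dp0 _ _ T0) !slf_attf eqxx.
  by [].
have -> : z = ds (slf [::] r0) + r1 + r by rewrite Eds !subrK.
apply: BdD => //; apply: BdD => //.
by exists (slf [::] r0) => //; apply: TT_sub T0.
Qed.

End Filter.

(** * Cones with apex in the span of the constraints *)

Section Cone.
Variables (A : idomainType) (N : nat).
Hypothesis Adiv : forall a b : A, (exists c, a = c * b) \/ (exists c, b = c * a).
Hypothesis U2 : unit (2 : A).
Local Notation V := 'rV[A]_N.
Local Notation M := 'M[A]_N.
Implicit Types (B C : seq V) (e f h v w x y : V) (c : fr (seq V * seq M)).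
Local Notation unitv := (@unitv A N).
Local Notation ds := (@ds A N).

(* The vector e lies in the span of C, as far as orthogonality and stabilizers can tell. *)
Definition spn C e := (forall y, perp C y -> dot y e = 0) /\ (forall g, grp C g -> e *m g = e).

Lemma spn_mem C e : e \in C -> spn C e.
Proof. by move=> eC; split=> [y /perpP|g [_]]; apply. Qed.

Lemma spnD C e f : spn C e -> spn C f -> spn C (e + f).
Proof.
move=> [e1 e2] [f1 f2]; split=> [y Cy|g Gg]; first by rewrite dotDr e1 // f1 // addr0.
by rewrite mulmxDl e2 ?f2.
Qed.

Lemma spnZ C a e : spn C e -> spn C (a *: e).
Proof.
by move=> [e1 e2]; split=> [y Cy|g Gg]; [rewrite dotZr e1 ?mulr0|rewrite -scalemxAl e2].
Qed.

Lemma spnB C e f : spn C e -> spn C f -> spn C (e - f).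
Proof. by move=> Ce Cf; rewrite -scaleN1r; apply: spnD => //; apply: spnZ. Qed.

Lemma spn_sub C C' e : {subset C <= C'} -> spn C e -> spn C' e.
Proof.
move=> CC [e1 e2]; split=> [y /perpP Cy|g Gg]; last by apply: e2; apply: grp_sub Gg.
by apply: e1; apply/perpP => b /CC; apply: Cy.
Qed.

Lemma TT_spn B C n c : (forall b, b \in B -> spn C b) -> TT C n c -> TT B n c.
Proof.
move=> BC Tc; apply: sub_sup Tc _ => -[s u] [[[/= Xs Hu] Hs] Hn]; split=> //; split=> //; split=> //=.
  by apply: frame_sub Xs => y Hy; apply/perpP => b /BC[Hb _]; apply: Hb.
move=> g /Hu Gg; split; first by case: Gg.
by move=> b /BC[_ Hb]; apply: Hb.
Qed.

Definition cone e : fr (seq V * seq M) -> fr (seq V * seq M) := att (cons e).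
HB.instance Definition _ e := GRing.Additive.on (cone e).

Lemma cone_TT B C n e c : unitv e -> perp B e -> {subset B <= C} -> spn C e -> TT C n c ->
  TT B n.+1 (cone e c).
Proof.
move=> Ue Be BC Ce Tc.
have : TT (e :: B) n c.
  by apply: TT_spn Tc => b; rewrite inE => /orP[/eqP->//|/BC]; exact: spn_mem.
move=> Tc'; apply: (att_sup Tc') => s u [[[/= Rs Hu] Hs] Hn]; split; last by rewrite -Hn.
by split=> //; split=> //= g /Hu; apply: grp_sub => b bB; rewrite inE bB orbT.
Qed.

(** The usual cone formula. It needs e to be fixed by the group of C, because the normal form also
    moves the apex. *)
Lemma ds_cone C n e c : spn C e -> TT C n c -> ds (cone e c) = c - cone e (ds c).
Proof.
move=> [_ Ce] Tc; rewrite /ds /delta raddfD opprD addrA; congr (_ + _).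
  elim/fr_ind: c {Tc} => [|[s u]|a b Ha Hb]; first by rewrite !raddf0 addr0.
    rewrite [cone _ _]attU !dleftU /= raddfB /= linU /cns lin_lin [cone e (lin _ _)]lin_add; congr (_ - _).
    by apply: eq_lin_fun => t; rewrite linU [RHS]attU.
  by rewrite !raddfB /= Ha Hb; zmod.
have -> : dbar (@acts A N) (cone e c) = cone e (dbar (@acts A N) c).
  apply: (@att_dbar _ _ _ _ (@acts A N) (@acts A N) (cons e) (grp C)).
    by move=> s g /grpT /Ce E; rewrite /= E.
  by apply: sub_sup Tc _ => p [[[]]].
apply: tw_odd => -[s u]; rewrite [GRing.Additive.sort _ _]attU.
exact: supU.
Qed.

Lemma cone_Bd B C n e c : unitv e -> perp B e -> {subset B <= C} -> spn C e -> TT C n c ->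
  Bd B n (c - cone e (ds c)).
Proof.
move=> Ue Be BC Ce Tc; exists (cone e c); first exact: cone_TT Tc.
exact: ds_cone Tc.
Qed.

(** A reflection in the span of C fixes every vector orthogonal to C and commutes with the group of
    C, so conjugation by it moves only the apex. *)
Lemma conjs_cone B C n e c h : unit (dot h h) -> perp B h -> spn C h -> TT C n c ->
  conjs (refl h) (cone e c) = cone (e *m refl h) c.
Proof.
move=> Uh Bh [Ch1 Ch2] Tc.
apply: (eq_add (F := inner (@acts A N) (refl h) \o cone e) (G := cone (e *m refl h)) Tc).
move=> -[s u] [[[/= Rs Hu] _] _]; rewrite ![cone _ _]attU [inner _ _ _]linU /= refl_sym.
congr (<< (_ :: _, _) >>).
  rewrite -[RHS]map_id; apply/eq_in_map => y ys; rewrite reflE.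
  have Cy : perp C y.
    have := frame_pair Rs => /andP[_ /allP H]; exact: H.
  by rewrite Ch1 // mulr0 mul0r scale0r subr0.
rewrite -[RHS]map_id; apply/eq_in_map => g /Hu Gg.
rewrite (refl_comm (Ch2 g Gg) (grpK Gg)) -mulmxA refl_refl // mulmx1.
by [].
Qed.

Lemma conj_Bd B n c h : unit (dot h h) -> perp B h -> TT B n c -> ds c = 0 ->
  Bd B n (conjs (refl h) c - c).
Proof.
move=> Uh Bh Tc dc; have [w Tw E] := conjsP (refl_grp Uh Bh) Tc dc.
by exists w; rewrite // E addrAC subrr add0r.
Qed.

(** The Gram determinant of e and f is a unit, so their plane has an orthogonal basis e, h. Over a
    filling of c in its complement, the cones with apexes e and f give the homology. *)
Lemma cone_good B C n e f c : ol B -> {subset B <= C} -> unitv e -> unitv f -> perp B e -> perp B f ->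
  spn C e -> spn C f -> unit (1 - dot e f ^+ 2) -> TT C n c -> ds c = 0 ->
  (forall h, unit (dot h h) -> perp (e :: B) h -> Acyc [:: h, e & B] n) ->
  Bd B n.+1 (cone f c - cone e c).
Proof.
move=> oB BC Ue Uf Be Bf Ce Cf U Tc dc HQ.
pose h := f - dot f e *: e.
have he : dot h e = 0 by rewrite !dotS Ue mulr1 subrr.
have hh : dot h h = 1 - dot e f ^+ 2.
  by rewrite /h !dotS (dotC f e) Ue Uf; ring.
have Bh : perp (e :: B) h by rewrite perp_cons he eqxx; apply: perpB => //; apply: perpZ.
have Ch : spn C h by apply: spnB => //; apply: spnZ.
have Tc' : TT [:: h, e & B] n c.
  apply: TT_spn Tc => b; rewrite !inE => /or3P[/eqP->|/eqP->|/BC bC] //.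
  exact: spn_mem.
have Uh : unit (dot h h) by rewrite hh.
have [b Tb Eb] := HQ h Uh Bh c Tc' dc.
have Sh : {subset B <= [:: h, e & B]} by move=> b' bB; rewrite !inE bB !orbT.
have Se : spn [:: h, e & B] e by apply: spn_mem; rewrite !inE eqxx orbT.
have Sf : spn [:: h, e & B] f.
  have -> : f = h + dot f e *: e by rewrite subrK.
  by apply: spnD; [apply: spn_mem; rewrite mem_head|apply: spnZ].
exists (cone e b - cone f b).
  by apply: supB; [exact: cone_TT Tb|exact: cone_TT Tb].
by rewrite raddfB /= (ds_cone Se Tb) (ds_cone Sf Tb) Eb; zmod.
Qed.

End Cone.

(** * Small residue fields *)

Section Residue.
Variables (A : idomainType) (N : nat).
Hypothesis Adiv : forall a b : A, (exists c, a = c * b) \/ (exists c, b = c * a).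
Hypothesis U2 : unit (2 : A).
Local Notation V := 'rV[A]_N.
Implicit Types (a b c d : A) (B C : seq V) (e f h v w x y : V).
Local Notation unitv := (@unitv A N).

Definition eqm a b := ~~ unit (a - b).

Lemma eqm_refl a : eqm a a. Proof. by rewrite /eqm subrr unitr0. Qed.
Lemma eqm_sym a b : eqm a b -> eqm b a.
Proof. by rewrite /eqm -opprB unitrN. Qed.
Lemma eqm_trans b a c : eqm a b -> eqm b c -> eqm a c.
Proof. by move=> ab bc; rewrite /eqm -(subrKA b); exact: (nunitD Adiv ab bc). Qed.
Lemma eqmD a b c d : eqm a b -> eqm c d -> eqm (a + c) (b + d).
Proof. by move=> ab cd; rewrite /eqm opprD addrACA; exact: (nunitD Adiv ab cd). Qed.
Lemma eqmM a b c d : eqm a b -> eqm c d -> eqm (a * c) (b * d).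
Proof.
move=> ab cd; have H := nunitD Adiv (nunitMl c ab) (nunitMr b cd); rewrite /eqm.
by have -> : a * c - b * d = (a - b) * c + b * (c - d) by ring.
Qed.
Lemma eqmN a b : eqm a b -> eqm (- a) (- b).
Proof. by rewrite /eqm -opprD unitrN. Qed.
Lemma eqm0 a : eqm a 0 = ~~ unit a. Proof. by rewrite /eqm subr0. Qed.
Lemma eqm_unit a b : eqm a b -> unit a = unit b.
Proof. by move=> ab; rewrite -(subrK b a) addrC; apply: (unitDl Adiv). Qed.

Lemma unit_1Bsqr a : eqm a 0 -> unit (1 - a ^+ 2).
Proof.
rewrite eqm0 => na; rewrite (unitDl Adiv) ?unitr1 // unitrN expr2.
exact: nunitMl.
Qed.

(** Reflection in a vector w whose length and whose products with h and f are all invertible changes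
    (h, f) by the unit 2 (f, w) (h, w) / (w, w). *)
Lemma adjust B h f : ol B -> perp B h -> prim h -> ~~ unit (dot h h) -> perp B f -> unit (dot f f) ->
  exists2 g, grp B g & unit (dot h (f *m g)).
Proof.
move=> oB Bh ph nh Bf Uf.
case: (boolP (unit (dot h f))) => [U|nhf]; first by exists 1%:M; [exact: grp1|rewrite mulmx1].
have [x [Bx hx]] := prim_dual oB Bh ph.
have [x1 [Bx1 Uhx Ufx]] : exists x1, [/\ perp B x1, unit (dot h x1) & unit (dot f x1)].
  case: (boolP (unit (dot f x))) => [U|nfx]; first by exists x; rewrite hx unitr1.
  exists (x + f); split; first exact: perpD.
    by rewrite dotDr hx unitDl // unitr1.
  by rewrite dotDr addrC unitDl.
have [w [Bw Uhw Ufw Uw]] : exists w, [/\ perp B w, unit (dot h w), unit (dot f w) & unit (dot w w)].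
  case: (boolP (unit (dot x1 x1))) => [U|nx]; first by exists x1.
  exists (x1 + h); split; first exact: perpD.
  - by rewrite dotDr unitDl.
  - by rewrite dotDr unitDl // dotC.
  - have -> : dot (x1 + h) (x1 + h) = 2 * dot h x1 + dot x1 x1 + dot h h.
      by rewrite !dotS (dotC x1 h); ring.
    by rewrite !unitDl // unitrM U2.
exists (refl w); first exact: refl_grp.
rewrite reflE dotDr dotNr dotZr addrC unitDl // unitrN !unitrM U2 Ufw Uhw unitrV Uw.
by [].
Qed.

(** Up to nonunits, the vector f0 in the plane of h and a dual vector x has length 1. Reflecting e
    in e - f0 then produces a genuine unit vector congruent to f0, in place of a lifting argument.
    Its product with e is a nonunit, and its product with v is congruent to u or to 0. *)
Lemma aux_five B e v h b c (u : A) : unit u -> unit (u - 1) -> unit (u + 1) ->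
  ol B -> unitv e -> unitv v -> perp B e -> perp B v -> perp (e :: B) h -> prim h -> ~~ unit (dot h h) ->
  v = b *: e + c *: h ->
  exists f, [/\ unitv f, perp B f, unit (dot h f), unit (dot e e * dot f f - dot e f ^+ 2) &
                unit (dot v v * dot f f - dot v f ^+ 2)].
Proof.
move=> Uu Um Up oB Ue Uv Be Bv Bh ph nh Ev.
have [/eqP he {}Bh'] : (dot h e == 0) /\ perp B h by move: Bh => /andP[].
have oeB : ol (e :: B) by rewrite /= Ue unitr1 Be.
have [x [Bx hx]] := prim_dual oeB Bh ph.
have [xe Bx'] : dot x e = 0 /\ perp B x by move: Bx => /andP[/eqP].
(* u and the coefficient c of h are arranged so that (v, f) is congruent to u or to 0 *)
have [gm [Ug Hg]] : exists gm, unit gm /\ (eqm (c * gm) u \/ eqm (c * gm) 0).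
  case: (boolP (unit c)) => [Uc|nc]; last first.
    by exists 1; rewrite unitr1 mulr1 eqm0; split=> //; right.
  by exists (u / c); rewrite unitrM Uu unitrV; split=> //; left; rewrite mulrC divrK // eqm_refl.
(* [bt] solves 2 gm bt + gm^2 (x, x) = 1; the length of f0 differs from the left side by the nonunit
   bt^2 (h, h). *)
pose bt := (1 - gm ^+ 2 * dot x x) / (2 * gm).
have [f0 Ef0] : exists f0, f0 = bt *: h + gm *: x by eexists.
have U2g : unit (2 * gm) by rewrite unitrM U2.
have fe : dot e f0 = 0 by rewrite Ef0 dotC !dotS he xe !mulr0 addr0.
have q0 : eqm (dot f0 f0) 1.
  have -> : dot f0 f0 = bt * bt * dot h h + bt * (2 * gm) + gm ^+ 2 * dot x x.
    by rewrite Ef0 !dotS (dotC x h) hx; ring.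
  rewrite /bt divrK // -addrA subrK -[X in eqm _ X]add0r; apply: eqmD (eqm_refl 1).
  by rewrite eqm0; apply: nunitMr.
have hf0 : eqm (dot h f0) gm.
  rewrite Ef0 !dotS hx mulr1 -[X in eqm _ X]add0r; apply: eqmD (eqm_refl gm).
  by rewrite eqm0; apply: nunitMr.
have Eq : dot (e - f0) (e - f0) = 1 + dot f0 f0.
  by rewrite !dotS (dotC f0) fe Ue; ring.
have Uq : unit (1 + dot f0 f0) by rewrite (eqm_unit (eqmD (eqm_refl 1) q0)).
pose s := 2 / (1 + dot f0 f0).
have Es : eqm s 1.
  have := eqmM (eqm_refl 2^-1) (eqmM (eqm_refl s) (eqmD (eqm_refl 1) q0)).
  by rewrite [s * (1 + dot f0 f0)]divrK // mulVr // [s * _]mulrC mulKr // => /eqm_sym.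
pose f := e *m refl (e - f0).
have Ef : f = (1 - s) *: e + s *: f0.
  by rewrite /f reflE Eq dotDr dotNr fe subr0 Ue mulr1 -/s scalerBr scalerBl scale1r; zmod.
have Bf0 : perp B f0 by rewrite Ef0; apply: perpD; apply: perpZ.
have Gr : grp B (refl (e - f0)) by apply: refl_grp; [rewrite Eq|apply: perpB].
have Uf : unitv f by rewrite /unitv /f dot_orth //; case: Gr.
have nEs : ~~ unit (1 - s) by apply: eqm_sym.
have hf : eqm (dot h f) gm.
  rewrite Ef dotDr !dotZr he mulr0 add0r -[X in eqm _ X]mul1r.
  exact: eqmM.
have ef : eqm (dot e f) 0.
  by rewrite Ef dotDr !dotZr fe mulr0 addr0 Ue mulr1 eqm0.
have vf : eqm (dot v f) (c * gm).
  rewrite Ev !dotS -[X in eqm _ X]add0r; apply: eqmD; last exact: eqmM (eqm_refl c) hf.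
  by rewrite -[X in eqm _ X](mulr0 b); apply: eqmM (eqm_refl b) ef.
exists f; split=> //; first by rewrite /f perp_act.
- by rewrite (eqm_unit hf).
- by rewrite Ue Uf mulr1; apply: unit_1Bsqr.
rewrite Uv Uf mulr1; case: Hg => /(eqm_trans vf) H; last exact: unit_1Bsqr.
rewrite (@eqm_unit _ (1 - u * u)).
  have -> : 1 - u * u = - ((u - 1) * (u + 1)) by ring.
  by rewrite unitrN unitrM Um.
by apply: eqmD (eqm_refl 1) _; apply: eqmN; rewrite expr2; apply: eqmM.
Qed.

Section Three.
(* The residue field has three elements. *)
Hypothesis K3 : forall u : A, unit u -> eqm (u ^+ 2) 1.

Lemma three_pm (u : A) : unit u -> eqm u 1 \/ eqm u (- 1).
Proof.
move=> /K3 H; case: (boolP (unit (u - 1))) => U; last by left.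
right; rewrite /eqm opprK; move: H; rewrite /eqm.
have -> : u ^+ 2 - 1 = (u - 1) * (u + 1) by ring.
by rewrite unitrM U.
Qed.

Lemma three_two : eqm 2 (- 1).
Proof.
have := K3 U2; rewrite /eqm.
by have -> : 2 ^+ 2 - 1 = 2 - (-1) :> A by ring.
Qed.

(** In the field of three elements -1 is not a square. *)
Lemma gram_three e f : eqm (dot e e * dot f f) (- 1) -> unit (dot e e * dot f f - dot e f ^+ 2).
Proof.
move=> H; case: (boolP (unit (dot e f))) => [/K3 U|nU].
  rewrite (@eqm_unit _ (- 1 - 1)); last by apply: eqmD H (eqmN U).
  have -> : (- 1 - 1 : A) = - 2 by ring.
  by rewrite unitrN.
rewrite (unitDl Adiv); first by rewrite (eqm_unit H) unitrN unitr1.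
by rewrite unitrN expr2; apply: nunitMl.
Qed.

(** The lengths of e and v are congruent, since h is isotropic modulo the maximal ideal and b^2 is
    congruent to 1. Hence one letter f0 of the opposite type serves both, once [adjust] has made its
    product with h invertible. *)
Lemma aux_three (letter : V -> Prop) B e v h b c f0 : (forall w g, grp B g -> letter w -> letter (w *m g)) ->
  ol B -> unit (dot e e) -> unit (dot v v) -> perp B e -> perp B v -> perp (e :: B) h -> prim h ->
  ~~ unit (dot h h) -> v = b *: e + c *: h -> letter f0 -> perp B f0 -> eqm (dot e e * dot f0 f0) (- 1) ->
  exists f, [/\ letter f, perp B f, unit (dot h f), unit (dot e e * dot f f - dot e f ^+ 2) &
                unit (dot v v * dot f f - dot v f ^+ 2)].
Proof.
move=> Lg oB Ue Uv Be Bv Bh ph nh Ev Lf Bf H.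
have [/eqP he {}Bh'] : (dot h e == 0) /\ perp B h by move: Bh => /andP[].
have Uf : unit (dot f0 f0).
  by have := eqm_unit H; rewrite unitrN unitr1 unitrM => /andP[].
have [g Gg Uhf] := adjust oB Bh' ph nh Bf Uf.
have qf : dot (f0 *m g) (f0 *m g) = dot f0 f0 by rewrite dot_orth //; case: Gg.
have qv : eqm (dot v v) (dot e e).
  have E : dot v v = b ^+ 2 * dot e e + c * c * dot h h.
    by rewrite Ev !dotS he (dotC e h) he; ring.
  have nch : ~~ unit (c * c * dot h h) by apply: nunitMr.
  have Ub : unit b by move: Uv; rewrite E unitDl // unitrM => /andP[]; rewrite unitrX_pos.
  rewrite E -[X in eqm _ X]mul1r -[X in eqm _ X]addr0; apply: eqmD; last by rewrite eqm0.
  exact: eqmM (K3 Ub) (eqm_refl _).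
exists (f0 *m g); split=> //; first exact: Lg.
- by rewrite perp_act.
- by apply: gram_three; rewrite qf.
- by apply: gram_three; rewrite qf; apply: eqm_trans H; apply: eqmM (eqm_refl _).
Qed.

End Three.

Lemma residue_cases : (exists u : A, [/\ unit u, unit (u - 1) & unit (u + 1)]) \/
  (forall u : A, unit u -> eqm (u ^+ 2) 1).
Proof.
case: (Classical_Prop.classic (exists u : A, unit u /\ unit (u ^+ 2 - 1))) => [[u [Uu U]]|H]; [left|right].
  exists u; move: U; have -> : u ^+ 2 - 1 = (u - 1) * (u + 1) by ring.
  by rewrite unitrM => /andP[].
by move=> u Uu; apply/negP => U; apply: H; exists u.
Qed.

(** The filtration with no non-unit letters; it merely turns exactness for frames into acyclicity of
    the total complex. *)
Lemma Acyc_unit B n : (forall i : nat, (i <= n)%N -> Exact unitv B i) -> Acyc B n.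
Proof.
move=> Ex c Tc dc; apply: (@filter A N B B unitv n) => //.
- by move=> v g [gg _]; apply: unitv_act.
- by move=> [//|v f] m /= [[]].
- by move=> y1 y2 m c' /= [[]].
- by move=> y c' [].
Qed.

End Residue.

(** * Letters over a vector of length 2, for a residue field of three elements *)

Section Rank.
Variables (A : idomainType) (N : nat).
Hypothesis Adiv : forall a b : A, (exists c, a = c * b) \/ (exists c, b = c * a).
Hypothesis U2 : unit (2 : A).
Local Notation V := 'rV[A]_N.
Implicit Types (B C : seq V) (e f h v w x y : V).
Local Notation unitv := (@unitv A N).
Local Notation ds := (@ds A N).

Definition L12 v := dot v v = 1 \/ dot v v = 2.
(** The letters used over a constraint x of length 2. As the unit vector is only sought in the span
    with x, they can be found with one dimension less, which makes up for the place taken by x. *)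
Definition LX x y := unit (dot y y) /\
  exists l mu : A, dot (l *: x + mu *: y) (l *: x + mu *: y) = 1.

Lemma L12_unit v : L12 v -> unit (dot v v).
Proof. by case=> ->; rewrite ?unitr1. Qed.
Lemma L12_act B v (g : 'M[A]_N) : grp B g -> L12 v -> L12 (v *m g).
Proof. by move=> Gg; rewrite /L12 dot_orth //; case: Gg. Qed.

Lemma LX_act x B v (g : 'M[A]_N) : grp (x :: B) g -> LX x v -> LX x (v *m g).
Proof.
move=> Gg [Uv [l [mu E]]]; have gg := grpK Gg; split; first by rewrite dot_orth.
exists l, mu; rewrite -E -[RHS](dot_orth _ _ gg) mulmxDl -!scalemxAl.
have Ex : x *m g = x by case: Gg => _; apply; exact: mem_head.
by rewrite Ex.
Qed.
Lemma unit_LX x v : unitv v -> LX x v.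
Proof. by move=> Uv; split; [rewrite Uv unitr1|exists 0, 1; rewrite scale0r add0r scale1r]. Qed.

Lemma half_unit x y : dot x x = 2 -> dot y y = 2 -> dot x y = 0 -> unitv (2^-1 *: x + 2^-1 *: y).
Proof.
move=> qx qy xy; rewrite /unitv !dotS (dotC y x) qx qy xy !mulr0 addr0 add0r mulVr // mulr1.
by rewrite -mulr2n -[_ *+ 2]mulr_natl divrr.
Qed.

Section Three.
Hypothesis K3 : forall u : A, unit u -> eqm (u ^+ 2) 1.
Let two_m := three_two U2 K3.

(** N1 and N2 are homologous to cones on c whose apexes e1 and e2 are unit vectors in the spans of x
    with y1 and with y2. If the plane of e1 and e2 is degenerate modulo the maximal ideal,
    reflections move both apexes, without changing the classes of the cones, to vectors that are
    orthogonal modulo this ideal. *)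
Lemma Bd_two x y1 y2 B n m c : ol B -> dot x x = 2 -> perp B x ->
  frame (Lt' (LX x)) (x :: B) [:: y1; y2] -> n = m.+1 -> TT [:: y2, y1, x & B] m c -> ds c = 0 ->
  (forall u w, ol [:: u, w & B] -> Acyc [:: u, w & B] m) ->
  exists N1 N2, [/\ TT [:: y1, x & B] n N1, TT [:: y2, x & B] n N2, ds N1 = c, ds N2 = c &
    Bd B n (N2 - N1)].
Proof.
move=> oB qx Bx /= [[[Uy1 [l1 [mu1 E1]]] _] C1 [[[Uy2 [l2 [mu2 E2]]] _] C2 _]] -> Tc dc HQ.
have [/eqP y1x B1] : dot y1 x == 0 /\ perp B y1 by move: C1 => /andP[].
have [/eqP y21 [/eqP y2x B2]] : dot y2 y1 == 0 /\ dot y2 x == 0 /\ perp B y2.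
  by move: C2 => /and3P[].
have Ux : unit (dot x x) by rewrite qx.
have [N1 T1 D1] : exists2 N1, TT [:: y1, x & B] m.+1 N1 & ds N1 = c.
  apply: HQ => //; first by rewrite /= Uy1 Ux Bx y1x eqxx B1.
  by apply: TT_sub Tc => b bB; rewrite inE bB orbT.
have [N2 T2 D2] : exists2 N2, TT [:: y2, x & B] m.+1 N2 & ds N2 = c.
  apply: HQ => //; first by rewrite /= Uy2 Ux Bx y2x eqxx B2.
  by apply: TT_sub Tc => b; rewrite !inE => /or3P[->|->|->]; rewrite ?orbT.
exists N1, N2; split=> //.
set C := [:: y2, y1, x & B] in Tc.
have S0 (Y : seq V) : {subset B <= Y ++ B} by move=> b bB; rewrite mem_cat bB orbT.
have Cx : spn C x by apply: spn_mem; rewrite !inE eqxx !orbT.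
have Cy1 : spn C y1 by apply: spn_mem; rewrite !inE eqxx !orbT.
have Cy2 : spn C y2 by apply: spn_mem; rewrite !inE eqxx.
have Bl (l mu : A) y : perp B y -> perp B (l *: x + mu *: y) by move=> By; apply: perpD; apply: perpZ.
have a1 e : unitv e -> perp B e -> spn [:: y1, x & B] e -> Bd B m.+1 (N1 - cone e c).
  by move=> Ue Be Se; rewrite -D1; apply: cone_Bd T1 => //; exact: (S0 [:: y1; x]).
have a2 e : unitv e -> perp B e -> spn [:: y2, x & B] e -> Bd B m.+1 (N2 - cone e c).
  by move=> Ue Be Se; rewrite -D2; apply: cone_Bd T2 => //; exact: (S0 [:: y2; x]).
have good e f : unitv e -> unitv f -> perp B e -> perp B f -> spn C e -> spn C f ->
    unit (1 - dot e f ^+ 2) -> Bd B m.+1 (cone f c - cone e c).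
  move=> Ue Uf Be Bf Ce Cf U; apply: (@cone_good _ _ B C) => //; first exact: (S0 [:: y2; y1; x]).
  move=> h Uh Bh; apply: HQ => //=; rewrite Uh Ue unitr1 Be oB.
  by move: Bh => /= ->.
have fin e f : unitv e -> unitv f -> perp B e -> perp B f -> spn [:: y1, x & B] e -> spn [:: y2, x & B] f ->
    Bd B m.+1 (cone f c - cone e c) -> Bd B m.+1 (N2 - N1).
  move=> Ue Uf Be Bf Se Sf H.
  have -> : N2 - N1 = (N2 - cone f c) + (cone f c - cone e c) - (N1 - cone e c) by zmod.
  by apply: BdD; [apply: BdD => //; apply: a2|apply: BdN; apply: a1].
have Sx1 : spn [:: y1, x & B] x by apply: spn_mem; rewrite !inE eqxx orbT.
have Sx2 : spn [:: y2, x & B] x by apply: spn_mem; rewrite !inE eqxx orbT.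
have Sy1 : spn [:: y1, x & B] y1 by apply: spn_mem; rewrite !inE eqxx.
have Sy2 : spn [:: y2, x & B] y2 by apply: spn_mem; rewrite !inE eqxx.
have toC1 e : spn [:: y1, x & B] e -> spn C e.
  by apply: spn_sub => b bB; rewrite inE bB orbT.
have toC2 e : spn [:: y2, x & B] e -> spn C e.
  by apply: spn_sub => b; rewrite !inE => /or3P[->|->|->]; rewrite ?orbT.
have E1' : 2 * l1 ^+ 2 + mu1 ^+ 2 * dot y1 y1 = 1.
  by rewrite -[RHS]E1 !dotS y1x (dotC x) y1x qx; ring.
have qe1 (l : A) : l ^+ 2 = l1 ^+ 2 -> unitv (l *: x + mu1 *: y1).
  move=> El; rewrite /unitv -[RHS]E1' -El.
  by rewrite !dotS y1x (dotC x) y1x qx; ring.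
have Ue2 : unitv (l2 *: x + mu2 *: y2) by [].
have E2' : 2 * l2 ^+ 2 + mu2 ^+ 2 * dot y2 y2 = 1.
  by rewrite -[RHS]E2 !dotS y2x (dotC x) y2x qx; ring.
have dot12 l l' : dot (l *: x + mu1 *: y1) (l' *: x + mu2 *: y2) = 2 * l * l'.
  by rewrite !dotS y1x (dotC x y2) y2x (dotC y1 y2) y21 qx; ring.
have Be1 l := Bl l mu1 y1 B1; have Be2 l := Bl l mu2 y2 B2.
have Se1 l : spn [:: y1, x & B] (l *: x + mu1 *: y1) by apply: spnD; apply: spnZ.
have Se2 l : spn [:: y2, x & B] (l *: x + mu2 *: y2) by apply: spnD; apply: spnZ.
case: (boolP (unit (1 - dot (l1 *: x + mu1 *: y1) (l2 *: x + mu2 *: y2) ^+ 2))) => [U|nU].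
  apply: (fin _ _ (qe1 l1 (erefl _)) Ue2 (Be1 _) (Be2 _) (Se1 _) (Se2 _)).
  by apply: (good _ _ (qe1 l1 (erefl _)) Ue2 (Be1 _) (Be2 _) (toC1 _ (Se1 _)) (toC2 _ (Se2 _)) U).
have [Ul1 Ul2] : unit l1 /\ unit l2.
  case: (boolP (unit (l1 * l2))) => [|n12]; first by rewrite unitrM => /andP[].
  case/negP: nU; apply: unit_1Bsqr => //; rewrite dot12 eqm0 // -mulrA.
  exact: nunitMr.
have second (l mu q : A) : unit l -> 2 * l ^+ 2 + mu ^+ 2 * q = 1 -> unit mu /\ eqm q (- 1).
  move=> Ul E; have H : eqm (mu ^+ 2 * q) (- 1).
    have -> : mu ^+ 2 * q = 1 - 2 * l ^+ 2 by rewrite -[X in X - _]E; ring.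
    have H0 := K3 Ul; rewrite /eqm.
    have -> : 1 - 2 * l ^+ 2 - - 1 = - 2 * (l ^+ 2 - 1) by ring.
    exact: nunitMr.
  have Umu : unit mu.
    by have := eqm_unit Adiv H; rewrite unitrN unitr1 unitrM unitrX_pos // => /andP[].
  split=> //; apply: (eqm_trans Adiv) H; rewrite -[X in eqm X]mul1r.
  by apply: (eqmM Adiv) (eqm_refl _); apply: eqm_sym; apply: K3.
have [Um1 q1] := second _ _ _ Ul1 E1'; have [Um2 q2] := second _ _ _ Ul2 E2'.
(* the sign of l1 is free, and makes the two reflected vectors orthogonal modulo the maximal ideal *)
have [l [El Ul Hl]] : exists l, [/\ l ^+ 2 = l1 ^+ 2, unit l & eqm (mu1 * l2 + l * mu2) 0].
  have [P Q] : unit (mu1 * l2) /\ unit (l1 * mu2) by rewrite !unitrM Um1 Ul1 Um2 Ul2.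
  have add1 : eqm (1 + - (1 : A)) 0 by rewrite subrr eqm_refl.
  have add2 : eqm (- (1 : A) + 1) 0 by rewrite addNr eqm_refl.
  have [P1|P1] := three_pm K3 P; have [Q1|Q1] := three_pm K3 Q.
  - exists (- l1); rewrite sqrrN unitrN mulNr; split=> //.
    exact: (eqm_trans Adiv (eqmD Adiv P1 (eqmN Q1))).
  - exists l1; split=> //; exact: (eqm_trans Adiv (eqmD Adiv P1 Q1)).
  - exists l1; split=> //; exact: (eqm_trans Adiv (eqmD Adiv P1 Q1)).
  - exists (- l1); rewrite sqrrN unitrN mulNr; split=> //.
    by have := eqm_trans Adiv (eqmD Adiv P1 (eqmN Q1)); apply; rewrite opprK.
pose e1 := l *: x + mu1 *: y1; pose e2 := l2 *: x + mu2 *: y2.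
have Ue1 : unitv e1 by apply: qe1.
pose w1 := x - y1; pose w2 := x - y2.
have qw1 : dot w1 w1 = 2 + dot y1 y1 by rewrite !dotS y1x (dotC x) y1x qx; ring.
have qw2 : dot w2 w2 = 2 + dot y2 y2 by rewrite !dotS y2x (dotC x) y2x qx; ring.
have m1 (q : A) : eqm q (- 1) -> eqm (2 + q) 1.
  by rewrite /eqm => Hq; have -> : 2 + q - 1 = q - - 1 by ring.
have Uw1 : unit (dot w1 w1) by rewrite qw1 (eqm_unit Adiv (m1 _ q1)) unitr1.
have Uw2 : unit (dot w2 w2) by rewrite qw2 (eqm_unit Adiv (m1 _ q2)) unitr1.
have Bw1 : perp B w1 by apply: perpB. have Bw2 : perp B w2 by apply: perpB.
have conj_step w : unit (dot w w) -> perp B w -> spn C w ->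
    Bd B m.+1 ((cone (e2 *m refl w) c - cone (e1 *m refl w) c) - (cone e2 c - cone e1 c)).
  move=> Uw Bw Cw.
  have Tz e : unitv e -> perp B e -> spn C e -> TT B m.+1 (cone e c).
    by move=> Ue Be Ce; apply: cone_TT Tc => //; exact: (S0 [:: y2; y1; x]).
  have dz e : spn C e -> ds (cone e c) = c.
    by move=> Ce; rewrite (ds_cone Ce Tc) dc raddf0 subr0.
  have Tz' : TT B m.+1 (cone e2 c - cone e1 c).
    apply: supB; first exact: (Tz _ Ue2 (Be2 _) (toC2 _ (Se2 _))).
    exact: (Tz _ Ue1 (Be1 _) (toC1 _ (Se1 _))).
  have dz' : ds (cone e2 c - cone e1 c) = 0.
    by rewrite raddfB /= (dz _ (toC2 _ (Se2 l2))) (dz _ (toC1 _ (Se1 l))) subrr.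
  have := conj_Bd Uw Bw Tz' dz'; rewrite /conjs raddfB /=.
  by rewrite -/(conjs _ _) -/(conjs _ _) !(conjs_cone _ Uw Bw Cw Tc).
have grp_w w (Uw : unit (dot w w)) (Bw : perp B w) := refl_grp Uw Bw.
have act_u w e : unit (dot w w) -> perp B w -> unitv e -> unitv (e *m refl w).
  by move=> Uw Bw; apply: unitv_act; case: (grp_w w Uw Bw).
have act_p w e : unit (dot w w) -> perp B w -> perp B e -> perp B (e *m refl w).
  by move=> Uw Bw; rewrite (perp_act _ (grp_w w Uw Bw)).
have act_s (Y : seq V) w e : spn Y e -> spn Y w -> spn Y (e *m refl w).
  by move=> Se Sw; rewrite reflE; apply: spnB => //; apply: spnZ.
have Cw1 : spn C w1 by apply: spnB. have Cw2 : spn C w2 by apply: spnB.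
(* The reflection in w2 preserves the span of x and y2, so the cone with apex e2 and its conjugate
   are both homologous to N2. As conjugation is trivial on homology, the class of the cone with apex
   e1 does not change either. *)
have H1 : Bd B m.+1 (cone (e1 *m refl w2) c - cone e1 c).
  have X := conj_step w2 Uw2 Bw2 Cw2.
  have Y1 := a2 e2 Ue2 (Be2 _) (Se2 _).
  have Y2 := a2 (e2 *m refl w2) (act_u _ _ Uw2 Bw2 Ue2) (act_p _ _ Uw2 Bw2 (Be2 _))
    (act_s _ _ _ (Se2 _) (spnB Sx2 Sy2)).
  have -> : cone (e1 *m refl w2) c - cone e1 c =
     ((N2 - cone e2 c) - (N2 - cone (e2 *m refl w2) c)) -
     ((cone (e2 *m refl w2) c - cone (e1 *m refl w2) c) - (cone e2 c - cone e1 c)) by zmod.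
  by apply: BdD; [apply: BdD => //|]; apply: BdN.
have H2 : Bd B m.+1 (cone (e2 *m refl w1) c - cone e2 c).
  have X := conj_step w1 Uw1 Bw1 Cw1.
  have Y1 := a1 e1 Ue1 (Be1 _) (Se1 _).
  have Y2 := a1 (e1 *m refl w1) (act_u _ _ Uw1 Bw1 Ue1) (act_p _ _ Uw1 Bw1 (Be1 _))
    (act_s _ _ _ (Se1 _) (spnB Sx1 Sy1)).
  have -> : cone (e2 *m refl w1) c - cone e2 c =
     ((cone (e2 *m refl w1) c - cone (e1 *m refl w1) c) - (cone e2 c - cone e1 c)) +
     ((N1 - cone e1 c) - (N1 - cone (e1 *m refl w1) c)) by zmod.
  by apply: BdD => //; apply: BdD => //; apply: BdN.
pose t1 := 2 * (2 * l) / (2 + dot y2 y2); pose t2 := 2 * (2 * l2) / (2 + dot y1 y1).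
have F1 : e1 *m refl w2 = e1 - t1 *: w2.
  by rewrite reflE qw2; congr (_ - (_ * _ / _) *: _); rewrite !dotS y1x (dotC x y2) y2x (dotC y1 y2) y21 qx; ring.
have F2 : e2 *m refl w1 = e2 - t2 *: w1.
  by rewrite reflE qw1; congr (_ - (_ * _ / _) *: _); rewrite !dotS y2x (dotC x y1) y1x y21 qx; ring.
have tE (l' q : A) : eqm q (- 1) -> eqm (2 * (2 * l') / (2 + q)) l'.
  move=> Hq; have Uq : unit (2 + q) by rewrite (eqm_unit Adiv (m1 _ Hq)) unitr1.
  set t := _ / _; have Et : t * (2 + q) = 2 * (2 * l') by rewrite divrK.
  apply: (eqm_trans Adiv (b := t * (2 + q))).
    by rewrite -[X in eqm X]mulr1; apply: (eqmM Adiv (eqm_refl t)); apply/eqm_sym/m1.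
  rewrite Et -[X in eqm _ X]mul1r mulrA; apply: (eqmM Adiv) (eqm_refl l').
  by rewrite -expr2; apply: K3.
have He : eqm (dot (e1 *m refl w2) (e2 *m refl w1)) 0.
  have -> : dot (e1 *m refl w2) (e2 *m refl w1) =
      (l - t1) * (2 * (l2 - t2)) + (mu1 * t2 * dot y1 y1 + t1 * mu2 * dot y2 y2).
    by rewrite F1 F2 !dotS y1x y2x (dotC x y1) (dotC x y2) y1x y2x y21 (dotC y1 y2) y21 qx; ring.
  (* t1 and t2 are congruent to l and l2, and y1 and y2 have lengths congruent to -1, so the product
     reduces to -(mu1 l2 + l mu2). *)
  have -> : 0 = 0 * (2 * (l2 - t2)) + (- 1) * 0 :> A by ring.
  apply: (eqmD Adiv).
    by apply: (eqmM Adiv) (eqm_refl _); rewrite eqm0; apply: eqm_sym; apply: tE.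
  apply: (eqm_trans Adiv) (eqmM Adiv (eqm_refl (- 1)) Hl).
  have -> : - 1 * (mu1 * l2 + l * mu2) = mu1 * l2 * (- 1) + l * mu2 * (- 1) by ring.
  by apply: (eqmD Adiv); apply: (eqmM Adiv) => //; apply: (eqmM Adiv) => //; rewrite ?eqm_refl //; apply: tE.
have H3 : Bd B m.+1 (cone (e2 *m refl w1) c - cone (e1 *m refl w2) c).
  apply: (good _ _ (act_u _ _ Uw2 Bw2 Ue1) (act_u _ _ Uw1 Bw1 Ue2) (act_p _ _ Uw2 Bw2 (Be1 _))
    (act_p _ _ Uw1 Bw1 (Be2 _))); last exact: unit_1Bsqr.
    exact: (act_s _ _ _ (toC1 _ (Se1 _)) Cw2).
  exact: (act_s _ _ _ (toC2 _ (Se2 _)) Cw1).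
apply: (fin _ _ Ue1 Ue2 (Be1 _) (Be2 _) (Se1 _) (Se2 _)).
have -> : cone e2 c - cone e1 c = (cone (e2 *m refl w1) c - cone (e1 *m refl w2) c) +
  ((cone (e1 *m refl w2) c - cone e1 c) - (cone (e2 *m refl w1) c - cone e2 c)) by zmod.
by apply: BdD => //; apply: BdD => //; apply: BdN.
Qed.

End Three.

End Rank.

(** * Stability under a rank condition *)

Section RankStability.
Variables (A : idomainType) (N : nat).
Hypothesis Adiv : forall a b : A, (exists c, a = c * b) \/ (exists c, b = c * a).
Hypothesis U2 : unit (2 : A).
Local Notation V := 'rV[A]_N.
Implicit Types (B C D : seq V) (e f h v w x y : V).
Local Notation unitv := (@unitv A N).
Local Notation ds := (@ds A N).

Variable m : nat.
Hypothesis m_gt0 : (1 <= m)%N.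
Hypothesis UV : forall B, ol B -> (size B + m <= N)%N -> exists2 e, unitv e & perp B e.

(** Room counted by rank, where any vector of invertible length takes one place, so [kap = 1]. The
    bound is N + 1 because the last of the t letters still needs a complement of rank m. *)
Definition Mr B t := ol B /\ (t + size B + m <= N.+1)%N.

Lemma Mr_le B t t' : Mr B t -> (t' <= t)%N -> Mr B t'.
Proof. by move=> [oB H] tt; split=> //; lia. Qed.
Lemma Mr_cons B t v : Mr B t.+1 -> unit (dot v v) -> perp B v -> Mr (v :: B) t.
Proof. by move=> [oB H] Uv Bv; split; [rewrite /= Uv Bv|rewrite /=; lia]. Qed.
Lemma Mr_ex B : Mr B 1 -> exists2 e, unitv e & perp B e.
Proof. by move=> [oB H]; apply: UV => //; lia. Qed.
Lemma unitv_unit v : unitv v -> unit (dot v v).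
Proof. by move->; rewrite unitr1. Qed.

Lemma Mr_two B t : Mr B t.+2 -> exists e f, [/\ unitv e, unitv f, perp B e, perp B f & dot e f = 0].
Proof.
move=> HM; have [e Ue Be] := Mr_ex (Mr_le HM (isT : (1 <= t.+2)%N)).
have HM' : Mr (e :: B) 1 by apply: Mr_cons (Mr_le HM _) (unitv_unit Ue) Be.
have [f Uf /andP[/eqP fe Bf]] := Mr_ex HM'.
by exists e, f; split=> //; rewrite dotC.
Qed.

Lemma Mr_Acyc5 (u : A) : unit u -> unit (u - 1) -> unit (u + 1) ->
  forall n B, Mr B (1 + n * 2) -> Acyc B n.
Proof.
move=> Uu Um Up n B HM; apply: Acyc_unit => i ni.
apply: (@acyclic A N Adiv U2 unitv 1 Mr) => //.
- exact: unitv_unit.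
- by move=> ? ? [].
- exact: Mr_le.
- by move=> ? ? ? HM' Ue Be; apply: Mr_cons => //; apply: unitv_unit.
- by move=> ? ? ? HM'; apply: Mr_cons.
- exact: Mr_ex.
- move=> B' e v h b c [oB' _] Ue Uv Be Bv Bh ph nh Ev.
  exact: (aux_five Adiv U2 Uu Um Up oB' Ue Uv Be Bv Bh ph nh Ev).
by apply: Mr_le HM _; lia.
Qed.

Section Three.
Hypothesis K3 : forall u : A, unit u -> eqm (u ^+ 2) 1.

Lemma sum_two e f : unitv e -> unitv f -> dot e f = 0 -> dot (e + f) (e + f) = 2.
Proof. by move=> Ue Uf ef; rewrite !dotS (dotC f) ef Ue Uf; ring. Qed.

Lemma Mr_L12 n B : Mr B (1 + n * 2) -> Exact (@L12 A N) B n.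
Proof.
apply: (@acyclic A N Adiv U2 _ 1 Mr) => //.
- exact: L12_unit.
- by move=> ? ? [].
- exact: Mr_le.
- by move=> ? ? ? HM' Ue Be; apply: Mr_cons => //; apply: L12_unit.
- by move=> ? ? ? HM'; apply: Mr_cons.
- by move=> B' /Mr_ex[e Ue Be]; exists e => //; left.
- move=> B' e v h b c HM Le Lv Be Bv Bh ph nh Ev; have [oB' _] := HM.
  have [e1 [e2 [U1 U2' B1 B2 e12]]] := Mr_two HM.
  have [f0 [Lf Bf Hf]] : exists f0, [/\ L12 f0, perp B' f0 & eqm (dot e e * dot f0 f0) (- 1)].
    case: Le => ->.
      exists (e1 + e2); rewrite sum_two // mul1r; split; [right; exact: sum_two|exact: perpD|exact: three_two].
    by exists e1; rewrite U1 mulr1; split=> //; [left|exact: three_two].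
  exact: (aux_three Adiv U2 K3 (fun w g => @L12_act A N B' w g) oB' (L12_unit U2 Le) (L12_unit U2 Lv) Be Bv Bh ph nh Ev Lf Bf Hf).
Qed.

(** One place more than in [Mr]: a new letter is first sought in the complement of the list without
    x. *)
Definition Mx x B C t := [/\ ol C, (t + size C + m <= N.+2)%N & exists D, C = D ++ x :: B].

Lemma ol_cat D B : ol (D ++ B) = [&& ol D, ol B & all (fun d => perp B d) D].
Proof.
elim: D => [|d D IH] /=; first by rewrite andbT.
rewrite IH perp_cat; case: (unit _) => //=; case: (perp D d) => //=; rewrite ?andbF //=.
by case: (perp B d); rewrite /= ?andbF //= !andbA.
Qed.

(** A unit vector e orthogonal to the list without x is projected off x. The length 1 - 2 l^2 of the
    projection is a unit because l^2 is 0 or 1 in the residue field, and e lies in the span of x and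
    the projection. *)
Lemma Mx_ex x B C : dot x x = 2 -> Mx x B C 1 -> exists2 e, LX x e & perp C e.
Proof.
move=> qx [oC Hn [D EC]]; move: oC; rewrite EC ol_cat /= => /and3P[oD /and3P[Ux Bx oB] aD].
have [e Ue /[!perp_cat] /andP[De Be]] : exists2 e, unitv e & perp (D ++ B) e.
  apply: UV; last by move: Hn; rewrite EC !size_cat /=; lia.
  rewrite ol_cat oD oB; apply: sub_all aD => d /=; by case/andP.
have dx d : d \in D -> dot x d = 0.
  by move=> /(allP aD) /= /andP[/eqP]; rewrite dotC.
pose l := dot e x / 2; pose u := e - l *: x.
have ux : dot u x = 0 by rewrite /u !dotS qx divrK // subrr.
have Eu : dot u u = 1 - 2 * l ^+ 2.
  have ex : dot e x = 2 * l by rewrite mulrC divrK.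
  by rewrite /u !dotS (dotC x e) Ue qx ex; ring.
have Uu : unit (dot u u).
  rewrite Eu; case: (boolP (unit l)) => Ul.
    rewrite (@eqm_unit _ Adiv _ (- 1)) ?unitrN ?unitr1 //.
    have H := nunitMr (- 2) (K3 Ul); rewrite /eqm.
    by have -> : 1 - 2 * l ^+ 2 - - 1 = - 2 * (l ^+ 2 - 1) by ring.
  by rewrite (unitDl Adiv) ?unitr1 // unitrN expr2; apply: nunitMr; apply: nunitMl.
exists u; last first.
  rewrite perp_cat perp_cons ux eqxx /=; apply/andP; split.
    by apply: perpB => //; apply: perpZ; apply/perpP.
  by apply: perpB => //; apply: perpZ.
split=> //; exists l, 1; rewrite scale1r /u addrC subrK; exact: Ue.
Qed.

Lemma LX_type x e : dot x x = 2 -> LX x e -> eqm (dot e e) 1 \/ eqm (dot e e) (- 1).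
Proof. by move=> _ [Ue _]; apply: three_pm. Qed.

Lemma Mr_LX x B n : dot x x = 2 -> Mr (x :: B) (n * 2) -> Exact (LX x) (x :: B) n.
Proof.
move=> qx [oB Hn].
suff : Mx x B (x :: B) (n * 2).+1.
  apply: (@acyclic A N Adiv U2 _ 1 (Mx x B)) => //.
  - by move=> v [].
  - by move=> ? ? [].
  - by move=> B' t t' [H1 H2 H3] tt; split=> //; lia.
  - move=> B' t e [H1 H2 [D ED]] [Ue _] Be; split; [by rewrite /= Ue Be|by rewrite /=; lia|].
    by exists (e :: D); rewrite ED.
  - move=> B' t e [H1 H2 [D ED]] Ue Be; split; [by rewrite /= Ue Be|by rewrite /=; lia|].
    by exists (e :: D); rewrite ED.
  - by move=> B'; apply: Mx_ex.
  move=> B' e v h b c [oB' H2 [D ED]] Le Lv Be Bv Bh ph nh Ev.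
  have HM : Mr B' 2 by split=> //; lia.
  have [e1 [e2 [U1 U2' B1 B2 e12]]] := Mr_two HM.
  have act w g : grp B' g -> LX x w -> LX x (w *m g).
    move=> Gg; apply: (@LX_act _ _ x B); apply: grp_sub Gg => b'.
    by rewrite ED mem_cat => ->; rewrite orbT.
  have [f0 [Lf Bf Hf]] : exists f0, [/\ LX x f0, perp B' f0 & eqm (dot e e * dot f0 f0) (- 1)].
    have x1 y : perp B' y -> dot x y = 0.
      by rewrite dotC => /perpP; apply; rewrite ED mem_cat inE eqxx orbT.
    case: (LX_type qx Le) => H; last first.
      exists e1; split=> //; first exact: unit_LX.
      by rewrite U1 mulr1.
    exists (e1 + e2); split; [|exact: perpD|].
      split; first by rewrite sum_two.
      exists 2^-1, 2^-1; apply: half_unit => //; first exact: sum_two.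
      by rewrite dotDr !x1 // addr0.
    rewrite sum_two // -[X in eqm _ X]mul1r; apply: (eqmM Adiv) => //; exact: three_two.
  have [Ue _] := Le; have [Uv _] := Lv.
  exact: (aux_three Adiv U2 K3 act oB' Ue Uv Be Bv Bh ph nh Ev Lf Bf Hf).
by split=> //; exists [::].
Qed.

Lemma Mr_frame (L : V -> Prop) B t (f : seq V) : (forall v, L v -> unit (dot v v)) ->
  Mr B (size f + t) -> frame L B f -> Mr (catrev f B) t.
Proof.
move=> LU; elim: f B => [//|v f IH] B /= HM [Lv Bv Rf]; apply: IH => //.
by apply: Mr_cons => //; apply: LU.
Qed.

(** Two filtrations: over B by the letters [L12], then, for a single letter x of length 2, over x ::
    B by the letters [LX x]. Over B there is room for one filling common to two letters; over x :: B
    it is one place short, which is why [Bd_two] is called for. *)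
Lemma Mr_Acyc3 n B : Mr B (1 + n * 2) -> Acyc B n.
Proof.
elim/ltn_ind: n B => n IH B HM; have [oB Hn] := HM.
move=> z Tz dz.
apply: (@filter A N B B (@L12 A N) n) => //.
- by move=> v; left.
- by move=> v g; apply: L12_act.
- by move=> i ni; apply: Mr_L12; apply: Mr_le HM _; lia.
- move=> f k Rf f3 E; apply: IH; first by lia.
  by apply: (Mr_frame (L := Lt' (@L12 A N))) Rf => [v [/(L12_unit U2)]//|]; apply: Mr_le HM _; lia.
- move=> y1 y2 k c /= [[L1 _] C1 [[L2 _] C2 _]] E Tc dc.
  have [||b Tb Eb] := IH k _ [:: y2, y1 & B] _ c Tc dc; first by lia.
    have HM1 : Mr (y1 :: B) (1 + k * 2).+1 by apply: (@Mr_cons B _ y1 _ (L12_unit U2 L1) C1); apply: Mr_le HM _; lia.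
    exact: (@Mr_cons (y1 :: B) _ y2 HM1 (L12_unit U2 L2) C2).
  exists b, b; rewrite subrr; split=> //; last exact: Bd0.
  + by rewrite E; apply: TT_sub Tb => w wB; rewrite inE wB orbT.
  + by rewrite E; apply: TT_sub Tb => w; rewrite !inE => /orP[->|->]; rewrite ?orbT.
move=> x c [Lx nx] Bx Tc dc; have qx : dot x x = 2 by case: Lx.
have Ux : unit (dot x x) by rewrite qx.
have HMx : Mr (x :: B) (n * 2) by apply: Mr_cons.
apply: (@filter A N B (x :: B) (LX x) n) => //.
- by move=> b bB; rewrite inE bB orbT.
- by move=> v; apply: unit_LX.
- by move=> v g; apply: LX_act.
- by move=> i ni; apply: Mr_LX => //; apply: Mr_le HMx _; lia.
- move=> f k Rf f3 E; apply: IH; first by lia.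
  by apply: (Mr_frame (L := Lt' (LX x))) Rf => [v [[]]//|]; apply: Mr_le HMx _; lia.
- move=> y1 y2 k c' Ry E Tc' dc'; apply: (Bd_two Adiv U2 K3 oB qx Bx Ry E Tc' dc').
  move=> u w ouw; apply: IH; first by lia.
  by split=> //=; lia.
move=> y c' [[Uy [l [mu E]]] _] Cy Tc' dc'.
have [_ By] : True /\ perp B y by split=> //; case/andP: Cy.
have Se : spn [:: y, x & B] (l *: x + mu *: y).
  by apply: spnD; apply: spnZ; apply: spn_mem; rewrite !inE eqxx ?orbT.
have := @cone_Bd A N B [:: y, x & B] n (l *: x + mu *: y) c' E.
rewrite dc' raddf0 subr0; apply=> //; first by apply: perpD; apply: perpZ.
by move=> b bB; rewrite !inE bB !orbT.
Qed.

End Three.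

Theorem rank_stability i :
  ((2 * i + m <= N)%N -> Stab_surj (Nil V) i) /\ ((2 * i.+1 + m <= N)%N -> Stab_inj (Nil V) i).
Proof.
have HQ n B : Mr B (1 + n * 2) -> Acyc B n.
  have [[u [Uu Um Up]]|K3] := residue_cases A; first exact: (Mr_Acyc5 Uu Um Up).
  exact: Mr_Acyc3.
have [S I] := @stability A N Adiv U2 Mr 2 1 isT isT Mr_le
  (fun B t e HM Ue => @Mr_cons B t e HM (unitv_unit Ue)) Mr_ex (fun B n => @HQ n B) i.
by split=> H; [apply: S|apply: I]; split=> //=; lia.
Qed.

End RankStability.

(** * Stability under a Pythagoras condition *)

Section FrameStability.
Variables (A : idomainType) (N : nat).
Hypothesis Adiv : forall a b : A, (exists c, a = c * b) \/ (exists c, b = c * a).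
Hypothesis U2 : unit (2 : A).
Local Notation V := 'rV[A]_N.
Implicit Types (B C D : seq V) (e h v w x y : V) (f s : seq V).
Local Notation unitv := (@unitv A N).
Local Notation acts := (@acts A N).
Local Notation ds := (@ds A N).

Variable p : nat.
Hypothesis p_gt0 : (1 <= p)%N.
Hypothesis PV : forall x : V, unit (dot x x) ->
  exists2 l : seq A, size l = p & dot x x = \sum_(a <- l) a ^+ 2.

Fixpoint comb (l : seq A) f : V :=
  match l, f with a :: l', v :: f' => a *: v + comb l' f' | _, _ => 0 end.

Lemma comb_perp l f y : perp f y -> dot (comb l f) y = 0.
Proof.
elim: l f => [|a l IH] [|v f] /=; rewrite ?dot0l // => /andP[/eqP vy fy].
by rewrite !dotS IH // dotC vy mulr0 addr0.
Qed.

Lemma comb_q C l f : frame unitv C f -> size l = size f -> dot (comb l f) (comb l f) = \sum_(a <- l) a ^+ 2.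
Proof.
elim: l f C => [|a l IH] [|v f] C //=; first by rewrite big_nil dot0l.
move=> [Uv Cv Rf] [E]; have vf : dot (comb l f) v = 0.
  by apply: comb_perp; apply: (frame_perp Rf); exact: mem_head.
by rewrite big_cons !dotS (dotC v) vf (IH _ _ Rf E) Uv; ring.
Qed.

Lemma comb_C C l f : frame unitv C f -> perp C (comb l f).
Proof.
move=> Rf; apply/perpP => c cC; apply: comb_perp.
exact: (frame_perp Rf).
Qed.

Definition Fu B t := exists2 f, frame unitv B f & size f = t.

Lemma Fu_sub B B' t : (forall y, perp B y -> perp B' y) -> Fu B t -> Fu B' t.
Proof. by move=> H [f Rf Sf]; exists f => //; apply: frame_sub Rf. Qed.
Lemma Fu_act B t (g : 'M[A]_N) : g *m g^T = 1%:M -> Fu B t -> Fu (acts B g) t.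
Proof.
move=> gg [f Rf Sf]; exists (acts f g); last by rewrite size_acts.
by apply: frame_act => // v; apply: unitv_act.
Qed.
Lemma Fu_le B t t' : Fu B t -> (t' <= t)%N -> Fu B t'.
Proof.
move=> [f Rf Sf] tt; exists (take t' f); last by rewrite size_takel // Sf.
exact: frame_subseq (take_subseq _ _) Rf.
Qed.
Lemma Fu_nil B : Fu B 0. Proof. by exists [::]. Qed.
Lemma Fu_cons B t : Fu B t.+1 -> exists2 v, unitv v /\ perp B v & Fu (v :: B) t.
Proof. by move=> [[|v f] // [Uv Bv Rf] [Sf]]; exists v => //; exists f. Qed.

Lemma Fu_move B D v w t : dot v v = dot w w -> unit (dot v v) -> perp B v -> perp B w ->
  Fu (D ++ v :: B) t -> exists2 g, grp B g /\ v *m g = w & Fu (acts D g ++ w :: B) t.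
Proof.
move=> E Uv Bv Bw HF; have [g [Gg Eg]] := transit1 Adiv U2 E Uv Bv Bw.
exists g => //; have := Fu_act (grpK Gg) HF.
by rewrite /acts map_cat /= -/(acts B g) (acts_grp Gg) Eg.
Qed.

Lemma Fu_unit B e t : Fu B t.+1 -> unitv e -> perp B e -> Fu (e :: B) t.
Proof.
move=> /Fu_cons[v [Uv Bv] HF] Ue Be.
by have [|g _] := @Fu_move B [::] v e t _ (unitv_unit Uv) Bv Be HF; first by rewrite Uv Ue.
Qed.

Lemma Fu_split B t r : Fu B (r + t) -> exists2 f, frame unitv B f /\ size f = r & Fu (catrev f B) t.
Proof.
move=> [f Rf Sf]; rewrite -(cat_take_drop r f) in Rf; have [R1 R2] := frame_catE Rf.
exists (take r f); first by split=> //; rewrite size_takel // Sf leq_addr.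
by exists (drop r f) => //; rewrite size_drop Sf addKn.
Qed.

(** The length of v is a sum of p squares, so a combination of p frame vectors has this length, and
    an isometry fixing B carries it to v. The list D, orthogonal to the combination, is carried
    along. *)
Lemma Fu_vec B D v t : Fu (D ++ B) (p + t) -> unit (dot v v) -> perp B v ->
  exists2 g, grp B g & Fu (acts D g ++ v :: B) t /\ forall d, d \in D -> dot (d *m g) v = 0.
Proof.
move=> /Fu_split[f [Rf Sf] HF] Uv Bv; have [l Sl El] := PV Uv.
have Cv : perp (D ++ B) (comb l f) := comb_C l Rf.
have /andP[Dv Bv'] : perp D (comb l f) && perp B (comb l f) by rewrite -perp_cat.
have E : dot (comb l f) (comb l f) = dot v v by rewrite (comb_q Rf) ?Sl ?Sf.
have HF' : Fu (D ++ comb l f :: B) t.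
  apply: Fu_sub HF => y; rewrite perp_catrev perp_cat => /and3P[yf yD yB].
  by rewrite perp_cat perp_cons yD yB dotC comb_perp ?eqxx.
have Uc : unit (dot (comb l f) (comb l f)) by rewrite E.
have [g [Gg Eg] HF2] := Fu_move E Uc Bv' Bv HF'.
exists g => //; split=> // d dD; rewrite -Eg dot_orth; last exact: grpK Gg.
by rewrite dotC; move/perpP: Dv; apply.
Qed.

Definition Me B t := ol B /\ Fu B t.

Lemma Me_Acyc5 (u : A) : unit u -> unit (u - 1) -> unit (u + 1) ->
  forall n B, Me B (1 + n * p.+1) -> Acyc B n.
Proof.
move=> Uu Um Up n B HM; apply: Acyc_unit => i ni.
apply: (@acyclic A N Adiv U2 unitv p Me) => //.
- exact: unitv_unit.
- by move=> ? ? [].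
- by move=> B' t t' [oB HF] tt; split=> //; apply: Fu_le HF _.
- by move=> B' t e [oB HF] Ue Be; split; [rewrite /= unitv_unit // Be|exact: Fu_unit].
- move=> B' t v [oB HF] Uv Bv; split; first by rewrite /= Uv Bv.
  by have [g _ []] := @Fu_vec B' [::] v t HF Uv Bv.
- by move=> B' [_ /Fu_cons[e [Ue Be] _]]; exists e.
- move=> B' e v h b c [oB' _] Ue Uv Be Bv Bh ph nh Ev.
  exact: (aux_five Adiv U2 Uu Um Up oB' Ue Uv Be Bv Bh ph nh Ev).
by case: HM => oB HF; split=> //; apply: Fu_le HF _; nia.
Qed.

Lemma Me_le B t t' : Me B t -> (t' <= t)%N -> Me B t'.
Proof. by move=> [oB HF] tt; split=> //; apply: Fu_le HF _. Qed.
Lemma Me_unit B t e : Me B t.+1 -> unitv e -> perp B e -> Me (e :: B) t.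
Proof. by move=> [oB HF] Ue Be; split; [rewrite /= unitv_unit // Be|exact: Fu_unit]. Qed.
Lemma Me_ex B : Me B 1 -> exists2 e, unitv e & perp B e.
Proof. by move=> [_ /Fu_cons[e [Ue Be] _]]; exists e. Qed.

Section Three.
Hypothesis K3 : forall u : A, unit u -> eqm (u ^+ 2) 1.

(** Room for t letters of length 1 or 2: t orthonormal vectors, or t - 1 of them and one x of length
    2. The second form is what remains when a letter of length 2 has been taken from the plane of
    two orthonormal vectors. *)
Definition M3 B t := ol B /\
  (Fu B t \/ exists x, [/\ dot x x = 2, perp B x & exists2 t', t = t'.+1 & Fu (x :: B) t']).

(** 2 is congruent to -1, which is not a square in the field of three elements. *)
Lemma p_gt1 x : unit (dot x x) -> dot x x = 2 -> (2 <= p)%N.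
Proof.
move=> Ux qx; have [l Sl El] := PV Ux; case: p Sl p_gt0 => [//|[|//]] Sl _.
case: l Sl El => [//|a [|//]] _; rewrite qx big_cons big_nil addr0 => E.
have Ua : unit a by move: U2; rewrite E unitrX_pos.
by have := K3 Ua; rewrite -E /eqm (_ : 2 - 1 = 1) ?unitr1 //; ring.
Qed.

Lemma M3_le B t t' : M3 B t -> (t' <= t)%N -> M3 B t'.
Proof.
move=> [oB HF] tt; split=> //; case: HF => [HF|[x [qx Bx [t1 E HF]]]]; first by left; apply: Fu_le HF _.
case: t' tt => [|t'] tt; first by left; apply: Fu_nil.
by right; exists x; split=> //; exists t' => //; apply: Fu_le HF _; lia.
Qed.

Lemma M3_letter B t e : M3 B t.+1 -> L12 e -> perp B e -> M3 (e :: B) t.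
Proof.
move=> [oB HF] Le Be; have Ue := L12_unit U2 Le.
split; first by rewrite /= Ue Be.
case: t HF => [|t] HF; first by left; apply: Fu_nil.
case: Le => qe; case: HF => [HF|[x [qx Bx [t1 [E] HF]]]].
- by left; apply: Fu_unit.
- subst t1; have [v [Uv /andP[/eqP vx Bv]] HF'] := Fu_cons HF.
  have HF2 : Fu ([:: x] ++ v :: B) t by apply: Fu_sub HF' => y /=; rewrite andbCA.
  have [|g [Gg Eg] HF3] := Fu_move _ (unitv_unit Uv) Bv Be HF2; first by rewrite Uv qe.
  right; exists (x *m g); split; [by rewrite dot_orth ?(grpK Gg)| |by exists t].
  rewrite perp_cons (perp_act _ Gg) Bx -Eg dot_orth ?(grpK Gg) // dotC vx eqxx.
  by [].
(* v1 + v2 is carried to e, and v1 - v2, again of length 2, becomes the vector x of the second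
   form. *)
- have [v1 [U1 B1] /Fu_cons[v2 [U2' /andP[/eqP v21 B2]] HF']] := Fu_cons HF.
  have q12 : dot (v1 + v2) (v1 + v2) = 2 by apply: sum_two => //; rewrite dotC.
  have HF2 : Fu ([:: v1 - v2] ++ (v1 + v2) :: B) t.
    apply: Fu_sub HF' => y /= /and3P[/eqP y2 /eqP y1 ->].
    by rewrite !dotS y1 y2 oppr0 addr0 eqxx.
  have [||g [Gg Eg] HF3] := Fu_move _ _ (perpD B1 B2) Be HF2; rewrite ?q12 //.
  right; exists ((v1 - v2) *m g); split; [|rewrite perp_cons (perp_act _ Gg)|by exists t].
    by rewrite dot_orth ?(grpK Gg) // !dotS (dotC v1) v21 U1 U2'; ring.
  rewrite (perpB B1 B2) andbT -Eg dot_orth ?(grpK Gg) // !dotS (dotC v1) v21 U1 U2'.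
  by apply/eqP; ring.
- have HF2 : Fu ([::] ++ x :: B) t1 by [].
  have [||g [Gg Eg] HF3] := Fu_move _ _ Bx Be HF2; rewrite ?qx //.
  by left; rewrite E.
Qed.

Lemma M3_vec B t v : M3 B (p + t) -> unit (dot v v) -> perp B v -> M3 (v :: B) t.
Proof.
move=> [oB HF] Uv Bv; split; first by rewrite /= Uv Bv.
case: HF => [HF|[x [qx Bx [t1 E HF]]]].
  by left; have [g _ []] := @Fu_vec B [::] v t HF Uv Bv.
case: t E => [|t] E; first by left; apply: Fu_nil.
have {E} E : t1 = (p + t)%N by move: E; rewrite addnS => -[].
rewrite E in HF; have [g Gg [HF2 Hd]] := @Fu_vec B [:: x] v t HF Uv Bv.
right; exists (x *m g); split; [by rewrite dot_orth ?(grpK Gg)| |by exists t].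
by rewrite perp_cons (perp_act _ Gg) Bx Hd ?mem_head // eqxx.
Qed.

Lemma M3_two B t : M3 B t.+2 -> exists e x, [/\ unitv e, dot x x = 2, perp B e & perp B x].
Proof.
move=> [_ [/Fu_cons[e [Ue Be] /Fu_cons[v [Uv /andP[/eqP ve Bv]] _]]|[x [qx Bx [t1 [<-] HF]]]]].
  by exists e, (e + v); split=> //; [apply: sum_two => //; rewrite dotC|exact: perpD].
by have [e [Ue /andP[_ Be]] _] := Fu_cons HF; exists e, x.
Qed.

Lemma M3_L12 n B : M3 B (1 + n * p.+1) -> Exact (@L12 A N) B n.
Proof.
apply: (@acyclic A N Adiv U2 _ p M3) => //.
- exact: L12_unit.
- by move=> ? ? [].
- exact: M3_le.
- exact: M3_letter.
- exact: M3_vec.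
- move=> B' [_ [/Fu_cons[e [Ue Be] _]|[x [qx Bx _]]]]; first by exists e => //; left.
  by exists x => //; right.
move=> B' e v h b c HM Le Lv Be Bv Bh ph nh Ev; have [oB' _] := HM.
have [e1 [x [U1 qx B1 Bx]]] := M3_two HM.
have [f0 [Lf Bf Hf]] : exists f0 : V, [/\ L12 f0, perp B' f0 & eqm (dot e e * dot f0 f0) (- 1)].
  case: Le => ->; first by exists x; rewrite qx mul1r; split=> //; [right|exact: three_two].
  by exists e1; rewrite U1 mulr1; split=> //; [left|exact: three_two].
exact: (aux_three Adiv U2 K3 (fun w g => @L12_act A N B' w g) oB' (L12_unit U2 Le) (L12_unit U2 Lv) Be Bv Bh ph nh Ev Lf Bf Hf).
Qed.

Lemma M3_frame B t f : M3 B (size f + t) -> frame (Lt' (@L12 A N)) B f -> M3 (catrev f B) t.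
Proof.
elim: f B => [//|v f IH] B /= HM [[Lv _] Bv Rf]; apply: IH => //.
exact: M3_letter.
Qed.

(** As p is at least 2, one degree frees at least three places, enough for two letters and an
    earlier letter x: pairs always have a common filling. For a single y over x, both of length 2,
    the unit vector (x + y)/2 is an apex. *)
Lemma M3_Acyc n B : M3 B (2 + n * p.+1) -> Acyc B n.
Proof.
elim/ltn_ind: n B => n IH B HM z Tz dz; have [oB _] := HM.
have p2 : (2 <= p)%N.
  have [e [x [_ qx _ _]]] := M3_two (M3_le HM (isT : (2 <= 2 + _)%N)).
  by apply: (@p_gt1 x) => //; rewrite qx.
(* filtering by the letters of length two, over B or over B extended by one such letter *)
have step C : {subset B <= C} -> (exists2 j, M3 C j & (2 + n * p.+1 <= j.+1)%N) ->
    (forall y c, Lt' (@L12 A N) y -> perp C y -> TT (y :: C) n c -> ds c = 0 -> Bd B n c) ->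
    forall c, TT C n c -> ds c = 0 -> Bd B n c.
  move=> BC [j HC Hj] H1; apply: (@filter A N B C (@L12 A N) n) => //.
  - by move=> v; left.
  - by move=> v g; apply: L12_act.
  - by move=> i ni; apply: M3_L12; apply: M3_le HC _; nia.
  - move=> f k Rf f3 E; apply: IH; first by lia.
    by apply: M3_frame Rf; apply: M3_le HC _; nia.
  move=> y1 y2 k c [/= [L1 _] C1 [[L2 _] C2 _]] E Tc dc.
  have HM1 : M3 (y1 :: C) (2 + k * p.+1).+1 by apply: M3_letter => //; apply: M3_le HC _; nia.
  have HM2 : M3 [:: y2, y1 & C] (2 + k * p.+1) by apply: M3_letter.
  have [|b Tb Eb] := IH k _ [:: y2, y1 & C] HM2 c Tc dc; first by lia.
  exists b, b; rewrite subrr; split=> //; last exact: Bd0.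
  + by rewrite E; apply: TT_sub Tb => w wB; rewrite inE wB orbT.
  + by rewrite E; apply: TT_sub Tb => w; rewrite !inE => /orP[->|->]; rewrite ?orbT.
have len2 (y : V) : Lt' (@L12 A N) y -> dot y y = 2 by move=> [[//|]].
apply: (step B) => //; first by exists (2 + n * p.+1)%N.
move=> x c Lx Bx Tc dc; have qx := len2 x Lx.
apply: (step (x :: B)) Tc dc => //.
- by move=> b bB; rewrite inE bB orbT.
- by exists (1 + n * p.+1)%N => //; apply: M3_letter Bx => //; right.
move=> y c' Ly Cy Tc' dc'; have qy := len2 y Ly.
have [/eqP yx By] := andP Cy.
have Ue := half_unit U2 qx qy (etrans (dotC x y) yx).
have Se : spn [:: y, x & B] (2^-1 *: x + 2^-1 *: y).
  by apply: spnD; apply: spnZ; apply: spn_mem; rewrite !inE eqxx ?orbT.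
have := @cone_Bd A N B [:: y, x & B] n (2^-1 *: x + 2^-1 *: y) c' Ue.
rewrite dc' raddf0 subr0; apply=> //; first by apply: perpD; apply: perpZ.
by move=> b bB; rewrite !inE bB !orbT.
Qed.

Lemma M3_ex B : M3 B 2 -> exists2 e, unitv e & perp B e.
Proof. by move=> /M3_two[e [x [Ue _ Be _]]]; exists e. Qed.

End Three.

Theorem frame_stability i : Fu (Nil V) N ->
  ((2 + i * p.+1 <= N)%N -> Stab_surj (Nil V) i) /\ ((2 + i.+1 * p.+1 <= N)%N -> Stab_inj (Nil V) i).
Proof.
move=> HF; have [[u [Uu Um Up]]|K3] := residue_cases A.
  have [S I] := @stability A N Adiv U2 Me p.+1 1 p_gt0 isT Me_le Me_unit Me_ex (fun B n => @Me_Acyc5 u Uu Um Up n B) i.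
  by split=> H; [apply: S|apply: I]; split=> //; apply: Fu_le HF _; lia.
(* The shift by one is needed because a single place of [M3] may hold only a vector of length 2,
   whereas two places always contain a unit vector. *)
have [S I] := @stability A N Adiv U2 (fun B t => M3 B t.+1) p.+1 1 p_gt0 isT
  (fun B t t' H tt => M3_le H (tt : (t'.+1 <= t.+1)%N)) (fun B t e H Ue => M3_letter H (or_introl Ue))
  M3_ex (fun B n => @M3_Acyc K3 n B) i.
by split=> H; [apply: S|apply: I]; split=> //; left; apply: Fu_le HF _; lia.
Qed.

End FrameStability.

(** * Unit vectors over the ring and its quotient field *)

Section Complement.
Variables (A : idomainType) (N : nat).
Hypothesis Adiv : forall a b : A, (exists c, a = c * b) \/ (exists c, b = c * a).
Hypothesis U2 : unit (2 : A).
Local Notation V := 'rV[A]_N.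
Implicit Types (B E : seq V) (x y z h v : V).

Lemma projD B x y : proj B (x + y) = proj B x + proj B y.
Proof.
elim: B => [//|b B IH] /=; rewrite IH dotDl mulrDl scalerDl opprD addrACA.
by [].
Qed.
Lemma projZ B a x : proj B (a *: x) = a *: proj B x.
Proof. by elim: B => [//|b B IH] /=; rewrite IH dotZl scalerBr scalerA mulrA. Qed.
Lemma proj_perp_id B x : perp B x -> proj B x = x.
Proof.
elim: B => [//|b B IH] /= /andP[/eqP xb Bx].
by rewrite IH // xb mul0r scale0r subr0.
Qed.
Lemma proj_sum B (I : finType) (F : I -> V) : proj B (\sum_i F i) = \sum_i proj B (F i).
Proof.
apply: (big_morph (proj B) (projD B)).
by rewrite -[X in proj B X](scale0r 0) projZ scale0r.
Qed.

Lemma dot_delta x j : dot x (delta_mx 0 j) = x 0 j.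
Proof.
rewrite dotE (bigD1 j) //= mxE !eqxx mulr1 big1 ?addr0 // => i /negbTE ij.
by rewrite mxE eqxx ij mulr0.
Qed.

Lemma qstdE x : qstd x = dot x x.
Proof. by rewrite dotE; apply: eq_bigr => j _; rewrite expr2. Qed.
Lemma BstdE x y : Bstd x y = 2 * dot x y.
Proof. by rewrite /Bstd !qstdE !dotS (dotC y); ring. Qed.

Lemma span_proj (K : fieldType) (g : {rmorphism A -> K}) (S : 'M[K]_N) B x :
  (forall b, b \in B -> (map_mx g b <= S)%MS) -> (map_mx g (x - proj B x)%R <= S)%MS.
Proof.
elim: B => [|b B IH] HS /=; first by rewrite subrr map_mx0 sub0mx.
rewrite opprB addrCA addrC map_mxD addmx_sub //.
  by apply: IH => b' bB; apply: HS; rewrite inE bB orbT.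
by rewrite map_mxZ scalemx_sub // HS ?mem_head.
Qed.

(** If every basis vector projected to zero, B would span the whole space over K, against its size.
    Otherwise let h be the primitive part of a nonzero projection and x dual to it: one of h, x, h +
    x has invertible length. *)
Lemma ol_extend1 (K : fieldType) (g : {rmorphism A -> K}) B : ol B -> (size B < N)%N ->
  exists2 v, unit (dot v v) & perp B v.
Proof.
move=> oB SB.
have [j nz] : exists j, proj B (delta_mx 0 j) != 0.
  apply/existsP; apply: contraT; rewrite negb_exists => /forallP H.
  pose S : 'M[K]_(size B, N) := \matrix_(i < size B) map_mx g (nth 0 B i).
  have HS b : b \in B -> (map_mx g b <= <<S>>)%MS.
    move=> bB; rewrite genmxE; have bi : (index b B < size B)%N by rewrite index_mem.
    have -> : map_mx g b = row (Ordinal bi) S by rewrite rowK /= nth_index.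
    exact: row_sub.
  have : (1%:M <= S)%MS.
    apply/row_subP => i; rewrite rowE mulmx1.
    have -> : delta_mx 0 i = map_mx g (delta_mx 0 i - proj B (delta_mx 0 i)).
      by have := H i; rewrite negbK => /eqP->; rewrite subr0 map_delta_mx.
    by have := @span_proj K g <<S>>%MS B (delta_mx 0 i) HS; rewrite genmxE.
  move=> /mxrankS; rewrite mxrank1 => /leq_trans /(_ (rank_leq_row S)).
  by rewrite leqNgt SB.
have [c [h [E ph c0]]] := prim_decomp Adiv nz.
have Bh : perp B h.
  have := proj_perp (delta_mx 0 j) oB; rewrite E => /perpP H; apply/perpP => b bB.
  by have /eqP := H b bB; rewrite dotZl mulf_eq0 (negbTE c0) => /eqP.
have [x [Bx hx]] := prim_dual oB Bh ph.
case: (boolP (unit (dot h h))) => [U|nh]; first by exists h.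
case: (boolP (unit (dot x x))) => [U|nx]; first by exists x.
exists (h + x); last exact: perpD.
have -> : dot (h + x) (h + x) = 2 + dot h h + dot x x.
  by rewrite !dotS (dotC x h) hx; ring.
by rewrite (unitDl Adiv) // (unitDl Adiv).
Qed.

Lemma ol_extend (K : fieldType) (g : {rmorphism A -> K}) B t : ol B -> (t + size B <= N)%N ->
  exists2 E, size E = t & ol (E ++ B).
Proof.
move=> oB; elim: t => [|t IH] tN; first by exists [::].
have [E SE oE] := IH (ltnW tN).
have [|v Uv Ev] := ol_extend1 g oE; first by rewrite size_cat SE.
by exists (v :: E); rewrite /= ?SE // Uv Ev.
Qed.

Lemma nunit_sum (I : finType) (F : I -> A) : (forall i, ~~ unit (F i)) -> ~~ unit (\sum_i F i).
Proof.
move=> H; elim/big_rec: _ => [|i x _ nx]; first by rewrite unitr0.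
exact: (nunitD Adiv).
Qed.

(* The orthogonal complement of B is a nonsingular direct summand of rank N - |B|. *)
Lemma unit_in_complement (K : fieldType) (g : {rmorphism A -> K}) d : unitvec_prop A d ->
  forall B, ol B -> (size B + d <= N)%N -> exists2 e : V, unitv e & perp B e.
Proof.
move=> UP B oB BN.
have zero x : perp B x -> (forall y, perp B y -> dot x y = 0) -> x = 0.
  move=> Bx H; apply/rowP => j; rewrite mxE -dot_delta dotC -(dot_proj _ oB Bx) dotC.
  by apply: H; apply: proj_perp.
have sub0 : perp B 0 by apply/perpP => c _; rewrite dot0l.
have [|||e [Be qe]] := UP N (fun x => perp B x).
- split; first by split=> // a x y Bx By; apply: perpD => //; apply: perpZ.
  exists (fun x => forall y, perp B y -> dot x y = 0); split.
    split=> [y _|a x y Hx Hy z Bz]; first by rewrite dot0l.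
    by rewrite dotDl dotZl Hx // Hy // mulr0 addr0.
  split=> // x; exists (proj B x), (x - proj B x); split; first exact: proj_perp.
  split; last by rewrite addrC subrK.
  by move=> y By; rewrite dotDl dotNl (dot_proj _ oB By) subrr.
- split=> [x Bx H|phi phiL].
    apply: zero => // y By; have := H y By; rewrite BstdE => /eqP.
    have /negbTE n2 : (2 : A) != 0 by apply: contraTneq U2 => ->; rewrite unitr0.
    by rewrite mulf_eq0 n2 => /eqP.
  pose s : V := \row_j phi (proj B (delta_mx 0 j)).
  (* The factor 1/2 compensates for [Bstd] being twice [dot]. *)
  exists (2^-1 *: proj B s); split; first by apply/perpZ/proj_perp.
  move=> y By; rewrite BstdE dotZl mulrA divrr // mul1r (dot_proj _ oB By).
  have phi0 : phi 0 = 0.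
    by have := phiL (-1) 0 0 sub0 sub0; rewrite scaler0 addr0 mulN1r addNr.
  (* [phi] is linear only on the complement of B, so the partial sums have to be shown to stay
     inside it. *)
  have phiS (I : seq 'I_N) (F : 'I_N -> A) :
      phi (\sum_(j <- I) F j *: proj B (delta_mx 0 j)) = \sum_(j <- I) F j * phi (proj B (delta_mx 0 j)) /\
      perp B (\sum_(j <- I) F j *: proj B (delta_mx 0 j)).
    elim: I => [|j I [IH1 IH2]]; first by rewrite !big_nil.
    rewrite !big_cons; have Bj := proj_perp (delta_mx 0 j) oB.
    split; first by rewrite phiL // IH1.
    by apply: perpD => //; apply: perpZ.
  have {1}-> : y = \sum_j y 0 j *: proj B (delta_mx 0 j).
    rewrite -{1}(proj_perp_id By) {1}(row_sum_delta y) proj_sum.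
    by apply: eq_bigr => j _; rewrite projZ.
  have [-> _] := phiS (index_enum 'I_N) (fun j => y 0 j).
  by rewrite dotE; apply: eq_bigr => j _; rewrite mxE mulrC.
- have [|E SE] := ol_extend g (t := d) oB; first by rewrite addnC.
  rewrite ol_cat => /and3P[oE _ /allP EB].
  exists (fun j : 'I_d => nth 0 E j); split.
    by move=> j; apply: EB; rewrite mem_nth // SE.
  move=> a [r [c [w [Hw Ew]]]] j; rewrite /maxid.
  have pw : pairwise (fun x y : V => dot x y == 0) E.
    elim: (E) oE => [//|v E' IH] /= /and3P[_ /allP Ev /IH->]; rewrite andbT.
    by apply/allP => y /Ev.
  have orth i k : (i < k)%N -> (k < d)%N -> dot (nth 0 E i) (nth 0 E k) = 0.
    by move=> ik kd; apply/eqP/(pairwiseP 0 pw); rewrite // inE SE //; apply: ltn_trans kd.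
  have Uj : unit (dot (nth 0 E j) (nth 0 E j)).
    have : (j < size E)%N by rewrite SE.
    move: (nat_of_ord j) => i; elim: (E) i oE => [//|v E' IH] [|i] /= /and3P[Uv _ oE'] //.
    exact: IH.
  have dj : dot (\sum_(k < d) a k *: nth 0 E k) (nth 0 E j) = a j * dot (nth 0 E j) (nth 0 E j).
    have dsum (I : seq 'I_d) : dot (\sum_(k <- I) a k *: nth 0 E k) (nth 0 E j) =
        \sum_(k <- I) a k * dot (nth 0 E k) (nth 0 E j).
      elim: I => [|k I IH]; first by rewrite !big_nil dot0l.
      by rewrite !big_cons dotDl dotZl IH.
    rewrite dsum (bigD1 j) //= big1 ?addr0 // => k kj.
    case: (ltngtP k j) => [H|H|H]; first by rewrite orth // mulr0.
      by rewrite dotC orth // mulr0.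
    by case/eqP: kj; apply: val_inj.
  have dm : ~~ unit (dot (\sum_(k < r) c k *: w k) (nth 0 E j)).
    have dsum (I : seq 'I_r) : dot (\sum_(k <- I) c k *: w k) (nth 0 E j) =
        \sum_(k <- I) c k * dot (w k) (nth 0 E j).
      elim: I => [|k I IH]; first by rewrite !big_nil dot0l.
      by rewrite !big_cons dotDl dotZl IH.
    rewrite dsum; apply: nunit_sum => k; apply: nunitMl; exact: (proj1 (Hw k)).
  by move: dm; rewrite -Ew dj unitrM Uj andbT.
by exists e => //; rewrite /unitv -qstdE.
Qed.

(* The line through h/t and x meets the quadric of vectors of length d in a second point, which is integral. *)
Lemma kneser B h d t : ol B -> perp B h -> prim h -> dot h h = d * t ^+ 2 ->
  exists2 e, dot e e = d & perp B e.
Proof.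
move=> oB Bh ph qh; case: (boolP (unit t)) => [Ut|nt].
  exists (t^-1 *: h); last exact: perpZ.
  have E : t * t^-1 = 1 by rewrite divrr.
  by rewrite !dotS qh -[RHS]mulr1 -[X in _ = d * X]mulr1 -E; ring.
have [x [Bx hx]] := prim_dual oB Bh ph.
(* [ep] is t times the length of x - h/t. It is congruent to -2 because t is a nonunit, so the
   second point has no denominator. *)
pose ep := d * t - 2 + t * dot x x.
have Ue : unit ep.
  rewrite /ep -addrA addrC -addrA (unitDl Adiv) ?unitrN //.
  by apply: (nunitD Adiv); [exact: nunitMl|exact: nunitMr].
exists (((dot x x - d) / ep) *: h + (2 * (d * t - 1) / ep) *: x); last by apply: perpD; apply: perpZ.
have E : ep * ep^-1 = 1 by rewrite divrr.
have E2 : ep ^+ 2 * ep^-1 ^+ 2 = 1 by rewrite -exprMn E expr1n.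
rewrite !dotS (dotC x h) hx qh -[RHS]mulr1 -[X in _ = d * X]E2 /ep.
move: (ep^-1) => i; ring.
Qed.

End Complement.

(** * Descent from the quotient field, and Hensel lifting *)

Section Valuation.
Variable A : idomainType.
Hypothesis hval : valuation_ring A.
Hypothesis U2 : unit (2 : A).
Local Notation K := {fraction A}.
Local Notation tof := (@FracField.tofrac A).

Lemma tof_eq0 a : (tof a == 0) = (a == 0). Proof. exact: tofrac_eq0. Qed.
Lemma tof_inj : injective tof. Proof. by move=> a b /eqP; rewrite tofrac_eq => /eqP. Qed.

Lemma val_div (a b : A) : (exists c, a = c * b) \/ (exists c, b = c * a).
Proof.
have [->|b0] := eqVneq b 0; first by right; exists 0; rewrite mul0r.
have [->|a0] := eqVneq a 0; first by left; exists 0; rewrite mul0r.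
have fa : tof a != 0 by rewrite tof_eq0. have fb : tof b != 0 by rewrite tof_eq0.
have [|[c E]|[c E]] := hval (x := tof a / tof b); first by rewrite mulf_neq0 ?invr_eq0.
  by left; exists c; apply: tof_inj; rewrite rmorphM /= -E divfK.
by right; exists c; apply: tof_inj; rewrite rmorphM /= -E invf_div divfK.
Qed.

Lemma val_frac (x : K) : exists nd : A * A, nd.2 != 0 /\ tof nd.2 * x = tof nd.1.
Proof.
have [->|x0] := eqVneq x 0; first by exists (0, 1); rewrite oner_neq0 mulr0 rmorph0.
have [[a ->]|[a E]] := hval x0; first by exists (a, 1); rewrite oner_neq0 rmorph1 mul1r.
exists (1, a); rewrite /= -E mulVf // rmorph1; split=> //.
by rewrite -tof_eq0 -E invr_eq0.
Qed.

Lemma common_denominator N (v : 'rV[K]_N) : exists a (w : 'rV[A]_N), a != 0 /\ tof a *: v = map_mx tof w.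
Proof.
have /fin_all_exists[nd H] j := val_frac (v 0 j).
exists (\prod_j (nd j).2), (\row_j ((\prod_(i | i != j) (nd i).2) * (nd j).1)); split.
  by apply/prodf_neq0 => j _; case: (H j).
apply/rowP => j; rewrite !mxE (bigD1 j) //= !rmorphM /= -(proj2 (H j)).
by rewrite mulrAC [RHS]mulrC.
Qed.

Lemma dot_map N (x y : 'rV[A]_N) : dot (map_mx tof x) (map_mx tof y) = tof (dot x y).
Proof. by rewrite !dotE rmorph_sum; apply: eq_bigr => j _; rewrite !mxE rmorphM. Qed.

Lemma perp_map N (B : seq 'rV[A]_N) x : perp (map (map_mx tof) B) (map_mx tof x) = perp B x.
Proof.
rewrite /perp all_map; apply: eq_all => b /=.
by rewrite dot_map tof_eq0.
Qed.

Lemma ol_map N (B : seq 'rV[A]_N) : ol B -> ol (map (map_mx tof) B).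
Proof.
elim: B => [//|b B IH] /= /and3P[Ub Bb /IH->]; rewrite perp_map Bb /= !andbT dot_map.
by rewrite unitfE tof_eq0; apply: contraTneq Ub => ->; rewrite unitr0.
Qed.

(** Clearing denominators and dividing by the content gives a primitive h with c^2 (h, h) = a^2 d.
    Since one of a, c divides the other and d is a unit, (h, h) = d t^2 for some t, and the secant
    construction applies. *)
Lemma descend N (B : seq 'rV[A]_N) (e : 'rV[K]_N) d : ol B -> unit d -> dot e e = tof d ->
  perp (map (map_mx tof) B) e -> exists2 e', dot e' e' = d & perp B e'.
Proof.
move=> oB Ud qe Be; have [a [w [a0 Ew]]] := common_denominator e.
have Bw : perp B w by rewrite -perp_map -Ew; apply: perpZ.
have qw : dot w w = a ^+ 2 * d.
  by apply: tof_inj; rewrite -dot_map -Ew !dotS qe expr2 !rmorphM /= mulrA.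
have d0 : d != 0 by apply: contraTneq Ud => ->; rewrite unitr0.
have w0 : w != 0.
  apply: contraTneq d0 => E; move: qw; rewrite E dot0l => /esym/eqP.
  by rewrite mulf_eq0 expf_eq0 (negbTE a0) /= negbK.
have [c [h [E ph c0]]] := prim_decomp val_div w0.
have Bh : perp B h.
  apply/perpP => b bB; move/perpP: Bw => /(_ b bB) /eqP.
  by rewrite E dotZl mulf_eq0 (negbTE c0) => /eqP.
have qh : c ^+ 2 * dot h h = a ^+ 2 * d by rewrite -qw E !dotS expr2 mulrA.
have [t Et] : exists t, dot h h = d * t ^+ 2.
  have [[t Et]|[s Es]] := val_div a c.
    exists t; apply: (mulfI (_ : c ^+ 2 != 0)); first by rewrite expf_neq0.
    by rewrite qh Et; ring.
  have qs : s ^+ 2 * dot h h = d.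
    apply: (mulfI (_ : a ^+ 2 != 0)); first by rewrite expf_neq0.
    by rewrite -qh Es; ring.
  have Us : unit s by move: Ud; rewrite -qs unitrM unitrX_pos // => /andP[].
  exists s^-1; rewrite -[in RHS]qs.
  by rewrite mulrAC -exprMn divrr // expr1n mul1r.
exact: (kneser val_div U2 oB Bh ph Et).
Qed.

Lemma frac_div (a b : K) : (exists c, a = c * b) \/ (exists c, b = c * a).
Proof.
have [->|b0] := eqVneq b 0; first by right; exists 0; rewrite mul0r.
by left; exists (a / b); rewrite divfK.
Qed.

Lemma frac_two : unit (2 : K).
Proof.
have -> : 2 = tof 2 by rewrite rmorph_nat.
by rewrite unitfE tof_eq0; apply: contraTneq U2 => ->; rewrite unitr0.
Qed.

Lemma unit_vector_ring d N (B : seq 'rV[A]_N) : unitvec_prop A d -> ol B -> (size B + d <= N)%N ->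
  exists2 e, unitv e & perp B e.
Proof. by move=> H; apply: (unit_in_complement val_div U2 tof H). Qed.

Lemma unit_vector_field d N (B : seq 'rV[A]_N) : unitvec_prop K d -> ol B -> (size B + d <= N)%N ->
  exists2 e, unitv e & perp B e.
Proof.
move=> H oB BN; have [|e Ue Be] := unit_in_complement frac_div frac_two idfun H (ol_map oB).
  by rewrite size_map.
have [||e' Ue' Be'] := @descend N B e 1 oB _ _ Be; rewrite ?unitr1 // ?rmorph1 //.
by exists e'.
Qed.

(** A representation by p squares over K is a vector of K^p with length (x, x); it descends to A
    because this length is a unit. *)
Lemma squares_field p N (x : 'rV[A]_N) : pyth_le K p -> unit (dot x x) ->
  exists2 l : seq A, size l = p & dot x x = \sum_(a <- l) a ^+ 2.
Proof.
move=> H Ux; have [l [Sl El]] := H [seq tof (x 0 j) | j <- enum 'I_N].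
pose e : 'rV[K]_p := \row_(i < p) nth 0 l i.
have qe : dot e e = tof (dot x x).
  rewrite !dotE rmorph_sum /=; rewrite big_map big_enum /= in El.
  transitivity (\sum_(j < N) tof (x 0 j) ^+ 2); last by apply: eq_bigr => j _; rewrite rmorphM expr2.
  by rewrite El (big_nth 0) big_mkord Sl; apply: eq_bigr => i _; rewrite mxE expr2.
have [e' qe' _] := @descend p [::] e _ isT Ux qe isT.
exists [seq e' 0 j | j <- enum 'I_p]; first by rewrite size_map size_enum_ord.
rewrite big_map big_enum /= -qe' dotE; apply: eq_bigr => j _.
by rewrite expr2.
Qed.

(** Of the p squares that represent the length modulo the maximal ideal, at least one is a unit.
    Correcting this single entry is a quadratic equation with derivative 2u, solvable by Hensel's
    lemma. *)
Lemma squares_henselian p N (x : 'rV[A]_N) : henselian A -> pyth_le_res A p -> unit (dot x x) ->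
  exists2 l : seq A, size l = p & dot x x = \sum_(a <- l) a ^+ 2.
Proof.
move=> Hh H Ux; have [l [Sl]] := H [seq x 0 j | j <- enum 'I_N].
have -> : \sum_(a <- [seq x 0 j | j <- enum 'I_N]) a ^+ 2 = dot x x.
  by rewrite big_map big_enum /= dotE; apply: eq_bigr => j _; rewrite expr2.
move=> El; have Ul : unit (\sum_(a <- l) a ^+ 2).
  by rewrite -(eqm_unit val_div (El : eqm (dot x x) _)).
have [u ul Uu] : exists2 u, u \in l & unit u.
  apply/hasP; apply: contraTT Ul => /hasPn Hn; rewrite big_seq.
  elim/big_rec: _ => [|a s al ns]; first by rewrite unitr0.
  by apply: (nunitD val_div) => //; rewrite expr2; apply: nunitMl; apply: Hn.
have [l1 [l2 El2]] : exists l1 l2, l = l1 ++ u :: l2.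
  by case/splitPr: ul => l1 l2; exists l1, l2.
pose s := \sum_(a <- l1) a ^+ 2 + \sum_(a <- l2) a ^+ 2.
have Es : \sum_(a <- l) a ^+ 2 = s + u ^+ 2.
  by rewrite El2 big_cat big_cons /s /=; ring.
pose f : {poly A} := 'X^2 - (dot x x - s)%:P.
have [||a [fa _]] := Hh f u.
- rewrite /f !hornerE /maxid; move: El; rewrite Es /maxid.
  have -> : u ^+ 2 - (dot x x - s) = - (dot x x - (s + u ^+ 2)) by ring.
  by rewrite unitrN.
- have -> : (f^`()).[u] = 2 * u.
    by rewrite /f derivB derivXn derivC subr0 hornerMn hornerXn expr1 mulr_natl.
  by rewrite /maxid unitrM U2 Uu.
have Ea : a ^+ 2 = dot x x - s.
  by move/eqP: fa; rewrite /f !hornerE subr_eq0 => /eqP.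
exists (l1 ++ a :: l2); first by rewrite -Sl El2 !size_cat.
by rewrite big_cat big_cons /= Ea /s; ring.
Qed.

Lemma frame_basis N : Fu (Nil 'rV[A]_N) N.
Proof.
have H (s : seq 'rV[A]_N) C : all (fun v : 'rV[A]_N => dot v v == 1) s ->
    pairwise (fun x y : 'rV[A]_N => dot x y == 0) s -> all (perp C) s -> frame (@unitv A N) C s.
  elim: s C => [//|v s IH] C /= /andP[/eqP Uv Us] /andP[vs ps] /andP[Cv Cs]; split=> //.
  apply: IH => //; apply/allP => y ys; rewrite perp_cons (allP Cs y ys) andbT dotC.
  exact: (allP vs).
have dd (i j : 'I_N) : dot (delta_mx 0 i : 'rV[A]_N) (delta_mx 0 j) = (i == j)%:R.
  by rewrite dot_delta mxE eqxx /= eq_sym.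
exists [seq delta_mx 0 j | j <- enum 'I_N]; last by rewrite size_map size_enum_ord.
apply: H.
- by rewrite all_map; apply/allP => j _ /=; rewrite dd eqxx.
- rewrite pairwise_map; have := enum_uniq 'I_N; rewrite uniq_pairwise.
  by apply: sub_pairwise => i j /= /negbTE ij; rewrite dd ij.
- by rewrite all_map; apply/allP.
Qed.

End Valuation.

(** * Comparison with the bar complex *)

Section Chains.
Variable T : choiceType.
Implicit Types (c : seq (int * T)) (t : T).

Definition of_chain c : fr T := [freeg c].

Lemma of_chainE c t : coeff t (of_chain c) = \sum_(x <- c | x.2 == t) x.1.
Proof. exact: coeff_Freeg. Qed.

Lemma of_chain_eq (a b : fr T) : (forall t, coeff t a = coeff t b) -> a = b.
Proof. by move=> H; apply/eqP/freeg_eqP. Qed.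

Lemma of_chain_nil : of_chain [::] = 0.
Proof. by apply: of_chain_eq => t; rewrite [LHS]of_chainE big_nil coeff0. Qed.

Lemma of_chain_cat c c' : of_chain (c ++ c') = of_chain c + of_chain c'.
Proof. by apply: of_chain_eq => t; rewrite coeffD !of_chainE big_cat. Qed.

Lemma of_chain_cons x c : of_chain (x :: c) = << x.2 >> *~ x.1 + of_chain c.
Proof.
apply: of_chain_eq => t; rewrite coeffD -freegUZ coeffU !of_chainE big_cons.
by case: eqP => _; rewrite ?mulr1 // mulr0 add0r.
Qed.

Lemma of_chain_scale k c : of_chain [seq (k * e.1, e.2) | e <- c] = of_chain c *~ k.
Proof.
elim: c => [|x c IH] /=; first by rewrite of_chain_nil mul0rz.
by rewrite !of_chain_cons IH mulrzDl -mulrzA mulrC.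
Qed.

Lemma of_chain_opp c : of_chain [seq (- x.1, x.2) | x <- c] = - of_chain c.
Proof.
elim: c => [|x c IH] /=; first by rewrite of_chain_nil oppr0.
by rewrite !of_chain_cons IH mulrNz opprD.
Qed.

Lemma of_chain_sup (P : T -> Prop) c : (forall x, x \in c -> P x.2) -> sup P (of_chain c).
Proof.
elim: c => [|x c IH] H; first by rewrite of_chain_nil; apply: sup0.
rewrite of_chain_cons; apply: supD; last by apply: IH => y yc; apply: H; rewrite inE yc orbT.
have Px : sup P << x.2 >> by apply/supU/H/mem_head.
case: x.1 => k; rewrite ?NegzE ?mulrNz; [|apply: supN].
  by elim: k => [|k IHk]; rewrite ?mulr0z ?intS ?mulrzDr ?mulr1z; [exact: sup0|exact: supD].
by elim: k.+1 => [|j IHj]; rewrite ?mulr0z ?intS ?mulrzDr ?mulr1z; [exact: sup0|exact: supD].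
Qed.

Definition to_chain (a : fr T) : seq (int * T) := [seq (coeff t a, t) | t <- dom a].
Lemma to_chainK a : of_chain (to_chain a) = a.
Proof.
exact: Freeg_dom.
Qed.
Lemma to_chain_sup (P : T -> Prop) a x : sup P a -> x \in to_chain a -> P x.2.
Proof. by move=> Sa /mapP[t ta ->]; exact: (supE Sa). Qed.

End Chains.

Lemma of_chain_map (T T' : choiceType) (f : T -> T') (c : seq (int * T)) :
  of_chain [seq (x.1, f x.2) | x <- c] = lin (fun t => << f t >>) (of_chain c).
Proof.
elim: c => [|x c IH] /=; first by rewrite !of_chain_nil raddf0.
by rewrite !of_chain_cons IH raddfD /= raddfMz /= linU.
Qed.

Lemma del_sum (T : choiceType) (u : seq T) :
  del u = \sum_(j <- iota 0 (size u)) << take j u ++ drop j.+1 u >> *~ (-1) ^+ j.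
Proof.
elim: u => [|x u IH] /=; first by rewrite big_nil.
rewrite big_cons drop0 expr0 mulr1z; congr (_ + _).
rewrite IH raddf_sum -sumrN (iotaDl 1 0) big_map; apply: eq_bigr => j _.
by rewrite raddfMz /= cnsU add1n exprS mulN1r mulrNz.
Qed.

Section Bar.
Variables (A : idomainType) (N : nat).
Local Notation M := 'M[A]_N.
Local Notation V := 'rV[A]_N.
Implicit Types (s u : seq M) (g : M) (B : seq V).

Definition bd1 s : fr (seq M) := of_chain (bar_bd_gen (@mulmx A N N N) s).

Lemma of_chain_bd (c : chain M) : of_chain (bar_bd (@mulmx A N N N) c) = lin bd1 (of_chain c).
Proof.
elim: c => [|x c IH]; first by rewrite !of_chain_nil raddf0.
by rewrite /bar_bd /= of_chain_cat -/(bar_bd _ c) IH of_chain_scale of_chain_cons raddfD /= raddfMz /= linU.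
Qed.

(* Homogeneous coordinates u_0, ..., u_i correspond to the bar coordinates u_(j-1) u_j^-1. *)
Definition quo g (h : M) := g *m h^T.
Definition bars u : seq M := if u is g :: u' then pairmap quo g u' else [::].
Fixpoint unbars g s : seq M := g :: (if s is h :: s' then unbars (h^T *m g) s' else [::]).

Lemma size_unbars g s : size (unbars g s) = (size s).+1.
Proof. by elim: s g => [//|h s IH] g /=; rewrite IH. Qed.
Lemma size_bars u : size (bars u) = (size u).-1.
Proof. by case: u => //= g u; rewrite size_pairmap. Qed.

Lemma unbarsK g s : g *m g^T = 1%:M -> (forall h, h \in s -> h *m h^T = 1%:M) -> bars (unbars g s) = s.
Proof.
move=> /= + H; elim: s g H => [//|h s IH] g H gg.
have hh := H h (mem_head _ _).
have gh : (h^T *m g) *m (h^T *m g)^T = 1%:M.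
  by rewrite trmx_mul trmxK mulmxA -(mulmxA h^T) gg mulmx1; apply: mulmx1C.
have := IH (h^T *m g); rewrite /bars /=; case: s H {IH} => [|h' s] H IH /=.
  by rewrite /quo trmx_mul trmxK mulmxA gg mul1mx.
rewrite /= in IH; rewrite IH //.
  by rewrite /quo trmx_mul trmxK mulmxA gg mul1mx.
by move=> k ks; apply: H; rewrite inE ks orbT.
Qed.

Lemma barsK g u : (forall h, h \in g :: u -> h *m h^T = 1%:M) -> unbars g (bars (g :: u)) = g :: u.
Proof.
rewrite /bars; elim: u g => [//|h u IH] g H /=; congr (_ :: _).
have gg := H g (mem_head _ _).
rewrite /quo trmx_mul trmxK -mulmxA (mulmx1C gg) mulmx1 IH // => k ku.
by apply: H; rewrite inE ku orbT.
Qed.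

Lemma bars_act g u : g *m g^T = 1%:M -> bars [seq h *m g | h <- u] = bars u.
Proof.
move=> gg; case: u => [//|h u] /=; elim: u h => [//|k u IH] h /=; rewrite IH; congr (_ :: _).
by rewrite /quo trmx_mul mulmxA -(mulmxA h) gg mulmx1.
Qed.

(** Deleting an inner vertex multiplies the two adjacent quotients; deleting the first or the last
    one drops a quotient. *)
Lemma bars_face u j : (1 < size u)%N -> (j < size u)%N -> (forall h, h \in u -> h *m h^T = 1%:M) ->
  bars (take j u ++ drop j.+1 u) = bar_face (@mulmx A N N N) (bars u) j.
Proof.
case: u => [//|g u] Su ju H; rewrite /bar_face size_bars /=.
case: j ju => [|j] ju /=.
  by rewrite drop0; case: u Su {H ju} => //= h u.
rewrite ltnS in ju; case: (altP (j.+1 =P size u)) => [E|ne].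
  have -> : drop j.+1 u = [::] by rewrite drop_oversize // E.
  rewrite cats0 -E /=; rewrite -{2}(cat_take_drop j u) pairmap_cat take_size_cat //.
  by rewrite size_pairmap size_takel // ltnW.
have lt2 : (j.+1 < size u)%N by rewrite ltn_neqAle ne.
case Es : (pairmap quo g u) => [|b0 bs].
  by move: (size_pairmap quo g u); rewrite Es => /esym/size0nil E; rewrite E in Su.
rewrite -Es {bs Es}.
have [s1 [x [y [s2 [Eu S1]]]]] : exists s1 x y s2, u = s1 ++ [:: x, y & s2] /\ size s1 = j.
  exists (take j u), (nth g u j), (nth g u j.+1), (drop j.+2 u).
  by rewrite -(drop_nth g lt2) -(drop_nth g ju) cat_take_drop size_takel // ltnW.
have Ex : x *m x^T = 1%:M by apply: H; rewrite Eu inE mem_cat !inE eqxx !orbT.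
have P1 : pairmap quo g u = pairmap quo g s1 ++ [:: quo (last g s1) x, quo x y & pairmap quo y s2].
  by rewrite Eu pairmap_cat.
have P2 : size (pairmap quo g s1) = j by rewrite size_pairmap.
have -> : take j u ++ drop j.+1 u = s1 ++ y :: s2.
  by rewrite Eu take_size_cat // -(cat_rcons x) drop_size_cat // size_rcons S1.
rewrite pairmap_cat /= P1 take_size_cat //; congr (_ ++ _ :: _).
  rewrite !nth_cat P2 ltnn subnn /= ltnNge leqnSn /= subSnn /= /quo.
  by rewrite mulmxA -(mulmxA (last g s1)) (mulmx1C Ex) mulmx1.
have E2 : (j.+2 - j = 2)%N by lia.
by rewrite drop_cat P2 ltnNge (leqW (leqW (leqnn j))) /= E2 /= drop0.
Qed.

Definition homog : fr (seq M) -> fr (seq V * seq M) := lin (fun s => << ([::], unbars 1%:M s) >>).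
Definition inhomog : fr (seq V * seq M) -> fr (seq M) := lin (fun p => << bars p.2 >>).
HB.instance Definition _ := GRing.Additive.on homog.
HB.instance Definition _ := GRing.Additive.on inhomog.

Definition Bs B i s := size s = i /\ forall g, g \in s -> grp B g.

Lemma unbars_grp B g s : grp B g -> (forall h, h \in s -> grp B h) -> forall h, h \in unbars g s -> grp B h.
Proof.
elim: s g => [|k s IH] g Gg Gs h /=; first by rewrite inE => /eqP->.
rewrite inE => /orP[/eqP->//|]; apply: IH.
  by apply: grpM => //; apply/grpT/Gs/mem_head.
by move=> l ls; apply: Gs; rewrite inE ls orbT.
Qed.

Lemma bars_grp B u : (forall h, h \in u -> grp B h) -> forall h, h \in bars u -> grp B h.
Proof.
case: u => [//|g u] /=; elim: u g => [//|k u IH] g Gu h /=.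
rewrite inE => /orP[/eqP->|].
  apply: grpM; first exact/Gu/mem_head.
  by apply/grpT/Gu; rewrite !inE eqxx orbT.
by apply: IH => l lu; apply: Gu; rewrite inE lu orbT.
Qed.

Lemma homog_LL B i a : sup (Bs B i) a -> LL 0 B i (homog a).
Proof.
move=> Sa; apply: (sup_lin Sa) => s [Ss Gs]; apply: supU; split; last by rewrite /= size_unbars Ss.
split; last by case: (s) => [|h s'] /=; eexists.
split=> //= g; apply: unbars_grp => //; exact: grp1.
Qed.

Lemma inhomog_sup B i c : LL 0 B i c -> sup (Bs B i) (inhomog c).
Proof.
move=> Lc; apply: (sup_lin Lc) => -[s u] [[[/= _ Gu] _] Su]; apply: supU; split.
  by rewrite size_bars; move: Su; rewrite /= add0n => ->.
exact: bars_grp.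
Qed.

Lemma homogK B i a : sup (Bs B i) a -> inhomog (homog a) = a.
Proof.
move=> Sa; rewrite /homog lin_add; apply: (lin_id Sa) => s [_ Gs].
rewrite /= [inhomog _]linU unbarsK //; first by rewrite trmx1 mulmx1.
by move=> h /Gs [].
Qed.

Lemma inhomogK B i c : LL 0 B i c -> homog (inhomog c) = c.
Proof.
move=> Lc; rewrite /inhomog lin_add; apply: (lin_id Lc) => -[s u] [[[/= [_ /size0nil ->] Gu] [u' Eu]] _].
by rewrite /= [homog _]linU Eu barsK // => h; rewrite -Eu => /Gu [].
Qed.

Lemma inhomog_db B i c : LL 0 B i c -> inhomog (db c) = lin bd1 (inhomog c).
Proof.
case: i => [|i] Lc.
  (* In degree 0 both sides vanish by convention: [nf] kills the empty simplex, and [bar_bd_gen] is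
     zero on the empty tuple. *)
  rewrite (db_LL0 Lc) raddf0 /inhomog lin_lin; symmetry.
  rewrite (eq_lin (g := fun=> 0) Lc) ?lin_0 // => -[s u] [[_ [u' /= ->]] /=].
  by rewrite linU add0n => -[/size0nil ->]; exact: of_chain_nil.
apply: (eq_add (F := inhomog \o db (N:=N)) (G := lin bd1 \o inhomog) Lc) => -[s u] [[[/= _ Gu] _] Su].
rewrite add0n in Su; have Su2 : (1 < size u)%N by rewrite Su.
rewrite /db /dbar delrU [inhomog << _ >>]linU linU /=.
have Sd : sup (fun v => (exists g v', v = g :: v' /\ g *m g^T = 1%:M)) (del u).
  apply: sub_sup (supI (del_sub u) (del_size u)) _ => v [vu Sv].
  case: v vu Sv => [|g v] vu Sv; first by rewrite -Sv in Su2.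
  have Gg : grp B g by apply: Gu; exact: (mem_subseq vu (mem_head _ _)).
  by exists g, v; split=> //; exact: grpK Gg.
transitivity (lin (fun v => << bars v >>) (del u)).
  rewrite /nf lin_lin lin_add; apply: (eq_lin Sd) => v [g [v' [-> gg]]].
  rewrite linU /nfg /= [inhomog _]linU /actu /=.
  have gT : g^T *m g^T^T = 1%:M by rewrite trmxK; apply: mulmx1C.
  by have := bars_act (g :: v') gT => /= ->.
rewrite del_sum raddf_sum /bd1.
have -> : bar_bd_gen (@mulmx A N N N) (bars u) =
    [seq ((-1) ^+ j, bar_face (@mulmx A N N N) (bars u) j) | j <- iota 0 (size u)].
  have : size (bars u) = i.+1 by rewrite size_bars Su.
  rewrite /bar_bd_gen; case E : (bars u) => [//|b bs] /= [->].
  by rewrite Su.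
have Hr : forall j, j \in iota 0 (size u) -> (j < size u)%N by move=> j; rewrite mem_iota.
elim: (iota _ _) Hr => [|j r IH] Hr /=; first by rewrite big_nil of_chain_nil.
rewrite big_cons of_chain_cons IH; last by move=> k kr; apply: Hr; rewrite inE kr orbT.
congr (_ + _); rewrite raddfMz /= linU bars_face //; first exact/Hr/mem_head.
by move=> h /Gu [].
Qed.

End Bar.

(** * O_n as the stabilizer of the last basis vector in O_(n+1) *)

Section Transfer.
Variables (A : idomainType) (n : nat).
Hypothesis U2 : unit (2 : A).
Local Notation st := (@stab A n).
Local Notation V := 'rV[A]_(n + 1).

Lemma orthP N (g : 'M[A]_N) : orth g <-> grp [::] g.
Proof.
split=> [[Ug H]|[gg _]].
  split=> //; have H2 (x y : 'rV[A]_N) : dot (x *m g) (y *m g) = dot x y.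
    have : 2 * dot (x *m g) (y *m g) = 2 * dot x y.
      by rewrite -!BstdE /Bstd -mulmxDl !H.
    by move/(mulrI U2).
  apply/matrixP => i j; have := H2 (delta_mx 0 i) (delta_mx 0 j).
  rewrite dot_delta dotE -!rowE !mxE eqxx /= eq_sym => <-.
  by apply: eq_bigr => k _; rewrite !mxE.
split=> [|x]; first by case: (mulmx1_unit gg).
by rewrite !qstdE dot_orth.
Qed.

Definition elast : V := row_mx 0 1%:M.

Lemma elast_unit : unitv elast.
Proof. by rewrite /unitv /dot /elast tr_row_mx mul_row_col trmx0 mulmx0 add0r trmx1 mulmx1 mxE. Qed.

Lemma stabM (g h : 'M[A]_n) : st (g *m h) = st g *m st h.
Proof. by rewrite /stab mulmx_block !(mulmx0, mul0mx, addr0, add0r, mulmx1). Qed.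

Lemma stabK : cancel st ulsubmx.
Proof. by move=> g; rewrite /stab block_mxKul. Qed.

Lemma stab_grp (g : 'M[A]_n) : orth g -> grp [:: elast] (st g).
Proof.
move=> /orthP[gg _]; split.
  rewrite /stab tr_block_mx !trmx0 trmx1 mulmx_block gg !(mulmx0, mul0mx, addr0, add0r, mulmx1).
  by rewrite -scalar_mx_block.
move=> b; rewrite inE => /eqP->; rewrite /elast /stab mul_row_block.
by rewrite !(mulmx0, mul0mx, addr0, add0r, mulmx1).
Qed.

(** Fixing the last basis vector determines the last row; the same for the transpose, which is the
    inverse, determines the last column. *)
Lemma grp_stab (g : 'M[A]_(n + 1)) : grp [:: elast] g -> orth (ulsubmx g) /\ st (ulsubmx g) = g.
Proof.
move=> Gg; have E (h : 'M[A]_(n + 1)) : grp [:: elast] h -> dlsubmx h = 0 /\ drsubmx h = 1%:M.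
  move=> [_ /(_ elast (mem_head _ _))]; rewrite -{1}(submxK h) /elast mul_row_block.
  by rewrite !(mul0mx, add0r, mul1mx) => /eq_row_mx.
have [d1 d2] := E g Gg; have [d3 _] := E _ (grpT Gg).
have u1 : ursubmx g = 0 by rewrite -[ursubmx g]trmxK trmx_ursub d3 trmx0.
have Eg : st (ulsubmx g) = g by rewrite /stab -[RHS]submxK d1 d2 u1.
split=> //; apply/orthP; split=> //.
have [gg _] := Gg; have := etrans gg (@scalar_mx_block _ n 1 1).
rewrite -{1 2}Eg /stab tr_block_mx !trmx0 trmx1 mulmx_block !(mulmx0, mul0mx, addr0, add0r, mulmx1).
by move=> /eq_block_mx[].
Qed.

Lemma bar_face_map (s : seq 'M[A]_n) j : (j <= size s)%N ->
  bar_face (@mulmx A _ _ _) (map st s) j = map st (bar_face (@mulmx A _ _ _) s j).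
Proof.
rewrite /bar_face size_map leq_eqVlt => /orP[js|js]; last rewrite (ltn_eqF js).
  by rewrite js; case: ifP => _; [case: (s)|rewrite map_take].
case: j js => [|j] js /=; first by case: (s).
case: s js => [//|g s] /= js.
rewrite map_cat /= map_take map_drop; congr (_ ++ _ :: _).
rewrite -[st g :: map st s]/(map st (g :: s)) !(nth_map g) /= ?stabM //; exact: ltnW.
Qed.

Definition stl : fr (seq 'M[A]_n) -> fr (seq 'M[A]_(n + 1)) := lin (fun s => << map st s >>).
Definition ull : fr (seq 'M[A]_(n + 1)) -> fr (seq 'M[A]_n) :=
  lin (fun s => << map (fun g : 'M[A]_(n + 1) => ulsubmx g : 'M[A]_n) s >>).
HB.instance Definition _ := GRing.Additive.on stl.
HB.instance Definition _ := GRing.Additive.on ull.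
Local Notation bd1n := (@bd1 A n).
Local Notation bd1N := (@bd1 A (n + 1)).

Lemma stlK a : ull (stl a) = a.
Proof.
rewrite /stl lin_add; apply: (lin_id (sup_T _)) => s _; rewrite /= [ull _]linU -map_comp.
by congr (<< _ >>); rewrite -[RHS]map_id; apply: eq_map => g /=; rewrite stabK.
Qed.

Lemma stl_bd a : lin bd1N (stl a) = stl (lin bd1n a).
Proof.
rewrite /stl lin_add [RHS]lin_lin; apply: eq_lin_fun => s; rewrite /= linU /bd1 -of_chain_map.
congr of_chain; case: s => [//|g s]; rewrite /bar_bd_gen /= -/(map st (g :: s)) size_map.
rewrite -!bar_face_map // -map_comp; congr [:: _, _ & _].
by apply/eq_in_map => j; rewrite mem_iota => /andP[_ js] /=; rewrite -bar_face_map.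
Qed.

Definition Os i (s : seq 'M[A]_n) := size s = i /\ forall g, g \in s -> orth g.
Local Notation B0 := (Nil V).

Lemma stl_sup i a : sup (Os i) a -> sup (Bs [:: elast] i) (stl a).
Proof.
move=> Sa; apply: (sup_lin Sa) => s [Ss Gs]; apply: supU; split; first by rewrite size_map.
by move=> g /mapP[h /Gs Oh ->]; apply: stab_grp.
Qed.

Lemma ull_sup i a : sup (Bs [:: elast] i) a -> sup (Os i) (ull a) /\ stl (ull a) = a.
Proof.
move=> Sa; split.
  apply: (sup_lin Sa) => s [Ss Gs]; apply: supU; split; first by rewrite size_map.
  by move=> g /mapP[h /Gs /grp_stab[Oh _] ->].
rewrite /ull lin_add; apply: (lin_id Sa) => s [_ Gs]; rewrite /= [stl _]linU -map_comp.
congr (<< _ >>); rewrite -[RHS]map_id; apply/eq_in_map => g /Gs Gg /=.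
by have [_] := grp_stab Gg.
Qed.

Lemma cycle_of_chain N i (P : 'M[A]_N -> Prop) (c : chain 'M[A]_N) : is_cycle (@mulmx A N N N) P i c ->
  sup (fun s => size s = i /\ forall g, g \in s -> P g) (of_chain c) /\ lin (@bd1 A N) (of_chain c) = 0.
Proof.
move=> [Hc dc]; split; first exact: of_chain_sup.
rewrite -of_chain_bd; apply: of_chain_eq => t; rewrite of_chainE coeff0.
exact: dc.
Qed.

Lemma of_chain_boundary N i (P : 'M[A]_N -> Prop) (c : chain 'M[A]_N) b :
  sup (fun s => size s = i.+1 /\ forall g, g \in s -> P g) b -> lin (@bd1 A N) b = of_chain c ->
  is_boundary (@mulmx A N N N) P i c.
Proof.
move=> Sb Eb; exists (to_chain b); split; first by move=> x xb; exact: (to_chain_sup Sb xb).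
move=> t; have := congr1 (coeff t) Eb.
by rewrite -[b]to_chainK -of_chain_bd !of_chainE to_chainK.
Qed.

Lemma Bs_orth i a : sup (fun s : seq 'M[A]_(n + 1) => size s = i /\ forall g, g \in s -> orth g) a <-> sup (Bs B0 i) a.
Proof.
by split=> Sa; apply: sub_sup Sa _ => s [Ss Gs]; split=> // g /Gs /orthP.
Qed.

Lemma perp_nil (v : V) : perp B0 v. Proof. by []. Qed.

Lemma transfer_surj i : Stab_surj B0 i -> stab_surj A n i.
Proof.
move=> HS z' Cz'; have [Sz dz] := cycle_of_chain Cz'; move/Bs_orth in Sz.
have Lc := homog_LL Sz.
have dc : db (homog (of_chain z')) = 0.
  case: i {HS Cz'} Sz Lc => [|i] Sz Lc; first exact: db_LL0 Lc.
  by rewrite -(inhomogK (db_LL Lc)) (inhomog_db Lc) (homogK Sz) dz raddf0.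
have [c' [Lc' dc'] [h Lh Eh]] := HS elast elast_unit (perp_nil _) _ Lc dc.
have [Sn En] := ull_sup (inhomog_sup Lc').
exists (to_chain (ull (inhomog c'))); split.
  split=> [x xb|t]; first exact: (to_chain_sup Sn xb).
  suff E : lin bd1n (ull (inhomog c')) = 0.
    have := congr1 (coeff t) E; rewrite -{1}[ull (inhomog c')]to_chainK -of_chain_bd of_chainE coeff0.
    by [].
  by rewrite -[LHS]stlK -stl_bd En -(inhomog_db Lc') dc' !raddf0.
apply: (@of_chain_boundary _ _ _ _ (inhomog h)).
  by apply/Bs_orth; apply: inhomog_sup Lh.
rewrite -(inhomog_db Lh) Eh raddfB /= (homogK Sz) of_chain_cat of_chain_opp; congr (_ - _).
by rewrite of_chain_map -/(stl _) to_chainK En.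
Qed.

Lemma transfer_inj i : Stab_inj B0 i ->
  hom_inj (@mulmx A n n n) (@mulmx A (n + 1) (n + 1) (n + 1)) (@orth A n) (@orth A (n + 1)) st i.
Proof.
move=> HI z Cz [w [Hw Ew]]; have [Sz dz] := cycle_of_chain Cz.
have Ss := stl_sup Sz; have Lc := homog_LL Ss.
have dst : lin bd1N (stl (of_chain z)) = 0 by rewrite stl_bd dz raddf0.
have dc : db (homog (stl (of_chain z))) = 0.
  case: i {HI Cz Hw Sz} Ss Lc => [|i] Ss Lc; first exact: db_LL0 Lc.
  by rewrite -(inhomogK (db_LL Lc)) (inhomog_db Lc) (homogK Ss) dst raddf0.
have Sw : sup (Bs B0 i.+1) (of_chain w) by apply/Bs_orth; apply: of_chain_sup.
have Lw := homog_LL Sw.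
have Edw : lin bd1N (of_chain w) = stl (of_chain z).
  rewrite -of_chain_bd /stl -of_chain_map; apply: of_chain_eq => t; rewrite !of_chainE.
  exact: Ew.
have HH : Hm 0 B0 i (homog (stl (of_chain z))).
  exists (homog (of_chain w)) => //.
  by rewrite -(inhomogK (db_LL Lw)) (inhomog_db Lw) (homogK Sw) Edw.
have [h Lh Eh] := HI elast elast_unit (perp_nil _) _ Lc dc HH.
have [Sh Eh'] := ull_sup (inhomog_sup Lh).
apply: (of_chain_boundary Sh).
by rewrite -[LHS]stlK -stl_bd Eh' -(inhomog_db Lh) Eh (homogK Ss) stlK.
Qed.

End Transfer.

(** * Numerical ranges of the eight cases *)

Lemma qle_nat i n b c d : (0 < d)%N -> qle i n b c d -> (i * d + b + c <= n)%N.
Proof.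
move=> d0; rewrite /qle ler_pdivlMr ?ltr0n // !lerBrDr -!natrM -!natrD ler_nat.
by rewrite addnAC.
Qed.

Theorem theorem3p9 (A : idomainType) (hval : valuation_ring A)
  (h2 : (2 : A) \is a GRing.unit) (n : nat) (hn : (1 <= n)%N) :
  (* (i) *)
  (forall mA, is_m_inv A mA -> forall i : nat,
     (qle i n mA 1 3 -> stab_surj A n i) /\ (qle i n mA 2 3 -> stab_iso A n i)) /\
  (* (ii) *)
  (forall mA, is_m_inv A mA -> formally_real A -> forall i : nat,
     (qle i n mA 0 2 -> stab_surj A n i) /\ (qle i n mA 1 2 -> stab_iso A n i)) /\
  (* (iii) *)
  (forall p, henselian A -> is_pyth_res A p -> forall i : nat,
     (qle i n 3 (2 * p) (2 * p + 1) -> stab_surj A n i) /\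
     (qle i n 4 (2 * p) (2 * p + 1) -> stab_iso A n i)) /\
  (* (iv) *)
  (forall p, henselian A -> formally_real_res A -> is_pyth_res A p -> forall i : nat,
     (qle i n 2 p (p + 1) -> stab_surj A n i) /\
     (qle i n 3 p (p + 1) -> stab_iso A n i)) /\
  (* (v) *)
  (forall mK, is_m_inv {fraction A} mK -> forall i : nat,
     (qle i n mK 1 3 -> stab_surj A n i) /\ (qle i n mK 2 3 -> stab_iso A n i)) /\
  (* (vi) *)
  (forall mK, is_m_inv {fraction A} mK -> formally_real {fraction A} -> forall i : nat,
     (qle i n mK 0 2 -> stab_surj A n i) /\ (qle i n mK 1 2 -> stab_iso A n i)) /\
  (* (vii) *)
  (forall p, is_pyth {fraction A} p -> forall i : nat,
     (qle i n 3 (2 * p) (2 * p + 1) -> stab_surj A n i) /\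
     (qle i n 4 (2 * p) (2 * p + 1) -> stab_iso A n i)) /\
  (* (viii) *)
  (forall p, formally_real {fraction A} -> is_pyth {fraction A} p -> forall i : nat,
     (qle i n 2 p (p + 1) -> stab_surj A n i) /\
     (qle i n 3 p (p + 1) -> stab_iso A n i)).
Proof.
have Adiv := val_div hval.
have rank m : (1 <= m)%N -> (forall B : seq 'rV[A]_(n + 1), ol B -> (size B + m <= n + 1)%N ->
      exists2 e, unitv e & perp B e) ->
    forall i, ((i * 2 + m <= n)%N -> stab_surj A n i) /\ ((i * 2 + m + 1 <= n)%N -> stab_iso A n i).
  move=> m1 UV i; have [S I] := rank_stability Adiv h2 m1 UV i.
  have HS : (i * 2 + m <= n)%N -> stab_surj A n i by move=> H; apply: transfer_surj => //; apply: S; lia.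
  split=> // H; split; first by apply: HS; lia.
  by apply: transfer_inj => //; apply: I; lia.
have frames p : (1 <= p)%N -> (forall x : 'rV[A]_(n + 1), unit (dot x x) ->
      exists2 l : seq A, size l = p & dot x x = \sum_(a <- l) a ^+ 2) ->
    forall i, ((i * (p + 1) + 2 + p <= n)%N -> stab_surj A n i) /\
      ((i * (p + 1) + 3 + p <= n)%N -> stab_iso A n i).
  move=> p1 PV i; have [S I] := frame_stability Adiv h2 p1 PV i (frame_basis A (n + 1)).
  have HS : (i * (p + 1) + 2 + p <= n)%N -> stab_surj A n i.
    by move=> H; apply: transfer_surj => //; apply: S; nia.
  split=> // H; split; first by apply: HS; lia.
  by apply: transfer_inj => //; apply: I; nia.
have rank_ring m : is_m_inv A m -> forall i, _ :=
  fun H => rank m (proj1 H) (fun B => unit_vector_ring hval h2 (proj1 (proj2 H))).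
have rank_field m : is_m_inv {fraction A} m -> forall i, _ :=
  fun H => rank m (proj1 H) (fun B => unit_vector_field hval h2 (proj1 (proj2 H))).
have frame_res p : henselian A -> is_pyth_res A p -> forall i, _ :=
  fun Hh H => frames p (proj1 H) (fun x => squares_henselian hval h2 Hh (proj1 (proj2 H))).
have frame_field p : is_pyth {fraction A} p -> forall i, _ :=
  fun H => frames p (proj1 H) (fun x => squares_field hval h2 (proj1 (proj2 H))).
(* The range of slope 2 contains that of slope 3: 3 i + m + 1 <= n implies 2 i + m <= n, and
   similarly for isomorphisms. *)
have q3 i m : (qle i n m 1 3 -> (i * 2 + m <= n)%N) /\ (qle i n m 2 3 -> (i * 2 + m + 1 <= n)%N).
  by split=> /qle_nat => /(_ isT); lia.
have q2 i m : (qle i n m 0 2 -> (i * 2 + m <= n)%N) /\ (qle i n m 1 2 -> (i * 2 + m + 1 <= n)%N).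
  by split=> /qle_nat => /(_ isT); lia.
(* Likewise i (2 p + 1) + 3 + 2 p <= n implies i (p + 1) + 2 + p <= n. *)
have r2 i p : (qle i n 3 (2 * p) (2 * p + 1) -> (i * (p + 1) + 2 + p <= n)%N) /\
    (qle i n 4 (2 * p) (2 * p + 1) -> (i * (p + 1) + 3 + p <= n)%N).
  by split=> /qle_nat; rewrite addn1 => /(_ isT); nia.
have r1 i p : (qle i n 2 p (p + 1) -> (i * (p + 1) + 2 + p <= n)%N) /\
    (qle i n 3 p (p + 1) -> (i * (p + 1) + 3 + p <= n)%N).
  by split=> /qle_nat; rewrite addn1 => /(_ isT).
have both (P Q P' Q' P1 Q1 : Prop) : (P' -> P) /\ (Q' -> Q) -> (P -> P1) /\ (Q -> Q1) -> (P' -> P1) /\ (Q' -> Q1) by tauto.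
split; [|split; [|split; [|split; [|split; [|split; [|split]]]]]].
- by move=> m H i; apply: both (q3 i m) (rank_ring m H i).
- by move=> m H _ i; apply: both (q2 i m) (rank_ring m H i).
- by move=> p Hh H i; apply: both (r2 i p) (frame_res p Hh H i).
- by move=> p Hh _ H i; apply: both (r1 i p) (frame_res p Hh H i).
- by move=> m H i; apply: both (q3 i m) (rank_field m H i).
- by move=> m H _ i; apply: both (q2 i m) (rank_field m H i).
- by move=> p H i; apply: both (r2 i p) (frame_field p H i).
- by move=> p _ H i; apply: both (r1 i p) (frame_field p H i).
Qed.
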